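(* Let $p\ge 2$, $\theta,\alpha\ge 0$ and $\mu>0$ be real numbers such that $\alpha-(p-1)=0$ and $\mu\le\mu_{\alpha,\theta}$. Then there exists a positive nonincreasing function $u\in W^{1,p}_{\alpha,\theta}(0,\infty)$ with $\|u\|_{W^{1,p}_{\alpha,\theta}(0,\infty)}=1$ such that $$d(\theta,\alpha,\mu)=\int_0^\infty A_{p,\mu}(|u(x)|)\,d\lambda_\theta(x)$$ in each of the following cases: (i) $p\ge 3$ and $0<\mu<\mu_{\alpha,\theta}$; (ii) $p=2$ and $\frac{2}{B(2,\theta)}<\mu<\mu_{\alpha,\theta}$.
   Context: For $\beta\ge 0$ put $\omega_\beta=\frac{2\pi^{(1+\beta)/2}}{\Gamma((1+\beta)/2)}$ and $d\lambda_\beta(x)=\omega_\beta x^\beta dx$ on $(0,\infty)$. For $1\le q<\infty$, $L^q_\beta(0,\infty)$ is the space of measurable $u$ on $(0,\infty)$ with $\|u\|_{L^q_\beta(0,\infty)}=\left(\int_0^\infty|u|^q\,d\lambda_\beta\right)^{1/q}<\infty$. For $\alpha,\theta\ge0$, $W^{1,p}_{\alpha,\theta}(0,\infty)=\{u\in L^p_\theta(0,\infty):\ u'\in L^p_\alpha(0,\infty),\ \lim_{x\to\infty}u(x)=0\}$ (with $u$ locally absolutely continuous, $u'$ its derivative), with norm $\|u\|_{W^{1,p}_{\alpha,\theta}(0,\infty)}=\left(\|u'\|^p_{L^p_\alpha(0,\infty)}+\|u\|^p_{L^p_\theta(0,\infty)}\right)^{1/p}$. $\lfloor p\rfloor$ denotes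 the largest integer strictly less than $p$. For $t\ge0$, $A_{p,\mu}(t)=e^{\mu t^{p/(p-1)}}-\sum_{j=0}^{\lfloor p\rfloor-1}\frac{\mu^j}{j!}t^{\frac{p}{p-1}j}$. $\mu_{\alpha,\theta}:=(1+\theta)\,\omega_\alpha^{1/\alpha}$. With $\alpha=p-1$, $$d(\theta,\alpha,\mu):=\sup_{0\ne u\in W^{1,p}_{\alpha,\theta}(0,\infty)}\int_0^\infty A_{p,\mu}\left(\frac{|u(x)|}{\|u\|_{W^{1,p}_{\alpha,\theta}(0,\infty)}}\right)d\lambda_\theta(x).$$ The constant $B(2,\theta)$ is defined by $$B(2,\theta)^{-1}:=\inf_{0\ne u\in W^{1,2}_{1,\theta}(0,\infty)}\frac{\|u'\|^2_{L^2_1(0,\infty)}\,\|u\|^2_{L^2_\theta(0,\infty)}}{\|u\|^4_{L^4_\theta(0,\infty)}}.$$ *)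

(* Defs.v *)
From HB Require Import structures.
From mathcomp Require Import all_boot all_order all_algebra.
From mathcomp Require Import all_classical all_reals all_analysis.

Set Implicit Arguments.
Unset Strict Implicit.
Unset Printing Implicit Defensive.

Import Order.TTheory GRing.Theory Num.Theory.
Import numFieldNormedType.Exports.

Local Open Scope classical_set_scope.
Local Open Scope ring_scope.

Definition GammaR (R : realType) (s : R) : R :=
  \int[lebesgue_measure]_(t in `]0%R, +oo[) (t `^ (s - 1) * expR (- t)).

Definition omega (R : realType) (beta : R) : R :=
  2 * pi `^ ((1 + beta) / 2) / GammaR ((1 + beta) / 2).

(* The integral over (0, oo) of f with respect to the weighted measure
   d lambda_beta = omega_beta x^beta dx. *)
Definition int_lambda (R : realType) (beta : R) (f : R -> R) : \bar R :=
  (\int[lebesgue_measure]_(x in `]0%R, +oo[)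
     (f x * (omega beta * x `^ beta))%R%:E)%E.

(* Functions on (0, oo) are represented by functions R -> R whose values on
   ]-oo, 0] are never looked at. *)
Definition norm_L (R : realType) (q beta : R) (u : R -> R) : \bar R :=
  (int_lambda beta (fun x => `|u x| `^ q)%R `^ (q^-1)%R)%E.

Definition in_L (R : realType) (q beta : R) (u : R -> R) : Prop :=
  measurable_fun (`]0, +oo[ : set R) u /\ (norm_L q beta u < +oo)%E.

(* The intervals of the family are disjoint up to endpoints. *)
Definition abs_cont (R : realType) (s t : R) (u : R -> R) : Prop :=
  forall e : R, 0 < e -> exists2 d : R, 0 < d &
    forall (n : nat) (a b : 'I_n -> R),
      (forall i, [/\ s <= a i, a i <= b i & b i <= t]) ->
      trivIset setT (fun i => `]a i, b i[%classic) ->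
      \sum_(i < n) (b i - a i) < d ->
      \sum_(i < n) `|u (b i) - u (a i)| < e.

Definition loc_abs_cont (R : realType) (u : R -> R) : Prop :=
  forall s t : R, 0 < s -> s < t -> abs_cont s t u.

(* A locally absolutely continuous u is derivable almost everywhere on (0, oo);
   at the remaining points the total function derive1 u takes a junk value, which
   the integrals do not see. *)
Definition in_W (R : realType) (p alpha theta : R) (u : R -> R) : Prop :=
  [/\ loc_abs_cont u, in_L p theta u, in_L p alpha (derive1 u) &
      u x @[x --> +oo] --> (0 : R)].

Definition norm_W (R : realType) (p alpha theta : R) (u : R -> R) : \bar R :=
  ((norm_L p alpha (derive1 u) `^ p + norm_L p theta u `^ p) `^ (p^-1)%R)%E.

Definition in_W_neq0 (R : realType) (p alpha theta : R) (u : R -> R) : Prop :=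
  in_W p alpha theta u /\ exists2 x : R, 0 < x & u x != 0.

(* The largest integer strictly less than p (not the usual floor: it is p - 1
   at an integer p); see strict_floorP. *)
Definition strict_floor (R : realType) (p : R) : int := Num.ceil p - 1.

Lemma strict_floorP (R : realType) (p : R) :
  (strict_floor p)%:~R < p /\
  forall m : int, m%:~R < p -> m <= strict_floor p.
Proof.
split; first exact: ceilB1_lt.
by move=> m mp; rewrite /strict_floor lerBrDr lezD1 ceil_gt_int.
Qed.

(* For p > 1 the integer strict_floor p is nonnegative, so that its absolute
   value is the natural number itself. *)
Definition A_fun (R : realType) (p mu t : R) : R :=
  expR (mu * t `^ (p / (p - 1))) -
  \sum_(j < `|strict_floor p|%N) mu ^+ j / (j`!)%:R * t `^ (p / (p - 1) * j%:R).

Definition mu_crit (R : realType) (alpha theta : R) : R :=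
  (1 + theta) * omega alpha `^ alpha^-1.

(* To be used with alpha = p - 1. *)
Definition d_sup (R : realType) (p theta alpha mu : R) : \bar R :=
  ereal_sup [set int_lambda theta
      (fun x => A_fun p mu (`|u x| / fine (norm_W p alpha theta u)))
    | u in [set u | in_W_neq0 p alpha theta u]].

(* The constant B(2, theta), as the inverse of an infimum. *)
Definition B2 (R : realType) (theta : R) : \bar R :=
  ((ereal_inf [set norm_L 2%R 1%R (derive1 u) ^+ 2 * norm_L 2%R theta u ^+ 2
                     / norm_L 4%R theta u ^+ 4
    | u in [set u | in_W_neq0 2%R 1%R theta u]])^-1)%E.

(* Main.v *)
Require Import Defs.
From HB Require Import structures.
From mathcomp Require Import all_boot all_order all_algebra.
From mathcomp Require Import all_classical all_reals all_analysis.
From mathcomp Require Import measurable_realfun.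
From mathcomp Require Import ring lra.

(** Write c for the coefficient of t^p and R for the rest, so that A(t) = c t^p + R(t)
    (Aabs_split); c vanishes unless p is an integer. R(t) is at least a constant times
    t^r with r > p (Rem_ge), and it is the part of A with a compactness property. Since
    alpha = p - 1, the gradient term is an energy in the variable ln x: it does not
    change under u(x) -> u(x/s), whereas every integral against lambda_theta is
    multiplied by s^(theta+1). The direct method works, and this scaling decides what
    can go wrong in it.

    Only nonnegative nonincreasing profiles matter. The decreasing rearrangement with
    respect to lambda_theta keeps all the integrals of functions of |u|
    (int_lambda_equidistr) and does not raise the energy (rearr_energy): where the
    rearrangement falls from one level to another, |u| does so at least as steeply in
    the variable ln x (rearr_crossing). The proofs avoid differentiating limits and
    rearrangements by replacing the gradient integral with a supremum of sums of chord
    energies |v b - v a|^p / ln(b/a)^(p-1) over disjoint segments (energy_le). Such a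
    supremum passes to pointwise limits, can be estimated by cutting segments, and
    equals the gradient integral (W_energy, energy_grad_le).

    Take a maximizing sequence of normalized profiles. Locally bounded monotone
    functions have a pointwise convergent subsequence (adm_precompact). Below the
    critical value of mu, the bound on v near 0 that the energy gives, of order (ln
    1/x)^((p-1)/p), makes all the R(v) lie below one integrable function
    (adm_dominated), so their integrals converge. The term c |v|_p^p may lose mass at
    infinity. Hence d is at most c l + (integral of R(v)), where l is at least the mass
    of v and omega times the energy plus l is at most 1 (maximizing_profile). A dilation
    of v restores the lost mass at no cost in energy, and it can only increase the
    integral of R(v); so a maximizer exists unless v = 0, and v = 0 would force d <= c
    (exists_maximizer).

    That d > c follows by testing small multiples of a fixed profile, of amplitude
    t^(1/p), dilated to norm 1 (dilation_gap): the energy costs a multiple of t, and R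
    gains a multiple of t^(r/p-1). For p >= 3 either c = 0 or r < 2p, and small t are
    enough. For p = 2 both terms are linear in t, and the comparison of their
    coefficients for a near-optimal function of the quotient defining B(2,theta) is
    exactly the hypothesis 2 / B(2,theta) < mu (lead_lt_d_sup2).

    Finally A(l t) >= l A(t) for l >= 1, so a profile that leaves part of the constraint
    unused cannot be optimal (adm_strict): the maximizer has norm 1
    (maximizer_saturates). If it vanished from x0 on, one could stop its steep descent
    slightly before x0, keep the value reached up to x0, and come down over the interval
    from x0 to 2 x0; for a start close enough to x0 this releases part of the constraint
    and lowers the function nowhere, which is impossible (maximizer_positive). *)

Set Implicit Arguments.
Unset Strict Implicit.
Unset Printing Implicit Defensive.

Import Order.TTheory GRing.Theory Num.Theory.
Import numFieldNormedType.Exports.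

Local Open Scope classical_set_scope.
Local Open Scope ring_scope.

(** * Absolutely continuous functions on a segment *)

Lemma open_itv_bounded (R : realType) (J : set R) : open J -> is_interval J ->
  (lebesgue_measure J < +oo)%E -> exists ab : R * R, ab.1 <= ab.2 /\ J = `]ab.1, ab.2[%classic.
Proof.
move=> oJ /is_intervalP JE muJ.
have empty : J = set0 -> exists ab : R * R, ab.1 <= ab.2 /\ J = `]ab.1, ab.2[%classic.
  by move=> ->; exists (0, 0); rewrite set_itv_ge// bnd_simp ltxx.
have {}oJ : J = J° by apply/esym/interior_id.
move: JE oJ muJ; case: (Rhull J) => [[b1 x|[|]] [b2 y|[|]]] JE.
- rewrite [in RHS]JE interior_itv_bnd => {}JE _.
  have [xy|yx] := leP x y; first by exists (x, y).
  exists (x, x); split => //=.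
  by rewrite JE !set_itv_ge// bnd_simp -leNgt// ltW.
- by rewrite [in RHS]JE set_itv_ge// interior0 => /empty.
- by move=> _; rewrite JE lebesgue_measure_itv/= ltry.
- by move=> _; rewrite JE lebesgue_measure_itv/= ltNyr.
- by rewrite [in RHS]JE set_itv_ge// interior0 => /empty.
- by move=> _; rewrite JE lebesgue_measure_itv/=.
- by rewrite [in RHS]JE set_itv_ge// interior0 => /empty.
- by rewrite [in RHS]JE set_itv_ge// interior0 => /empty.
- by rewrite [in RHS]JE set_itv_ge// interior0 => /empty.
Qed.

Lemma open_itv_seq (R : realType) (U : set R) : open U ->
  (lebesgue_measure U < +oo)%E -> exists ab : nat -> R * R,
  [/\ forall k, (ab k).1 <= (ab k).2, trivIset setT (fun k => `](ab k).1, (ab k).2[%classic) &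
   U = \bigcup_k `](ab k).1, (ab k).2[%classic].
Proof.
move=> oU muU.
have H k : exists ab : R * R, ab.1 <= ab.2 /\ open_disjoint_itv oU k = `]ab.1, ab.2[%classic.
  apply: open_itv_bounded.
  - exact: open_disjoint_itv_open.
  - exact: open_disjoint_itv_is_interval.
  - apply: le_lt_trans muU; apply: le_measure; rewrite ?inE.
    + by apply: open_measurable; exact: open_disjoint_itv_open.
    + by apply: open_measurable.
    + by rewrite [X in _ `<=` X](open_disjoint_itv_bigcup oU); exact: bigcup_sup.
have [ab abP] := choice H.
have E : open_disjoint_itv oU = fun k => `](ab k).1, (ab k).2[%classic.
  by apply/funext => k; case: (abP k).
exists ab; split; first by move=> k; case: (abP k).
  rewrite -E; exact: open_disjoint_itv_trivIset.
by rewrite -E; exact: open_disjoint_itv_bigcup.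
Qed.

(** Absolute continuity of a nondecreasing function on the whole line, over finite
    families given as sequences: the form met when an open set is exhausted by its
    components. *)
Definition ac_on_line (R : realType) (G : R -> R) := forall e : R, 0 < e -> exists2 d : R, 0 < d &
  forall n (ab : nat -> R * R), (forall k, (k < n)%N -> (ab k).1 <= (ab k).2) ->
    trivIset `I_n (fun k => `](ab k).1, (ab k).2[%classic) ->
    \sum_(k < n) ((ab k).2 - (ab k).1) < d -> \sum_(k < n) (G (ab k).2 - G (ab k).1) <= e.

Lemma LS_oc (R : realType) (G : cumulative R R) (a b : R) : a <= b ->
  lebesgue_stieltjes_measure G `]a, b]%classic = (G b - G a)%:E.
Proof.
move=> ab; rewrite /lebesgue_stieltjes_measure /measure_extension/=.
rewrite measurable_mu_extE/=; last exact: is_ocitv.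
by rewrite wlength_itv_bnd.
Qed.

(** A Lebesgue-null set sits in an open set of small measure. The components of the latter
    are disjoint intervals of small total length, so absolute continuity makes the sum of
    the increments of G over them small. *)
Lemma ac_dominates (R : realType) (G : cumulative R R) : ac_on_line G ->
  lebesgue_stieltjes_measure G `<< (@lebesgue_measure R).
Proof.
move=> acG; apply/null_content_dominatesP => N mN N0.
apply/eqP; rewrite eq_le measure_ge0 andbT; apply/lee_addgt0Pr => e e0; rewrite add0e.
have [d d0 H] := acG e e0.
have [U [oU NU UN]] : exists U : set R, [/\ open U, N `<=` U & (lebesgue_measure (U `\` N) < d%:E)%E].
  by apply: lebesgue_regularity_outer => //; rewrite N0 ltry.
have mU : measurable U by exact: open_measurable.
have Ud : (lebesgue_measure U < d%:E)%E.
  by rewrite -(setDUK NU) measureU ?N0 ?add0e//; [exact: measurableD|rewrite setDIK].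
have [ab [abE tab UE]] := open_itv_seq oU (lt_trans Ud (ltry _)).
have mI k : measurable (`](ab k).1, (ab k).2[%classic : set R) by exact: measurable_itv.
apply: (@le_trans _ _ (lebesgue_stieltjes_measure G U)).
  by apply: le_measure; rewrite ?inE.
rewrite UE measure_bigcup//=.
apply: lime_le; first exact: is_cvg_nneseries.
near=> n => /=.
apply: (@le_trans _ _ (\sum_(0 <= i < n) (G (ab i).2 - G (ab i).1)%:E)%E).
  rewrite big_mkcond/=; apply: lee_sum => i _.
  rewrite ifT ?in_setT// -LS_oc//; apply: le_measure; rewrite ?inE//.
  by move=> x /=; rewrite !in_itv/= => /andP[-> /ltW].
rewrite sumEFin lee_fin big_mkord; apply: H => //.
  by move=> i j _ _; exact: tab.
rewrite -lte_fin; apply: le_lt_trans Ud.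
rewrite -sumEFin.
apply: (@le_trans _ _ (\sum_(i < n) lebesgue_measure (`](ab i).1, (ab i).2[%classic : set R))%E).
  apply: lee_sum => i _; rewrite lebesgue_measure_itv/= lte_fin.
  case: ltP => // ba; rewrite lee_fin subr_le0//.
pose I k : set (measurableTypeR R) := `](ab k).1, (ab k).2[%classic.
have <- : lebesgue_measure (\big[setU/set0]_(i < n) I i) = (\sum_(i < n) lebesgue_measure (I i))%E.
  apply: measure_semi_additive.
- by move=> k; exact: mI.
- exact: tab.
- by apply: bigsetU_measurable => k _; exact: mI.
apply: le_measure; rewrite ?inE//.
  by apply: bigsetU_measurable => k _; exact: mI.
rewrite UE; exact: bigsetU_bigcup.
Unshelve. all: end_near. Qed.

Lemma cvge_ub (R : realType) (u : (\bar R)^nat) (l c : \bar R) :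
  u @ \oo --> l -> (forall n, u n <= c)%E -> (l <= c)%E.
Proof.
move=> cv H; rewrite -(cvg_lim (@ereal_hausdorff _) cv).
by apply: lime_le; [apply/cvg_ex; exists l|exact: nearW].
Qed.

(** Radon-Nikodym applied to the Lebesgue-Stieltjes measure of G. *)
Lemma ac_density (R : realType) (G : R -> R) (M : R) :
  {homo G : x y / x <= y} -> right_continuous G -> (forall x, `|G x| <= M) -> ac_on_line G ->
  exists f : R -> R, [/\ forall x, 0 <= f x,
    lebesgue_measure.-integrable setT (EFin \o f) &
    forall a b, a <= b -> ((G b - G a)%:E = \int[lebesgue_measure]_(x in `]a, b]) (f x)%:E)%E].
Proof.
move=> ndG rcG bG acG.
pose H : cumulative R R := HB.pack G (isCumulative.Build R _ R G ndG rcG).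
pose nu := lebesgue_stieltjes_measure H.
have fin_nu : fin_num_fun nu.
  move=> A mA; rewrite ge0_fin_numE; last exact: measure_ge0.
  apply: (@le_lt_trans _ _ (nu setT)); first by apply: le_measure; rewrite ?inE.
  apply: (@le_lt_trans _ _ (2 * M)%:E); last exact: ltry.
  have := @nondecreasing_cvg_mu _ _ _ nu (fun n => `]- (n%:R), n%:R]%classic).
  rewrite bigcup_itvT => /(_ _ _ _).
  have T1 : forall n, measurable (`](- n%:R), n%:R]%classic : set R) by move=> n; exact: measurable_itv.
  have T2 : nondecreasing_seq (fun n => `](- n%:R), n%:R]%classic : set R).
    by move=> *; apply/subsetPset/subset_itv; rewrite leBSide/= ?lerN2 ler_nat.
  move=> /(_ T1 measurableT T2) cv.
  apply: (cvge_ub cv) => n /=.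
  rewrite /nu LS_oc ?ge0_cp// lee_fin.
  have := bG n%:R; have := bG (- n%:R).
  rewrite !ler_norml => /andP[? ?] /andP[? ?]; rewrite /H/=; lra.
pose nu' : {finite_measure set (measurableTypeR R) -> \bar R} :=
  HB.pack nu (Measure_isFinite.Build _ (measurableTypeR R) R nu fin_nu).
have [f [f0 finf intf fE]] := @radon_nikodym_sigma_finite _ _ R lebesgue_measure nu' (@ac_dominates R H acG).
exists (fine \o f); split.
- by move=> x /=; rewrite fine_ge0.
- rewrite (_ : EFin \o _ = f)//; apply/funext => x /=; by rewrite fineK.
- move=> a b ab; rewrite -(LS_oc H)//.
  rewrite [LHS](fE `]a, b]%classic)//.
  by apply: eq_integral => x _ /=; rewrite fineK.
Qed.

Lemma abs_cont_fin (R : realType) (s t : R) (u : R -> R) : abs_cont s t u ->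
  forall e : R, 0 < e -> exists2 d : R, 0 < d &
    forall (T : finType) (a b : T -> R),
      (forall i, [/\ s <= a i, a i <= b i & b i <= t]) ->
      trivIset setT (fun i => `]a i, b i[%classic) ->
      \sum_i (b i - a i) < d -> \sum_i `|u (b i) - u (a i)| < e.
Proof.
move=> acu e e0; have [d d0 H] := acu e e0; exists d => // T a b ab tab.
have := H #|T| (a \o enum_val) (b \o enum_val).
rewrite (big_enum_val (A := T) (fun i => b i - a i)) (big_enum_val (A := T) (fun i => `|u (b i) - u (a i)|)).
apply => //= i j _ _ ne.
by apply: enum_val_inj; apply: tab.
Qed.

(** Partitions of different sizes are turned into sequences that stay at b once they have
    reached it, so that finitely many of them can be cut at a common length. *)
Lemma variation_chain (R : realType) (a b : R) (u : R -> R) v : variations a b u v ->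
  exists N (P : nat -> R), [/\ {homo P : i j / (i <= j)%N >-> i <= j}, P 0%N = a,
    forall i, (N <= i)%N -> P i = b &
    forall M, (N <= M)%N -> v = \sum_(i < M) `|u (P i.+1) - u (P i)|].
Proof.
move=> [s [ps /eqP ls] <-{v}].
pose P := nth b (a :: s).
have PN i : (size s <= i)%N -> P i = b.
  rewrite leq_eqVlt => /predU1P[<-|si]; last by rewrite /P nth_default.
  by rewrite /P nth_last/= ls.
exists (size s), P; split => //.
- apply: homo_leq => // [x y z|i]; first exact: le_trans.
  have [si|si] := ltnP i (size s); last by rewrite !PN// leqW.
  by move/pathP : ps => /(_ b _ si) /ltW.
- move=> M sM; rewrite /variation/= -(big_mkord xpredT (fun i => `|u (P i.+1) - u (P i)|)).
  rewrite [RHS](big_cat_nat (n := size s))//=.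
  rewrite [X in _ = _ + X](_ : _ = 0) ?addr0// big_nat big1// => i /andP[si _].
  by rewrite !PN// ?subrr ?normr0// leqW.
Qed.

(** A finite sum of suprema of nonempty sets is the supremum of the sums; bounds on all
    choices therefore bound the sum. *)
Lemma sum_ereal_sup_le (R : realType) (n : nat) (S : nat -> set R) (c : R) :
  (forall k, S k !=set0) ->
  (forall v : nat -> R, (forall k, (k < n)%N -> S k (v k)) -> \sum_(k < n) v k <= c) ->
  (\sum_(k < n) ereal_sup [set x%:E | x in S k] <= c%:E)%E.
Proof.
move=> S0; elim: n c => [|n ih] c H.
  rewrite big_ord0 lee_fin; have [v vS] := choice S0.
  by have := H v; rewrite big_ord0; apply.
rewrite big_ord_recr/=.
set A := (\sum_(i < n) _)%E.
have Ax x : S n x -> (A <= (c - x)%:E)%E.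
  move=> Sx; apply: ih => v vS.
  have := H (fun k => if (k == n)%N then x else v k).
  rewrite big_ord_recr/= eqxx lerBrDr => H'.
  have {}H' : \sum_(i < n) (if (i == n :> nat) then x else v i) + x <= c.
    apply: H' => k; case: eqP => [->//|/eqP kn].
    by rewrite ltnS leq_eqVlt (negbTE kn)/=; exact: vS.
  apply: le_trans H'; rewrite lerD2r le_eqVlt; apply/orP; left; apply/eqP.
  by apply: eq_bigr => i _; rewrite ltn_eqF.
have Afin : A \is a fin_num.
  have [x Sx] := S0 n.
  rewrite fin_numElt (le_lt_trans (Ax _ Sx)) ?ltry// andbT.
  apply: (@lt_le_trans _ _ (\sum_(i < n) (projT1 (cid (S0 i)))%:E)%E).
    by rewrite sumEFin ltNyr.
  apply: lee_sum => i _; apply: ereal_sup_ubound.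
  by exists (projT1 (cid (S0 i))) => //; case: cid.
rewrite addeC -leeBrDr//; apply: ge_ereal_sup => _ [x Sx <-].
rewrite leeBrDr// addeC -leeBrDr//; exact: Ax.
Qed.

(** The total variation of an absolutely continuous function is itself absolutely
    continuous: partitions of the members of a family of disjoint intervals form a finer
    family of the same total length. *)
Lemma TV_ac (R : realType) (s t : R) (u : R -> R) : abs_cont s t u ->
  forall e : R, 0 < e -> exists2 d : R, 0 < d &
    forall n (ab : nat -> R * R), (forall k, (k < n)%N -> [/\ s <= (ab k).1, (ab k).1 <= (ab k).2 & (ab k).2 <= t]) ->
    trivIset `I_n (fun k => `](ab k).1, (ab k).2[%classic) ->
    \sum_(k < n) ((ab k).2 - (ab k).1) < d ->
    (\sum_(k < n) total_variation (ab k).1 (ab k).2 u <= e%:E)%E.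
Proof.
move=> /abs_cont_fin acu e e0; have [d d0 H] := acu e e0; exists d => // n ab abP tab sab.
pose S k := if (k < n)%N then variations (ab k).1 (ab k).2 u else [set 0].
rewrite (eq_bigr (fun k : 'I_n => ereal_sup [set x%:E | x in S k])); last first.
  by move=> i _; rewrite /S ltn_ord.
apply: sum_ereal_sup_le.
  move=> k; rewrite /S; case: ifPn => kn; last by exists 0.
  have [_ ] := abP _ kn; rewrite le_eqVlt => /predU1P[<-|].
    by rewrite variationsxx => _; exists 0.
  by move=> *; exact: variations_neq0.
move=> v vS.
have C (k : 'I_n) : exists NP : nat * (nat -> R), [/\ {homo NP.2 : i j / (i <= j)%N >-> i <= j}, NP.2 0%N = (ab k).1,
    forall i, (NP.1 <= i)%N -> NP.2 i = (ab k).2 &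
    forall M, (NP.1 <= M)%N -> v k = \sum_(i < M) `|u (NP.2 i.+1) - u (NP.2 i)|].
  have := vS k (ltn_ord k); rewrite /S ltn_ord => /variation_chain[N [P HP]].
  by exists (N, P).
have [NP NPE] := choice C.
pose M := (\max_(k < n) (NP k).1)%N.
have NM k : ((NP k).1 <= M)%N by exact: (leq_bigmax (F := fun k => (NP k).1)).
have hP k i j : (i <= j)%N -> (NP k).2 i <= (NP k).2 j by case: (NPE k) => + _ _ _; apply.
have P0 k : (NP k).2 0%N = (ab k).1 by case: (NPE k).
have PM k : (NP k).2 M = (ab k).2 by case: (NPE k) => _ _ + _; apply.
have vE k : v (nat_of_ord k) = \sum_(i < M) `|u ((NP k).2 i.+1) - u ((NP k).2 i)|.
  by case: (NPE k) => _ _ _; apply.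
have Pa k i : (ab (nat_of_ord k)).1 <= (NP k).2 i by rewrite -P0 hP.
have Pb k i : (i <= M)%N -> (NP k).2 i <= (ab (nat_of_ord k)).2 by move=> ?; rewrite -PM hP.
pose a (x : 'I_n * 'I_M) := (NP x.1).2 x.2.
pose b (x : 'I_n * 'I_M) := (NP x.1).2 x.2.+1.
rewrite (eq_bigr _ (fun k _ => vE k)) pair_big/=.
apply: ltW; apply: (H _ a b).
- move=> [k i]; rewrite /a /b/=; have [sa _ bt] := abP k (ltn_ord k); split.
  + exact: le_trans sa (Pa _ _).
  + exact: hP.
  + by apply: le_trans bt; apply: Pb.
- move=> [k i] [k' i'] _ _ [x [/=]]; rewrite /a /b/= !in_itv/= => /andP[x1 x2] /andP[x3 x4].
  have kk' : k = k'.
    apply: val_inj; apply: tab; rewrite /=; [exact: ltn_ord|exact: ltn_ord|].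
    exists x; split; rewrite /= in_itv/=; apply/andP; split.
    + exact: le_lt_trans x1.
    + by apply: lt_le_trans x2 _; apply: Pb.
    + exact: le_lt_trans x3.
    + by apply: lt_le_trans x4 _; apply: Pb.
  rewrite -kk' in x3 x4 *; congr (_, _); apply: val_inj => /=.
  have [ii'|ii'|//] := ltngtP i i'.
  + by have := lt_trans x3 x2; rewrite ltNge hP.
  + by have := lt_trans x1 x4; rewrite ltNge hP.
- apply: le_lt_trans sab; rewrite le_eqVlt; apply/orP; left; apply/eqP.
  rewrite -(pair_big xpredT xpredT (fun k i => (NP k).2 (nat_of_ord i).+1 - (NP k).2 i))/=.
  apply: eq_bigr => k _.
  rewrite -(big_mkord xpredT (fun i => (NP k).2 i.+1 - (NP k).2 i)) telescope_sumr//.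
  by rewrite PM P0.
Qed.

Lemma ac_right_continuous (R : realType) (G : R -> R) :
  {homo G : x y / x <= y} -> ac_on_line G -> right_continuous G.
Proof.
move=> ndG acG x; apply/cvgrPdist_le => e e0.
have [d d0 H] := acG e e0.
near=> y.
have xy : x <= y by near: y; exact: nbhs_right_ge.
rewrite distrC ger0_norm ?subr_ge0 ?ndG//.
have := H 1%N (fun _ => (x, y)); rewrite !big_ord1/=; apply => //.
- by move=> i j /=; rewrite !ltnS !leqn0 => /eqP -> /eqP ->.
- rewrite ltrBlDl; near: y; apply: nbhs_right_lt; rewrite ltrDl//.
Unshelve. all: by end_near. Qed.

(** Segments shorter than the modulus associated with 1 have variation at most 1, and
    finitely many of them cover [s, t]. *)
Lemma TV_fin (R : realType) (s t : R) (u : R -> R) : s <= t -> abs_cont s t u ->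
  total_variation s t u \is a fin_num.
Proof.
move=> st /TV_ac/(_ 1 ltr01)[d d0 H].
have H1 a b : s <= a -> a <= b -> b <= t -> b - a < d -> (total_variation a b u <= 1%:E)%E.
  move=> sa ab bt bad; have := H 1%N (fun _ => (a, b)); rewrite !big_ord1/=; apply => //.
  by move=> i j /=; rewrite !ltnS !leqn0 => /eqP -> /eqP ->.
have [n nP] : exists n : nat, (t - s) / n.+1%:R < d.
  exists (Num.bound ((t - s) / d)).
  rewrite ltr_pdivrMr// -ltr_pdivrMl// mulrC.
  apply: (lt_trans (archi_boundP _)); first by rewrite divr_ge0 ?subr_ge0// ltW.
  by rewrite ltr_nat.
pose h := (t - s) / n.+1%:R.
have h0 : 0 <= h by rewrite divr_ge0 ?subr_ge0.
have hn : h * n.+1%:R = t - s by rewrite /h divfK.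
have K k : (k <= n.+1)%N -> (total_variation s (s + h * k%:R)%R u <= k%:R%:E)%E.
  elim: k => [|k ih] kn; first by rewrite mulr0 addr0 total_variationxx.
  have st' : s + h * k.+1%:R <= t.
    by rewrite -lerBrDl -hn ler_wpM2l// ler_nat.
  rewrite (@total_variationD _ _ _ (s + h * k%:R)).
  - have -> : (k.+1%:R)%:E = (k%:R%:E + 1%:E)%E :> \bar R by rewrite -EFinD natr1.
    rewrite leeD//; first by apply: ih; exact: ltnW.
    apply: H1 => //.
    + by rewrite lerDl mulr_ge0.
    + by rewrite lerD2l ler_wpM2l// ler_nat.
    + by rewrite (_ : _ - _ = h) // -natr1; ring.
  - by rewrite lerDl mulr_ge0.
  - by rewrite lerD2l ler_wpM2l// ler_nat.
rewrite ge0_fin_numE; last exact: total_variation_ge0.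
have := K _ (leqnn n.+1); rewrite hn addrCA subrr addr0 => /le_lt_trans; apply.
exact: ltry.
Qed.

Definition ac_increments (R : realType) (s t : R) (G : R -> R) :=
  forall e : R, 0 < e -> exists2 d : R, 0 < d &
    forall n (ab : nat -> R * R), (forall k, (k < n)%N -> [/\ s <= (ab k).1, (ab k).1 <= (ab k).2 & (ab k).2 <= t]) ->
    trivIset `I_n (fun k => `](ab k).1, (ab k).2[%classic) ->
    \sum_(k < n) ((ab k).2 - (ab k).1) < d ->
    \sum_(k < n) (G (ab k).2 - G (ab k).1) <= e.

(** Composing with this retraction of the line onto [s, t] extends functions from the
    segment to the whole line, where Stieltjes measures live. *)
Definition clamp (R : realType) (s t x : R) : R := Num.max s (Num.min t x).

Lemma clamp_in (R : realType) (s t x : R) : s <= t -> s <= clamp s t x <= t.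
Proof. by move=> st; rewrite /clamp le_max lexx/= ge_max st/= ge_min lexx. Qed.

Lemma clamp_id (R : realType) (s t x : R) : s <= x <= t -> clamp s t x = x.
Proof. by move=> /andP[sx xt]; rewrite /clamp min_r// max_r. Qed.

Lemma clamp_homo (R : realType) (s t x y : R) : x <= y -> clamp s t x <= clamp s t y.
Proof.
by move=> xy; rewrite /clamp; apply: le_max2 => //; apply: le_min2.
Qed.

Lemma clamp_lip (R : realType) (s t x y : R) : s <= t -> x <= y -> clamp s t y - clamp s t x <= y - x.
Proof.
move=> st xy; rewrite /clamp /Order.max /Order.min.
by case: (ltP t y) => ?; case: (ltP t x) => ?; do ?[case: ltP => ?]; lra.
Qed.

Lemma clamp_comp_ac (R : realType) (s t : R) (G : R -> R) : s <= t ->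
  ac_increments s t G ->
  ac_on_line (G \o clamp s t).
Proof.
move=> st H e e0; have [d d0 {}H] := H e e0; exists d => // n ab abP tab sab.
have := H n (fun k => (clamp s t (ab k).1, clamp s t (ab k).2)); apply => /=.
- move=> k kn; have /andP[? _] := clamp_in (ab k).1 st; have /andP[_ ?] := clamp_in (ab k).2 st.
  by split => //; apply: clamp_homo; exact: abP.
- move=> i j ni nj [x []] /=; rewrite !in_itv/= => xi xj.
  apply: tab => //; exists x; split; rewrite /= in_itv/=; [move: xi|move: xj];
  rewrite /clamp !(gt_max, lt_max, gt_min, lt_min); lra.
- apply: le_lt_trans sab; apply: ler_sum => k _; apply: clamp_lip => //; exact: abP.
Qed.

Lemma ac_density_clamp (R : realType) (s t : R) (G : R -> R) : s <= t ->
  (forall x y, s <= x -> x <= y -> y <= t -> G x <= G y) ->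
  ac_increments s t G ->
  exists f : R -> R, 
    lebesgue_measure.-integrable setT (EFin \o f) /\
    forall a b, s <= a -> a <= b -> b <= t -> ((G b - G a)%:E = \int[lebesgue_measure]_(x in `]a, b]) (f x)%:E)%E.
Proof.
move=> st ndG /(clamp_comp_ac st) acG.
have nd : {homo (G \o clamp s t) : x y / x <= y}.
  move=> x y xy /=; have /andP[? ?] := clamp_in x st; have /andP[? ?] := clamp_in y st.
  by apply: ndG => //; exact: clamp_homo.
have [] := @ac_density R (G \o clamp s t) (`|G s| + `|G t|) nd (ac_right_continuous nd acG) _ acG.
  move=> x /=; have /andP[sx xt] := clamp_in x st.
  have G1 : G s <= G (clamp s t x) by exact: ndG.
  have G2 : G (clamp s t x) <= G t by exact: ndG.
  have := ler_norm (G t); have := ler_norm (- G s); rewrite normrN => ? ?.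
  have := normr_ge0 (G t); have := normr_ge0 (G s) => ? ?.
  by rewrite ler_norml; lra.
move=> f [f0 intf fE]; exists f; split => // a b sa ab bt.
rewrite -fE//= !clamp_id//; first by rewrite sa (le_trans ab).
by rewrite bt (le_trans sa).
Qed.

(** u is the difference of its variation function V and of V - u; both are nondecreasing
    and absolutely continuous, hence integrals of densities. *)
Lemma abs_cont_density (R : realType) (s t : R) (u : R -> R) : s <= t -> abs_cont s t u ->
  exists f : R -> R, 
    lebesgue_measure.-integrable setT (EFin \o f) /\
    forall a b, s <= a -> a <= b -> b <= t -> u b - u a = \int[lebesgue_measure]_(x in `]a, b]) (f x).
Proof.
move=> st acu.
have TVfin x y : s <= x -> x <= y -> y <= t -> total_variation x y u \is a fin_num.
  move=> sx xy yt; have := TV_fin st acu.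
  rewrite (@total_variationD _ s t x)// ?(le_trans xy)// (@total_variationD _ x t y)//.
  by rewrite !fin_numD => /andP[_ /andP[]].
pose V x := fine (total_variation s x u).
have VB x y : s <= x -> x <= y -> y <= t -> (V y - V x)%:E = total_variation x y u.
  move=> sx xy yt; rewrite /V (@total_variationD _ s y x)// fineD ?TVfin//; last exact: le_trans yt.
  by rewrite addrC addrA addNr add0r fineK ?TVfin.
have VBu x y : s <= x -> x <= y -> y <= t -> `|u y - u x| <= V y - V x.
  by move=> sx xy yt; rewrite -lee_fin VB//; exact: total_variation_ge.
have acV : ac_increments s t V.
  move=> e e0; have [d d0 H] := TV_ac acu e0; exists d => // n ab abP tab sab.
  rewrite -lee_fin -sumEFin; apply: le_trans (H n ab abP tab sab).
  by apply: lee_sum => k _; have [? ? ?] := abP k (ltn_ord k); rewrite VB.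
have [f1 [if1 f1E]] : exists f : R -> R, lebesgue_measure.-integrable setT (EFin \o f) /\
    forall a b, s <= a -> a <= b -> b <= t -> ((V b - V a)%:E = \int[lebesgue_measure]_(x in `]a, b]) (f x)%:E)%E.
  apply: ac_density_clamp => // x y sx xy yt; rewrite -subr_ge0.
  exact: le_trans (VBu x y sx xy yt).
have [f2 [if2 f2E]] : exists f : R -> R, lebesgue_measure.-integrable setT (EFin \o f) /\
    forall a b, s <= a -> a <= b -> b <= t -> (((V b - u b) - (V a - u a))%:E = \int[lebesgue_measure]_(x in `]a, b]) (f x)%:E)%E.
  apply: (@ac_density_clamp _ s t (fun x => V x - u x)) => // [x y sx xy yt|e e0].
    have := VBu x y sx xy yt; have := ler_norm (u y - u x); lra.
  have [d d0 H] := acV (e / 2) (divr_gt0 e0 (ltr0Sn _ _)); exists d => // n ab abP tab sab.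
  have := H n ab abP tab sab; rewrite ler_pdivlMr// => /(le_trans _); apply.
  rewrite mulr_suml; apply: ler_sum => k _; have [sk kk kt] := abP k (ltn_ord k).
  have := VBu _ _ sk kk kt; have := ler_norm (- (u (ab k).2 - u (ab k).1)); rewrite normrN; lra.
have I a b f : lebesgue_measure.-integrable setT (EFin \o f) ->
    lebesgue_measure.-integrable (`]a, b] : set R) (EFin \o f).
  by apply: integrableS.
exists (f1 \- f2); split.
  by rewrite (_ : _ \o _ = (EFin \o f1) \- (EFin \o f2))%E//; exact: integrableB.
move=> a b sa ab bt; rewrite RintegralB//; try exact: I.
rewrite /Rintegral -f1E// -f2E//=; ring.
Qed.

Lemma derive_cst_add (R : realType) (F : R -> R) (c x : R) :
  derivable F x 1 -> 'D_1 (cst c \+ F) x = 'D_1 F x.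
Proof.
move=> dF; rewrite deriveD; [|exact: derivable_cst|exact: dF].
by rewrite derive_cst add0r.
Qed.

(** Lebesgue differentiation identifies the density of an absolutely continuous function
    with its derivative almost everywhere. *)
Lemma abs_cont_ftc_le (R : realType) (s t : R) (u : R -> R) : s < t -> abs_cont s t u ->
  measurable_fun `]s, t[ (derive1 u) ->
  (`|u t - u s|%:E <= \int[lebesgue_measure]_(x in `]s, t[) `|derive1 u x|%:E)%E.
Proof.
move=> st acu mu'.
have [f [intf fE]] := abs_cont_density (ltW st) acu.
have I (D : set R) : measurable D -> lebesgue_measure.-integrable D (EFin \o f).
  by move=> mD; apply: integrableS intf.
have mst : measurable (`]s, t[ : set R) by [].
have := @FTC1Ny R f (fun y => I _ (measurable_itv `]-oo, y])) (open_integrable_locally openT intf).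
move=> /= ae1.
have ae2 : ae_eq lebesgue_measure (`]s, t[%classic : set R) (EFin \o (fun x => `|derive1 u x|)) (EFin \o (fun x => `|f x|)).
  move: ae1; apply: filterS; first exact: (ae_filter_ringOfSetsType (@lebesgue_measure R)).
  move=> x [dF F'] /=; rewrite in_itv/= => /andP[sx xt].
  congr (`|_|%:E); rewrite -F' !derive1E.
  pose F := fun y : R => \int[lebesgue_measure]_(x in `]-oo, y]) (f x).
  pose g := cst (u s - F s) \+ F.
  have -> : 'D_1 u x = 'D_1 g x.
    apply: near_eq_derive; near=> y.
    have : y \in `]s, t[ by near: y; apply: near_in_itvoo; rewrite in_itv/= sx.
    rewrite in_itv/= => /andP[sy yt].
    have := fE s y (lexx _) (ltW sy) (ltW yt).
    rewrite -(@Rintegral_itvB _ f -oo%O (BRight y) s); last 3 first.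
    - exact: I.
    - by [].
    - by rewrite bnd_simp ltW.
    move=> H; rewrite /g /F/= addrAC -addrA -H; ring.
  exact: derive_cst_add.
rewrite (fE s t)// ?(ltW st)//.
rewrite EFin_normr_Rintegral//; last exact: I.
rewrite -integral_itv_bndo_bndc; last by have /measurable_int := I `]s, t[%classic mst.
apply: le_trans (le_abse_integral _ _ _) _ => //; first by have /measurable_int := I `]s, t[%classic mst.
rewrite le_eqVlt; apply/orP; left; apply/eqP.
under eq_integral do rewrite /= .
symmetry; apply: ge0_ae_eq_integral => //.
- by apply/measurable_EFinP; apply: measurableT_comp.
- have /measurable_int/measurable_EFinP mf := I `]s, t[%classic mst.
  by apply/measurable_EFinP; apply: measurableT_comp.
Unshelve. all: by end_near. Qed.

(** * Integrals of powers *)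

Section power_integrals.
Context {R : realType}.
Implicit Types (F f : R -> R) (a b s : R).
Notation mu := (@lebesgue_measure R).

Lemma is_derive_continuous F f (x : R) : is_derive x (1 : R) F (f x) -> {for x, continuous F}.
Proof. by move=> dF; apply/differentiable_continuous/derivable1_diffP; exact: ex_derive. Qed.

Lemma FTC_pos F f a b : (forall x : R, 0 < x -> is_derive x (1 : R) F (f x)) ->
  (forall x : R, 0 < x -> {for x, continuous f}) -> 0 < a -> a <= b ->
  (\int[mu]_(x in `]a, b[) (f x)%:E = (F b - F a)%:E)%E.
Proof.
move=> dF cf a0; rewrite le_eqVlt => /predU1P[<-|ab].
  by rewrite set_itvoo0 integral_set0 subrr.
have cF x : 0 < x -> {for x, continuous F} by move=> /dF; exact: is_derive_continuous.
have cfw : {within `[a, b], continuous f}.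
  by apply: continuous_in_subspaceT => x /set_mem/=; rewrite in_itv/= => /andP[ax _]; apply: cf; exact: lt_le_trans ax.
have mf : measurable_fun (`[a, b]%classic : set R) f by exact: subspace_continuous_measurable_fun.
have := @continuous_FTC2 R f F a b ab cfw; rewrite EFinB => <-.
- rewrite -[RHS]integral_itv_obnd_cbnd//; last first.
    by apply/measurable_EFinP; apply: measurable_funS mf => //; exact: subset_itv_oc_cc.
  rewrite -[RHS]integral_itv_bndo_bndc//.
  by apply/measurable_EFinP; apply: measurable_funS mf => //; exact: subset_itv_oo_cc.
- split.
  + by move=> x; rewrite in_itv/= => /andP[ax _]; have [] := dF x (lt_trans a0 ax).
  + exact/cvg_at_right_filter/cF.
  + exact/cvg_at_left_filter/cF/(lt_trans a0).
- by move=> x; rewrite in_itv/= => /andP[ax _]; rewrite derive1E; have [_] := dF x (lt_trans a0 ax).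
Qed.

(** Monotone convergence along an increasing sequence of domains; it reaches the improper
    ends of the half-line. *)
Lemma integral_exhaust (I : nat -> set R) (D : set R) (f : R -> \bar R) :
  (forall m n, (m <= n)%N -> I m `<=` I n) -> (forall n, measurable (I n)) -> \bigcup_n I n = D ->
  measurable_fun D f -> (forall x, D x -> 0 <= f x)%E ->
  (\int[mu]_(x in I n) f x)%E @[n --> \oo] --> (\int[mu]_(x in D) f x)%E.
Proof.
move=> ndI mI UI mf f0; rewrite -UI.
have ID n : I n `<=` D by rewrite -UI; exact: bigcup_sup.
apply: ge0_nondecreasing_set_cvg_integral => //.
- by move=> m n mn; apply/subsetPset; exact: ndI.
- by move=> n; apply: measurable_funS mf => //; rewrite -UI; apply: bigcup_measurable.
- by move=> n x /ID; exact: f0.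
Qed.

(** The fundamental theorem with an improper lower end: F may be singular at 0 as long as
    it has a limit there. *)
Lemma FTC_pos0 F f b l : (forall x : R, 0 < x -> is_derive x (1 : R) F (f x)) ->
  (forall x : R, 0 < x -> {for x, continuous f}) -> (forall x : R, 0 < x -> 0 <= f x) ->
  F x @[x --> 0^'+] --> l -> 0 < b ->
  (\int[mu]_(x in `]0%R, b[) (f x)%:E = (F b - l)%:E)%E.
Proof.
move=> dF cf f0 Fl b0.
pose a n := b / n.+1%:R.
have a0 n : 0 < a n by rewrite divr_gt0.
have ab n : a n <= b by rewrite ler_pdivrMr// ler_pMr// ler1n.
have acv : a n @[n --> \oo] --> (0 : R).
  by rewrite -(mulr0 b); apply: cvgMr; exact: cvg_harmonic.
have U : \bigcup_n (`]a n, b[%classic : set R) = `]0%R, b[%classic.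
  apply/seteqP; split => [x [n _]|x]; rewrite /= !in_itv/= => /andP[x1 x2].
    by rewrite x2 (lt_trans (a0 n)).
  have [n _ H] : \forall n \near \oo, a n < x by exact: cvgr_lt x1.
  by exists n => //=; rewrite in_itv/= x2 H/=.
have mf : measurable_fun (`]0, +oo[%classic : set R) f.
  apply: open_continuous_measurable_fun; first exact: interval_open.
  by move=> x; rewrite inE/= in_itv/= andbT; exact: cf.
apply: (@cvg_unique _ (@ereal_hausdorff R) _ _ _ _ (@integral_exhaust (fun n => `]a n, b[%classic) _ _ _ _ U _ _)) => //.
- move=> m n mn x /=; rewrite !in_itv/= => /andP[x1 ->]; rewrite andbT.
  by apply: le_lt_trans x1; rewrite ler_pM2l// lef_pV2 ?posrE// ler_nat.
- apply/measurable_EFinP; apply: measurable_funS mf => // x /=.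
  by rewrite !in_itv/= andbT => /andP[x1 _].
- by move=> x /=; rewrite in_itv/= lee_fin => /andP[x1 _]; apply: f0.
- rewrite /= (_ : (fun _ => _) = fun n => (F b - F (a n))%:E); last first.
    by apply/funext => n; rewrite (FTC_pos dF cf).
  apply: cvg_EFin; first exact: nearW.
  apply: cvgB; first exact: cvg_cst.
  by move/cvg_at_rightP : Fl; apply; split.
Qed.

Lemma continuous_powR_pos (r x : R) : 0 < x -> {for x, continuous (fun y : R => y `^ r)}.
Proof. by move=> x0; apply: (@is_derive_continuous _ (fun y => r * y `^ (r - 1))); exact: is_derive1_powR. Qed.

Lemma is_derive_powRS r (x : R) : 0 < x -> r + 1 != 0 ->
  is_derive x (1 : R) (fun y => (r + 1)^-1 * y `^ (r + 1)) (x `^ r).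
Proof.
move=> x0 r1.
have -> : x `^ r = (r + 1)^-1 *: ((r + 1) * x `^ (r + 1 - 1)).
  by rewrite addrK /GRing.scale/= mulrA mulVf// mul1r.
by apply: is_deriveZ; exact: is_derive1_powR.
Qed.

Lemma integral_powR r a b : r + 1 != 0 -> 0 < a -> a <= b ->
  (\int[mu]_(x in `]a, b[) (x `^ r)%:E = ((r + 1)^-1 * b `^ (r + 1) - (r + 1)^-1 * a `^ (r + 1))%:E)%E.
Proof.
move=> r1 a0 ab.
apply: (@FTC_pos (fun y => (r + 1)^-1 * y `^ (r + 1)) (fun x => x `^ r) a b _ _ a0 ab) => x x0.
  exact: is_derive_powRS.
exact: continuous_powR_pos.
Qed.

Lemma integral_powR0 r b : -1 < r -> 0 < b ->
  (\int[mu]_(x in `]0%R, b[) (x `^ r)%:E = ((r + 1)^-1 * b `^ (r + 1))%:E)%E.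
Proof.
move=> r1 b0; have r10 : 0 < r + 1 by rewrite -(opprK 1) subr_gt0.
have -> : (r + 1)^-1 * b `^ (r + 1) = (r + 1)^-1 * b `^ (r + 1) - 0 by rewrite subr0.
apply: (@FTC_pos0 (fun y => (r + 1)^-1 * y `^ (r + 1)) (fun x => x `^ r) b 0 _ _ _ _ b0) => [x x0|x x0|x _|].
- by apply: is_derive_powRS => //; rewrite gt_eqF.
- exact: continuous_powR_pos.
- exact: powR_ge0.
- by rewrite -[X in _ --> X](mulr0 (r + 1)^-1); apply: cvgMr; exact: powR_cvg0.
Qed.

Lemma integral_inv a b : 0 < a -> a <= b ->
  (\int[mu]_(x in `]a, b[) (x^-1)%:E = (ln b - ln a)%:E)%E.
Proof.
move=> a0 ab; apply: (@FTC_pos (@ln R) (fun x => x^-1) a b _ _ a0 ab) => x x0 /=.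
by apply: inv_continuous; rewrite gt_eqF.
Qed.

Lemma integral_powRy r : r < -1 -> (\int[mu]_(x in `]1%R, +oo[) (x `^ r)%:E < +oo)%E.
Proof.
move=> r1; have r10 : r + 1 < 0 by rewrite -(opprK 1) subr_lt0.
apply: (@le_lt_trans _ _ (- (r + 1)^-1)%:E); last exact: ltry.
apply: (cvge_ub (@integral_exhaust (fun n => `]1, n.+1%:R[%classic) _ _ _ _ _ _ _)) => //.
- by move=> m n mn x /=; rewrite !in_itv/= => /andP[-> xm]; rewrite (lt_le_trans xm)// ler_nat.
- apply/seteqP; split => [x [n _]|x]; rewrite /= !in_itv/= => /andP[x1 x2]; first by rewrite x1.
  exists (Num.bound x) => //=; rewrite in_itv/= x1/= (lt_trans (archi_boundP _))// ?ltr_nat//.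
  by rewrite ltW// (lt_trans _ x1).
- apply/measurable_EFinP; apply: measurable_funTS; exact: measurable_powR.
- by move=> x _; rewrite lee_fin powR_ge0.
- move=> n; rewrite integral_powR ?ler1n// ?ltr0_neq0// powR1 mulr1 lee_fin.
  by rewrite gerDr mulr_le0_ge0 ?powR_ge0// invr_le0 ltW.
Qed.

End power_integrals.

(** * The energy of a chord *)

(** The least gradient energy, with weight x^(p-1), of a function that goes from v a to v
    b over [a, b]: it is reached by the functions affine in ln x. *)
Definition seg (R : realType) (p : R) (v : R -> R) (a b : R) : R :=
  `|v b - v a| `^ p / (ln (b / a)) `^ (p - 1).

Section seg.
Context {R : realType}.
Variable p : R.
Hypothesis p1 : 1 < p.
Implicit Types (u v : R -> R) (a b e k y : R).
Notation mu := (@lebesgue_measure R).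

Let p0 : 0 < p. Proof. exact: lt_trans p1. Qed.
Let pm0 : 0 < p - 1. Proof. by rewrite subr_gt0. Qed.

Lemma powRS1 k : 0 <= k -> k * k `^ (p - 1) = k `^ p.
Proof. by move=> k0; apply: mulr_powRB1. Qed.

(** Young's inequality, read as: the convex function y^p lies above its tangent at k. *)
Lemma tangent_powR y k : 0 <= y -> 0 <= k ->
  p * k `^ (p - 1) * y <= y `^ p + (p - 1) * k `^ p.
Proof.
move=> y0 k0.
have q0 : 0 < p / (p - 1) by rewrite divr_gt0.
have pq : p^-1 + (p / (p - 1))^-1 = 1 by rewrite invf_div; field; rewrite gt_eqF.
have := conjugate_powR y0 (powR_ge0 k (p - 1)) p0 q0 pq.
rewrite -powRrM (_ : (p - 1) * (p / (p - 1)) = p); last by field; rewrite gt_eqF.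
rewrite -(ler_pM2l p0) => H.
have -> : p * k `^ (p - 1) * y = p * (y * k `^ (p - 1)) by ring.
apply: (le_trans H); rewrite le_eqVlt; apply/orP; left; apply/eqP.
by field; rewrite !gt_eqF.
Qed.

Lemma segxx v a : seg p v a a = 0.
Proof. by rewrite /seg subrr normr0 powR0 ?mul0r// gt_eqF. Qed.

(** The chord energy is a supremum of affine functions of |v b - v a| and ln (b / a), one
    for each slope k; this lemma and the next one are the two halves of that duality. Sums
    and integrals are then compared slope by slope, without Hoelder's inequality. *)
Lemma seg_tangent v a b k : 0 < a -> a <= b -> 0 <= k ->
  p * k `^ (p - 1) * `|v b - v a| <= seg p v a b + (p - 1) * k `^ p * ln (b / a).
Proof.
move=> a0; rewrite le_eqVlt => /predU1P[<-|ab] k0.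
  by rewrite segxx subrr normr0 mulr0 divff ?gt_eqF// ln1 mulr0 addr0.
have l0 : 0 < ln (b / a) by rewrite ln_gt0// ltr_pdivlMr// mul1r.
have y0 : 0 <= `|v b - v a| / ln (b / a) by rewrite divr_ge0// ltW.
have := tangent_powR y0 k0; rewrite -(ler_pM2r l0) mulrDl => H.
have -> : seg p v a b = (`|v b - v a| / ln (b / a)) `^ p * ln (b / a).
  rewrite powRM ?invr_ge0// ?(ltW l0)// /seg -mulrA; congr (_ * _).
  rewrite -[in RHS]powR_inv1 ?(ltW l0)// -powRrM -powRN.
  rewrite -[X in _ = _ * X](powRr1 (ltW l0)) -powRD ?(gt_eqF l0) ?implybT//.
  by congr powR; ring.
apply: le_trans H; rewrite le_eqVlt; apply/orP; left; apply/eqP.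
by field; rewrite gt_eqF.
Qed.

Lemma seg_le v a b e : 0 < a -> a <= b ->
  (forall k, 0 <= k -> p * k `^ (p - 1) * `|v b - v a| <= e + (p - 1) * k `^ p * ln (b / a)) ->
  seg p v a b <= e.
Proof.
move=> a0; rewrite le_eqVlt => /predU1P[<-|ab] H.
  by have := H 0 (lexx _); rewrite segxx subrr normr0 !powR0 ?mulr0 ?mul0r ?addr0// gt_eqF.
have l0 : 0 < ln (b / a) by rewrite ln_gt0// ltr_pdivlMr// mul1r.
set k := `|v b - v a| / ln (b / a).
have k0 : 0 <= k by rewrite divr_ge0// ltW.
have := H k k0.
have vE : `|v b - v a| = k * ln (b / a) by rewrite /k divfK// gt_eqF.
rewrite -lerBlDr; apply: le_trans.
have -> : seg p v a b = k `^ p * ln (b / a).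
  rewrite /seg vE powRM// ?(ltW l0)// -mulrA; congr (_ * _).
  rewrite -powRN -powRD ?(gt_eqF l0) ?implybT//.
  by rewrite -[RHS](powRr1 (ltW l0)); congr powR; ring.
rewrite vE -powRS1// le_eqVlt; apply/orP; left; apply/eqP; ring.
Qed.

(** A gap where v returns to the same value may be cut out of a segment. With x = y this
    says that cutting a segment in two does not lower the energy. *)
Lemma seg_split v a b x y : 0 < a -> a <= x -> x <= y -> y <= b -> v y = v x ->
  seg p v a b <= seg p v a x + seg p v y b.
Proof.
move=> a0 ax xy yb vxy.
have x0 := lt_le_trans a0 ax; have y0 := lt_le_trans x0 xy; have b0 := lt_le_trans y0 yb.
have ab : a <= b by apply: le_trans ax _; exact: le_trans xy _.
apply: seg_le => // k k0.
have := seg_tangent v a0 ax k0; have := seg_tangent v y0 yb k0.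
have tri : `|v b - v a| <= `|v b - v y| + `|v x - v a|.
  have -> : v b - v a = (v b - v y) + (v x - v a) by rewrite vxy; ring.
  exact: ler_normD.
have k1 : 0 <= p * k `^ (p - 1) by rewrite mulr_ge0 ?powR_ge0// ltW.
have := ler_wpM2l k1 tri.
have k2 : 0 <= (p - 1) * k `^ p by rewrite mulr_ge0 ?powR_ge0// ltW.
have : ln (x / a) + ln (b / y) <= ln (b / a).
  have [xa by0 ba] : [/\ 0 < x / a, 0 < b / y & 0 < b / a] by split; exact: divr_gt0.
  have xby : 0 < x / a * (b / y) by exact: mulr_gt0.
  rewrite -lnM ?posrE// ler_ln ?posrE//.
  have -> : x / a * (b / y) = b / a * (x / y) by field; rewrite !gt_eqF.
  by rewrite ler_piMr ?(ltW ba)// ler_pdivrMr ?mul1r.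
move=> /(ler_wpM2l k2).
rewrite !mulrDr; lra.
Qed.

End seg.

(** The tangent inequality at y = |u'(x)| x, divided by x and integrated over the segment,
    is the hypothesis of seg_le. *)
Lemma seg_le_integral (R : realType) (p : R) (u : R -> R) (a b : R) : 1 < p ->
  0 < a -> a <= b -> abs_cont a b u -> measurable_fun (`]0, +oo[ : set R) (derive1 u) ->
  ((seg p u a b)%:E <= \int[lebesgue_measure]_(x in `]a, b[) (`|derive1 u x| `^ p * x `^ (p - 1))%:E)%E.
Proof.
move=> p1 a0; rewrite le_eqVlt => /predU1P[<-|ab] acu mu'.
  by rewrite segxx// set_itvoo0 integral_set0.
have p0 : 0 < p by exact: lt_trans p1.
have pm0 : 0 < p - 1 by rewrite subr_gt0.
set I := (\int[_]_(x in _) _)%E.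
have I0 : (0 <= I)%E by apply: integral_ge0 => x _; rewrite lee_fin mulr_ge0// powR_ge0.
have mst : measurable (`]a, b[%classic : set R) by [].
have mu'ab : measurable_fun (`]a, b[ : set R) (derive1 u).
  apply: measurable_funS mu' => // x /=; rewrite !in_itv/= andbT => /andP[ax _].
  exact: lt_trans ax.
have m1 : measurable_fun (`]a, b[ : set R) (fun x => `|derive1 u x| `^ p * x `^ (p - 1)).
  apply: measurable_funM.
    apply: (@measurableT_comp _ _ _ _ _ _ (fun y : R => y `^ p)); first exact: measurable_powR.
    exact: measurableT_comp.
  by apply: measurable_funTS; exact: measurable_powR.
case E : I I0 => [e| |//] _; last by rewrite leey.
rewrite lee_fin; apply: seg_le => // [|k k0]; first exact: ltW.
have := abs_cont_ftc_le ab acu mu'ab.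
set k1 := p * k `^ (p - 1); set k2 := (p - 1) * k `^ p.
have k10 : 0 <= k1 by rewrite mulr_ge0 ?powR_ge0// ltW.
have k20 : 0 <= k2 by rewrite mulr_ge0 ?powR_ge0// ltW.
move=> H; rewrite -lee_fin.
apply: (@le_trans _ _ (k1%:E * \int[lebesgue_measure]_(x in `]a, b[) `|derive1 u x|%:E)%E).
  by rewrite EFinM lee_wpmul2l// lee_fin.
rewrite -ge0_integralZl//; last by apply/measurable_EFinP; exact: measurableT_comp.
have mi : measurable_fun (`]a, b[ : set R) (fun x : R => x^-1).
  apply: open_continuous_measurable_fun; first exact: interval_open.
  move=> x; rewrite inE/= in_itv/= => /andP[ax _]; apply: inv_continuous.
  by rewrite gt_eqF// (lt_trans a0).
have -> : (e + k2 * ln (b / a))%:E = (\int[lebesgue_measure]_(x in `]a, b[) (`|derive1 u x| `^ p * x `^ (p - 1) + k2 * x^-1)%:E)%E.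
  under [RHS]eq_integral do rewrite EFinD.
  rewrite ge0_integralD//; last 4 first.
  - by move=> x _; rewrite lee_fin mulr_ge0// powR_ge0.
  - exact/measurable_EFinP.
  - move=> x /=; rewrite in_itv/= => /andP[ax _]; rewrite lee_fin mulr_ge0// invr_ge0 ltW//.
    exact: lt_trans ax.
  - by apply/measurable_EFinP; exact: measurable_funM.
  rewrite -/I E; under [X in (_ + X)%E]eq_integral do rewrite EFinM.
  rewrite ge0_integralZl//; last 2 first.
  - exact/measurable_EFinP.
  - move=> x /=; rewrite in_itv/= => /andP[ax _]; rewrite lee_fin invr_ge0 ltW//.
    exact: lt_trans ax.
  rewrite integral_inv ?(ltW ab)// -EFinM -EFinD ln_div// posrE//.
  exact: lt_trans ab.
apply: ge0_le_integral => //.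
- by move=> x _; rewrite -EFinM lee_fin mulr_ge0.
- apply/measurable_EFinP; apply: measurable_funM => //; exact: measurableT_comp.
- by apply/measurable_EFinP; apply: measurable_funD => //; exact: measurable_funM.
- move=> x /=; rewrite in_itv/= => /andP[ax _]; have x0 : 0 < x by exact: lt_trans ax.
  rewrite -EFinM lee_fin -(ler_pM2r x0) mulrDl mulfVK ?gt_eqF// -mulrA.
  have := @tangent_powR _ _ p1 (`|derive1 u x| * x) k.
  rewrite mulr_ge0 ?(ltW x0)// => /(_ isT k0).
  rewrite powRM ?(ltW x0)// -(powRS1 p1 (ltW x0)) -/k1 -/k2 => /le_trans; apply.
  by rewrite [x * x `^ _]mulrC mulrA.
Qed.

(** * The normalizing constants of the weights *)

Section gamma.
Context {R : realType}.
Notation mu := (@lebesgue_measure R).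

Lemma measurable_powR_E (r : R) (D : set R) : measurable_fun D (fun x : R => (x `^ r)%:E).
Proof. by apply/measurable_EFinP; apply: measurable_funTS; exact: measurable_powR. Qed.

Lemma ge0_integral_split (f : R -> \bar R) (c : R) : 0 < c ->
  measurable_fun (`]0%R, +oo[ : set R) f -> (forall x : R, (0 < x)%R -> 0 <= f x)%E ->
  (\int[mu]_(x in `]0%R, +oo[) f x = \int[mu]_(x in `]0%R, c[) f x + \int[mu]_(x in `]c, +oo[) f x)%E.
Proof.
move=> c0 mf f0.
have -> : (`]0%R, +oo[%classic : set R) = `]0%R, c] `|` `]c, +oo[.
  by rewrite -itv_bndbnd_setU// bnd_simp ltW.
have mf1 : measurable_fun (`]0%R, c] `|` `]c, +oo[ : set R) f.
  by rewrite -itv_bndbnd_setU// bnd_simp ltW.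
rewrite ge0_integral_setU//=; last 2 first.
- move=> x [] /=; rewrite in_itv/=; [move=> /andP[? _]|rewrite andbT => cx]; apply: f0 => //.
  exact: lt_trans cx.
- apply/disj_setPS => x [] /=; rewrite !in_itv/= andbT => /andP[_ xc] cx.
  by have := lt_le_trans cx xc; rewrite ltxx.
rewrite -integral_itv_bndo_bndc//; apply: measurable_funS mf => // x /=.
by rewrite !in_itv/= andbT => /andP[].
Qed.

Lemma measurable_gamma_integrand (s : R) : measurable_fun setT (fun t : R => t `^ (s - 1) * expR (- t)).
Proof.
apply: measurable_funM; first exact: measurable_powR.
by apply: measurableT_comp => //; exact: measurable_oppr.
Qed.

(** Near 0 the integrand is at most t^(s-1); beyond 1 the exponential beats a power of t
    large enough to leave t^(-2). *)
Lemma gamma_integral_lty (s : R) : 0 < s ->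
  (\int[mu]_(t in `]0%R, +oo[) (t `^ (s - 1) * expR (- t))%:E < +oo)%E.
Proof.
move=> s0.
have mf : measurable_fun setT (fun t : R => (t `^ (s - 1) * expR (- t))%:E).
  by apply/measurable_EFinP; exact: measurable_gamma_integrand.
rewrite (@ge0_integral_split _ 1)//; last 2 first.
- exact: measurable_funTS.
- by move=> x _; rewrite lee_fin mulr_ge0 ?powR_ge0 ?expR_ge0.
apply: lte_add_pinfty.
  apply: (@le_lt_trans _ _ (\int[mu]_(t in `]0%R, 1%R[) (t `^ (s - 1))%:E)%E).
    apply: ge0_le_integral => //.
    - by move=> x _; rewrite lee_fin mulr_ge0 ?powR_ge0 ?expR_ge0.
    - exact: measurable_funTS.
    - exact: measurable_powR_E.
    - move=> x /=; rewrite in_itv/= => /andP[x0 _]; rewrite lee_fin ler_piMr ?powR_ge0//.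
      by rewrite -expR0 ler_expR oppr_le0 ltW.
  by rewrite integral_powR0 ?ltry// ltrBrDl subrr.
have [N NP] : exists N : nat, s + 1 < N.+1%:R.
  exists (Num.bound (s + 1)); apply: (lt_trans (archi_boundP _)); last by rewrite ltr_nat.
  by rewrite addr_ge0// ltW.
pose C : R := (N.+1`!)%:R.
apply: (@le_lt_trans _ _ (\int[mu]_(t in `]1%R, +oo[) (C%:E * (t `^ (-2))%:E))%E).
  apply: ge0_le_integral => //.
  - by move=> x _; rewrite lee_fin mulr_ge0 ?powR_ge0 ?expR_ge0.
  - exact: measurable_funTS.
  - apply: measurable_funeM; exact: measurable_powR_E.
  - move=> x /=; rewrite in_itv/= andbT => x1; rewrite -EFinM lee_fin.
    have x0 : 0 < x by exact: lt_trans x1.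
    rewrite expRN ler_pdivrMr ?expR_gt0//.
    have H : x ^+ N.+1 <= C * expR x.
      rewrite mulrC -ler_pdivrMr ?ltr0n ?fact_gt0//.
      by apply: le_trans (expR_ge1Dxn N (ltW x0)); rewrite lerDr.
    apply: (@le_trans _ _ (x `^ (-2) * x ^+ N.+1)).
      rewrite -powR_mulrn ?(ltW x0)// -powRD ?(gt_eqF x0) ?implybT//.
      by apply: ler_powR; [exact: ltW|lra].
    by rewrite -mulrA [C * _]mulrCA [C * _]mulrC ler_wpM2l ?powR_ge0// mulrC.
rewrite ge0_integralZl//; last 3 first.
- exact: measurable_powR_E.
- by move=> x _; rewrite lee_fin powR_ge0.
- by rewrite lee_fin ler0n.
apply: lte_mul_pinfty => //; first by rewrite lee_fin ler0n.
by apply: integral_powRy; lra.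
Qed.

Lemma GammaR_gt0 (s : R) : 0 < s -> 0 < GammaR s.
Proof.
move=> s0.
have lty := gamma_integral_lty s0.
have mf : measurable_fun setT (fun t : R => (t `^ (s - 1) * expR (- t))%:E).
  by apply/measurable_EFinP; exact: measurable_gamma_integrand.
rewrite /GammaR /Rintegral fine_gt0// lty andbT.
rewrite (@ge0_integral_split _ 1)//; last 2 first.
- exact: measurable_funTS.
- by move=> x _; rewrite lee_fin mulr_ge0 ?powR_ge0 ?expR_ge0.
apply: (@lt_le_trans _ _ (\int[mu]_(t in `]0%R, 1%R[) ((expR (-1))%:E * (t `^ s)%:E))%E); last first.
  rewrite -[leLHS]adde0 leeD//; last first.
    by apply: integral_ge0 => x _; rewrite lee_fin mulr_ge0 ?powR_ge0 ?expR_ge0.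
  apply: ge0_le_integral => //.
  - by move=> x _; rewrite -EFinM lee_fin mulr_ge0 ?powR_ge0 ?expR_ge0.
  - by apply: measurable_funeM; exact: measurable_powR_E.
  - exact: measurable_funTS.
  - move=> x /=; rewrite in_itv/= => /andP[x0 x1]; rewrite -EFinM lee_fin mulrC.
    apply: ler_pM; rewrite ?powR_ge0 ?expR_ge0//; last by rewrite ler_expR lerN2 ltW.
    by apply: ger_powR; [rewrite x0 ltW|rewrite gerDl oppr_le0].
rewrite ge0_integralZl//; last 2 first.
- exact: measurable_powR_E.
- by move=> x _; rewrite lee_fin powR_ge0.
rewrite integral_powR0//; last by rewrite (lt_trans _ s0)// oppr_lt0.
by rewrite -EFinM lte_fin powR1 mulr1 mulr_gt0 ?expR_gt0// invr_gt0 addr_gt0.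
Qed.

Lemma omega_gt0 (b : R) : 0 <= b -> 0 < omega b.
Proof.
move=> b0; rewrite /omega divr_gt0 ?mulr_gt0//; first exact/powR_gt0/pi_gt0.
by apply: GammaR_gt0; rewrite divr_gt0// ltr_pwDl.
Qed.

End gamma.

(** * The weighted measure of the half-line *)

Section weight.
Context {R : realType}.
Variable th : R.
Notation mu := (@lebesgue_measure R).

(** The weight is extended by 0 so that lambda_theta becomes a measure on the whole line. *)
Definition wdens (x : R) : \bar R := (if 0 < x then omega th * x `^ th else 0)%:E.

Lemma omega_ge0 : 0 <= omega th :> R.
Proof.
rewrite /omega divr_ge0 ?mulr_ge0 ?powR_ge0// /GammaR.
by apply: Rintegral_ge0 => x _; rewrite mulr_ge0 ?powR_ge0 ?expR_ge0.
Qed.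

Lemma wdens_ge0 x : (0 <= wdens x)%E.
Proof. by rewrite lee_fin; case: ifP => // _; rewrite mulr_ge0 ?powR_ge0 ?omega_ge0. Qed.

Lemma measurable_wdens : measurable_fun setT wdens.
Proof.
apply/measurable_EFinP; apply: measurable_fun_if => //.
- by apply: measurable_fun_ltr.
- by apply: measurable_funTS; apply: measurable_funM => //; exact: measurable_powR.
Qed.

Definition wlam (A : set (measurableTypeR R)) : \bar R := (\int[mu]_(x in A) wdens x)%E.

Let wlam0 : wlam set0 = 0. Proof. exact: integral_set0. Qed.

Let wlam_ge0 A : (0 <= wlam A)%E.
Proof. by apply: integral_ge0 => x _; exact: wdens_ge0. Qed.

Let wlam_sigma : semi_sigma_additive wlam.
Proof. exact: (@semi_sigma_additive_nng_induced _ (measurableTypeR R) R mu wdens measurable_wdens wdens_ge0). Qed.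

HB.instance Definition _ := isMeasure.Build _ _ _ wlam wlam0 wlam_ge0 wlam_sigma.

Lemma wlamE (A : set R) : A `<=` `]0, +oo[ -> wlam A = (\int[mu]_(x in A) (omega th * x `^ th)%:E)%E.
Proof.
move=> AP; apply: eq_integral => x /[!inE] /AP /=; rewrite in_itv/= andbT => x0.
by rewrite /wdens x0.
Qed.

Hypothesis th0 : 0 <= th.

(** The mass that lambda_theta gives to the interval from 0 to s. *)
Definition Lam (s : R) : R := omega th * ((th + 1)^-1 * s `^ (th + 1)).

Lemma th1_gt0 : 0 < th + 1. Proof. by rewrite ltr_wpDl. Qed.

Let thN1 : -1 < th. Proof. by rewrite (lt_le_trans _ th0)// oppr_lt0. Qed.

Lemma wlam_0s s : 0 < s -> wlam `]0, s[ = (Lam s)%:E.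
Proof.
move=> s0; rewrite wlamE; last by move=> x /=; rewrite !in_itv/= andbT => /andP[].
under eq_integral do rewrite EFinM.
rewrite ge0_integralZl//; last 3 first.
- exact: measurable_powR_E.
- by move=> x _; rewrite lee_fin powR_ge0.
- by rewrite lee_fin omega_ge0.
by rewrite integral_powR0.
Qed.

Lemma wlam_ab a b : 0 < a -> a <= b -> wlam `]a, b[ = (Lam b - Lam a)%:E.
Proof.
move=> a0 ab; rewrite wlamE; last first.
  by move=> x /=; rewrite !in_itv/= andbT => /andP[ax _]; exact: lt_trans ax.
under eq_integral do rewrite EFinM.
rewrite ge0_integralZl//; last 3 first.
- exact: measurable_powR_E.
- by move=> x _; rewrite lee_fin powR_ge0.
- by rewrite lee_fin omega_ge0.
by rewrite integral_powR// ?gt_eqF ?th1_gt0// -EFinM mulrBr.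
Qed.

Lemma Lam_gt0 s : 0 < s -> 0 < Lam s.
Proof. move=> s0; apply: mulr_gt0; first exact: omega_gt0.
by apply: mulr_gt0; [rewrite invr_gt0; exact: th1_gt0|exact: powR_gt0]. Qed.

Lemma Lam_lt s t : 0 < s -> 0 < t -> (Lam s < Lam t) = (s < t).
Proof.
move=> s0 t0; have w0 := omega_gt0 th0; have t1 := th1_gt0.
have t1' : 0 < (th + 1)^-1 by rewrite invr_gt0.
rewrite /Lam (ltr_pM2l w0) (ltr_pM2l t1').
apply/idP/idP => [|st].
  by apply: contraTT; rewrite -!leNgt; apply: ge0_ler_powR; rewrite ?nnegrE ltW// th1_gt0.
by apply: gt0_ltr_powR; rewrite ?nnegrE ?th1_gt0// ltW.
Qed.

Lemma Lam_le s t : 0 < s -> 0 < t -> (Lam s <= Lam t) = (s <= t).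
Proof. by move=> s0 t0; rewrite leNgt Lam_lt// -leNgt. Qed.

Lemma Lam_surj (y : R) : 0 < y -> exists2 s, 0 < s & Lam s = y.
Proof.
move=> y0; pose z := y * (omega th)^-1 * (th + 1).
have w0 := omega_gt0 th0; have t1 := th1_gt0.
have z0 : 0 < z by apply: mulr_gt0 => //; rewrite divr_gt0.
exists (z `^ (th + 1)^-1); first exact: powR_gt0.
rewrite /Lam -powRrM mulVf ?gt_eqF// powRr1 ?(ltW z0)// /z.
by field; rewrite !gt_eqF.
Qed.

(** The mass is a power of the endpoint. A segment further from 0 and carrying no more
    mass is therefore no longer in the variable ln x, which is what makes rearrangement
    lower the energy. *)
Lemma Lam_ratio s t a b : 0 < s -> s <= t -> s <= a -> a <= b ->
  Lam b - Lam a <= Lam t - Lam s -> b / a <= t / s.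
Proof.
move=> s0 st sa ab H.
have a0 := lt_le_trans s0 sa; have t0 := lt_le_trans s0 st; have b0 := lt_le_trans a0 ab.
have Ls := Lam_gt0 s0; have La := Lam_gt0 a0.
have H1 : Lam b / Lam a <= Lam t / Lam s.
  rewrite ler_pdivrMr// mulrAC ler_pdivlMr//.
  have : Lam s <= Lam a by rewrite Lam_le.
  have : Lam s <= Lam t by rewrite Lam_le.
  nra.
have E x y : 0 < x -> 0 < y -> Lam y / Lam x = (y / x) `^ (th + 1).
  move=> x0 y0; rewrite /Lam powRM ?invr_ge0 ?(ltW x0) ?(ltW y0)//.
  rewrite -[x^-1]powR_inv1 ?(ltW x0)// -powRrM mulN1r powRN.
  have w0 := omega_gt0 th0; have t1 := th1_gt0; have xp := powR_gt0 (th + 1) x0.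
  by field; rewrite !gt_eqF.
move: H1; rewrite !E//; apply: contraTT; rewrite -!ltNge => H1.
by apply: gt0_ltr_powR; rewrite ?nnegrE ?th1_gt0// divr_ge0// ltW.
Qed.

Lemma wlam_P : wlam `]0, +oo[ = +oo%E.
Proof.
apply/eqyP => A A0; have [s s0 <-] := Lam_surj A0.
rewrite -wlam_0s//; apply: le_measure; rewrite ?inE//.
by move=> x /=; rewrite !in_itv/= andbT => /andP[].
Qed.

End weight.

(** * Decreasing rearrangement *)

Section rearrangement.
Context {R : realType}.
Variables (th : R) (f : R -> R).
Hypothesis th0 : 0 <= th.
Hypothesis cf : forall x : R, 0 < x -> {for x, continuous f}.
Hypothesis f0 : forall x : R, 0 < x -> 0 <= f x.
Hypothesis foo : f x @[x --> +oo] --> (0 : R).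

Definition above (g : R -> R) (h : R) : set R := [set x | 0 < x /\ h < g x].

Definition distr (g : R -> R) (h : R) : \bar R := wlam th (above g h).

Lemma continuous_measurable_pos (g : R -> R) : (forall x : R, 0 < x -> {for x, continuous g}) ->
  measurable_fun (`]0, +oo[ : set R) g.
Proof.
move=> cg; apply: open_continuous_measurable_fun; first exact: interval_open.
by move=> x; rewrite inE/= in_itv/= andbT; exact: cg.
Qed.

Lemma measurable_above (g : R -> R) h : measurable_fun (`]0, +oo[ : set R) g ->
  measurable (above g h).
Proof.
move=> mg; have := mg (measurable_itv `]0, +oo[) `]h, +oo[%classic (measurable_itv _).
congr (measurable _); apply/seteqP; split => x /=; rewrite !in_itv/= !andbT //.
Qed.

Let mf := continuous_measurable_pos cf.
Let mabove h := @measurable_above f h mf.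

Lemma above_subset (g : R -> R) h h' : h <= h' -> above g h' `<=` above g h.
Proof. by move=> hh x [x0 hx]; split => //; exact: le_lt_trans hx. Qed.

Lemma distr_le h h' : h <= h' -> (distr f h' <= distr f h)%E.
Proof. by move=> hh; apply: le_measure; rewrite ?inE; [exact: mabove|exact: mabove|exact: above_subset]. Qed.

Lemma tail_small h : 0 < h -> exists2 X, 0 < X & forall x, X <= x -> f x < h.
Proof.
move=> h0; have [M [Mr HM]] : \forall x \near +oo, f x < h by apply: cvgr_lt foo _ h0.
exists (Num.max M 0 + 1); first by rewrite ltr_wpDl// le_max lexx orbT.
move=> x Mx; apply: HM; apply: lt_le_trans Mx.
by rewrite (@le_lt_trans _ _ (Num.max M 0)) ?ltrDl// le_max lexx.
Qed.

Lemma tail_bounded s : 0 < s -> exists2 H, 0 <= H & forall x, s <= x -> f x <= H.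
Proof.
move=> s0; have [X X0 HX] := tail_small ltr01.
pose Y := Num.max s X.
have sY : s <= Y by rewrite le_max lexx.
have cfw : {within `[s, Y], continuous f}.
  by apply: continuous_in_subspaceT => x /set_mem/=; rewrite in_itv/= => /andP[sx _]; apply: cf; exact: lt_le_trans sx.
have [c csY Hc] := EVT_max sY cfw.
exists (Num.max 1 (f c)); first by rewrite le_max ler01.
move=> x sx; rewrite le_max; have [xY|Yx] := leP x Y.
  by rewrite Hc ?orbT// in_itv/= sx.
by rewrite ltW// HX// (le_trans _ (ltW Yx))// le_max lexx orbT.
Qed.

(** Its supremum is the usual generalized inverse of the distribution function of f, taken
    at the mass of the interval from 0 to s. *)
Definition levels s := [set h | 0 <= h /\ ((Lam th s)%:E < distr f h)%E].

Definition rearr (s : R) : R := sup (levels s).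

Lemma levels_ub s : 0 < s -> has_ubound (levels s).
Proof.
move=> s0; have [H H0 HH] := tail_bounded s0; exists H => h [h0 Dh].
rewrite leNgt; apply/negP => Hh.
have : (distr f h <= (Lam th s)%:E)%E.
  rewrite -wlam_0s//; apply: le_measure; rewrite ?inE//; first exact: mabove.
  move=> x [x0 hx] /=.
  rewrite in_itv/= x0/= ltNge; apply/negP => /HH xH.
  by have := lt_trans Hh (lt_le_trans hx xH); rewrite ltxx.
by rewrite leNgt Dh.
Qed.

Lemma rearr_ge0 s : 0 < s -> 0 <= rearr s.
Proof.
move=> s0; have [[h hl]|] := pselect (levels s !=set0).
  by apply: le_trans (ub_le_sup (levels_ub s0) hl); case: hl.
by move=> /nonemptyPn E; rewrite /rearr E sup0.
Qed.

(** Sets above decreasing levels increase to the set above the limit level, so a strict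
    lower bound on the distribution survives a small increase of the level. *)
Lemma distr_right_cont h (c : R) : (c%:E < distr f h)%E ->
  exists2 h', h < h' & (c%:E < distr f h')%E.
Proof.
move=> ch.
have cv : distr f (h + n.+1%:R^-1) @[n --> \oo] --> distr f h.
  rewrite {2}/distr (_ : above f h = \bigcup_n above f (h + n.+1%:R^-1)); last first.
    apply/seteqP; split => [x [x0 hx]|x [n _]]; last by apply: above_subset; rewrite lerDl.
    have [n _ Hn] : \forall n \near \oo, n.+1%:R^-1 < f x - h.
      have := @cvg_harmonic R; move/cvgr_lt; apply; by rewrite subr_gt0.
    by exists n => //; split => //; rewrite -ltrBrDl; exact: Hn n (leqnn n).
  apply: nondecreasing_cvg_mu => //.
  - by move=> i; exact: mabove.
  - by apply: bigcup_measurable => i _; exact: mabove.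
  - move=> m n mn; apply/subsetPset/above_subset; rewrite lerD2l lef_pV2 ?posrE// ler_nat//.
have [[n Hn]|/forallNP H] := pselect (exists n : nat, (c%:E < distr f (h + n.+1%:R^-1))%E).
  by exists (h + n.+1%:R^-1); rewrite ?ltrDl.
have : (distr f h <= c%:E)%E by apply: (cvge_ub cv) => n; rewrite leNgt; apply/negP/H.
by rewrite leNgt ch.
Qed.

(** The Galois connection between a distribution function and its generalized inverse. All
    the properties of the rearrangement come from it. *)
Lemma lt_rearr s h : 0 < s -> 0 <= h -> (h < rearr s) <-> ((Lam th s)%:E < distr f h)%E.
Proof.
move=> s0 h0; split.
  move=> hs; have ne : levels s !=set0.
    by apply/set0P/negP => /eqP E; move: hs; rewrite /rearr E sup0 ltNge h0.
  have [h' [h'0 Lh'] hh'] := sup_gt ne hs.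
  by apply: lt_le_trans Lh' _; exact/distr_le/ltW.
move=> /distr_right_cont[h' hh' Lh']; apply: (lt_le_trans hh'); apply: ub_le_sup; first exact: levels_ub.
by split => //; exact: le_trans h0 (ltW hh').
Qed.

Lemma rearr_nonincr s t : 0 < s -> s <= t -> rearr t <= rearr s.
Proof.
move=> s0 st; have t0 := lt_le_trans s0 st.
rewrite leNgt; apply/negP => H.
have /(lt_rearr t0 (rearr_ge0 s0)) Ht := H.
have /(lt_rearr s0 (rearr_ge0 s0)) : ((Lam th s)%:E < distr f (rearr s))%E.
  by apply: le_lt_trans Ht; rewrite lee_fin Lam_le.
by rewrite ltxx.
Qed.

Lemma above_rearr h : 0 <= h -> above rearr h = [set s | 0 < s /\ ((Lam th s)%:E < distr f h)%E].
Proof.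
by move=> h0; apply/seteqP; split => s [s0 /(lt_rearr s0 h0) H].
Qed.

Lemma distr_rearr h : 0 <= h -> distr rearr h = distr f h.
Proof.
move=> h0; rewrite {1}/distr above_rearr//.
have : (0 <= distr f h)%E by exact: measure_ge0.
case: (distr f h) => [d| |//]; last first.
  move=> _; rewrite -[RHS](wlam_P th0); congr (wlam th _); apply/seteqP; split => s /=.
    by case; rewrite in_itv/= andbT.
  by rewrite in_itv/= andbT; split => //; rewrite ltry.
rewrite lee_fin le_eqVlt => /predU1P[<-|d0].
  rewrite (_ : [set s | _] = set0) ?measure0//; apply/seteqP; split => // s [s0].
  by rewrite lte_fin ltNge ltW// Lam_gt0.
have [s s0 sd] := Lam_surj th0 d0.
rewrite -sd -wlam_0s//; congr (wlam th _); apply/seteqP; split => t /=.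
  by move=> [t0]; rewrite wlam_0s// lte_fin Lam_lt// in_itv/= t0.
by rewrite in_itv/= => /andP[t0 ts]; split => //; rewrite wlam_0s// lte_fin Lam_lt.
Qed.

(** Where f last takes the value h and then first falls to the level of the rearrangement
    at t, it stays in between on a set whose mass is at most the mass between s and t, and
    which starts beyond s. In the variable ln x this descent is then no longer than that
    of the rearrangement (Lam_ratio). *)
Lemma rearr_crossing s t h : 0 < s -> s <= t -> rearr t < h -> h < rearr s ->
  exists a b, [/\ 0 < a, a <= b, f a = h /\ f b = rearr t,
    forall x, a < x -> x < b -> rearr t < f x < rearr s & b / a <= t / s].
Proof.
move=> s0 st th1 hs; have t0 := lt_le_trans s0 st.
set k := rearr t; have k0 : 0 <= k by exact: rearr_ge0.
have h0 : 0 < h by exact: le_lt_trans th1.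
have Dh : ((Lam th s)%:E < distr f h)%E := (lt_rearr s0 (ltW h0)).1 hs.
have Dk : (distr f k <= (Lam th t)%:E)%E.
  by rewrite leNgt; apply/negP => /(lt_rearr t0 k0); rewrite ltxx.
have [X X0 HX] := tail_small h0.
pose S := above f h.
have Sne : S !=set0.
  apply/set0P/negP => /eqP E; move: Dh; rewrite /distr -/S E measure0 lte_fin.
  by rewrite ltNge ltW// Lam_gt0.
have Sub : has_ubound S.
  by exists X => x [x0 hx]; rewrite leNgt; apply/negP => /ltW/HX; rewrite ltNge ltW.
(* The last point where f reaches the level h. *)
set a := sup S.
have Sa x : S x -> x <= a by move=> Sx; exact: ub_le_sup.
have a0 : 0 < a by have [x Sx] := Sne; apply: lt_le_trans (Sa _ Sx); case: Sx.
have fa_right x : a < x -> f x <= h.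
  by move=> ax; rewrite leNgt; apply/negP => hx; have := Sa x (conj (lt_trans a0 ax) hx); rewrite leNgt ax.
have fa : f a = h.
  apply/eqP; rewrite eq_le; apply/andP; split; rewrite leNgt; apply/negP => fah.
    have [e /= e0 He] : \forall y \near a, h < f y by exact: (cvgr_gt _ (cf a0)).
    have ay : a < a + e / 2 by rewrite ltrDl divr_gt0.
    have := fa_right _ ay; rewrite leNgt => /negP; apply; apply: He.
    by rewrite /ball/= opprD addrA subrr add0r normrN gtr0_norm ?divr_gt0//; lra.
  have [e /= e0 He] : \forall y \near a, f y < h by exact: (cvgr_lt _ (cf a0)).
  have [x Sx xa] := sup_adherent e0 (conj Sne Sub).
  have := He x; rewrite /ball/= ger0_norm ?subr_ge0 ?Sa//.
  by rewrite ltrBlDr -ltrBlDl => /(_ _); case: Sx => _ hx; rewrite -/a in xa *; move=> /(_ ltac:(lra)); rewrite ltNge ltW.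
have sa : s <= a.
  rewrite -(Lam_le th0)// -lee_fin; apply: le_trans (ltW Dh) _.
  rewrite -wlam_0s//; apply: le_measure; rewrite ?inE; [exact: mabove|by []|].
  move=> x Sx /=; case: (Sx) => x0 hx; rewrite in_itv/= x0/= lt_neqAle Sa// andbT.
  by apply/negP => /eqP xa; move: hx; rewrite xa fa ltxx.
(* Up to the first return to the level k, the segment from a to y adds mass to the part
   of the set above k that already carries the mass of the set above h. *)
have K y : a <= y -> (forall x, a < x -> x < y -> k < f x) -> Lam th y - Lam th a <= Lam th t - Lam th s.
  move=> ay Hy; rewrite lerBrDr -lee_fin; apply: le_trans Dk.
  rewrite EFinD -wlam_ab//; apply: le_trans (leeD (lexx _) (ltW Dh)) _.
  rewrite -measureU//; last 2 first.
  - exact: mabove.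
  - apply/seteqP; split => // x [/=]; rewrite in_itv/= => /andP[ax _] /Sa.
    by rewrite leNgt ax.
  apply: le_measure; rewrite ?inE; [by apply: measurableU => //; exact: mabove|exact: mabove|].
  move=> x [/=|[x0 hx]]; last by split => //; exact: lt_trans hx.
  by rewrite in_itv/= => /andP[ax xy]; split; [exact: lt_trans ax|exact: Hy].
pose B := [set x | a <= x /\ f x <= k].
have Bne : B !=set0.
  apply/set0P/negP => /eqP E.
  have [y y0 Ly] := Lam_surj th0 (addr_gt0 (Lam_gt0 th0 a0) (Lam_gt0 th0 t0)).
  have ay : a <= y by rewrite -(Lam_le th0)// Ly lerDl ltW// Lam_gt0.
  have : Lam th y - Lam th a <= Lam th t - Lam th s.
    apply: K => // x ax _; rewrite ltNge; apply/negP => xk.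
    by have Bx : B x := conj (ltW ax) xk; rewrite E in Bx.
  by rewrite Ly; have := Lam_gt0 th0 s0; lra.
have Blb : has_lbound B by exists a => x [].
(* The first point from a on where f is down to the level k. *)
set b := inf B.
have bB x : B x -> b <= x by move=> Bx; exact: ge_inf.
have ab : a <= b by apply: lb_le_inf => // x [].
have b0 := lt_le_trans a0 ab.
have fbk : f b <= k.
  rewrite leNgt; apply/negP => kb.
  have [e /= e0 He] : \forall y \near b, k < f y by exact: (cvgr_gt _ (cf b0)).
  have [x Bx xb] := inf_adherent e0 (conj Bne Blb).
  have := He x; rewrite /ball/= distrC ger0_norm ?subr_ge0 ?bB// ltrBlDl => /(_ xb).
  by rewrite ltNge; case: Bx => _ ->.
have ltab : a < b.
  by rewrite lt_neqAle ab andbT; apply/negP => /eqP E; move: fbk; rewrite -E fa leNgt th1.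
have above_k x : a <= x -> x < b -> k < f x.
  move=> ax xb; rewrite ltNge; apply/negP => xk.
  by have := bB x (conj ax xk); rewrite leNgt xb.
have fb : f b = k.
  apply/eqP; rewrite eq_le fbk/= leNgt; apply/negP => fbk'.
  have [e /= e0 He] : \forall y \near b, f y < k by exact: (cvgr_lt _ (cf b0)).
  pose y := Num.max a (b - e / 2).
  have yb : y < b by rewrite gt_max ltab/=; lra.
  have ay : a <= y by rewrite le_max lexx.
  have yb' : b - e / 2 <= y by rewrite le_max lexx orbT.
  have := above_k y ay yb; rewrite ltNge => /negP; apply; apply: ltW; apply: He.
  by rewrite /ball/= ger0_norm ?subr_ge0 ?(ltW yb)//; lra.
exists a, b; split => //.
- move=> x ax xb; apply/andP; split; first exact: above_k x (ltW ax) xb.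
  exact: le_lt_trans (fa_right x ax) hs.
- apply: (Lam_ratio th0) => //; apply: K => // x ax xb; apply: above_k => //; exact: ltW.
Qed.

End rearrangement.

(** * Integrals of equimeasurable functions *)

Section layer_cake.
Context {R : realType}.
Variable th : R.
Notation mu := (@lebesgue_measure R).

(** Layer-cake formula: Tonelli's theorem on the region below the graph of g. *)
Lemma int_lambda_tonelli (g : R -> R) : measurable_fun (`]0, +oo[ : set R) g ->
  (forall x, 0 < x -> 0 <= g x) ->
  int_lambda th g = (\int[mu]_(r in `[0%R, +oo[) wlam th (above g r))%E.
Proof.
move=> mg g0.
pose F (z : R * R) : \bar R := ((\1_([set z : R * R | 0 <= z.2 /\ 0 < z.1 /\ z.2 < g z.1]) z)%:E * wdens th z.1)%E.
have mA : measurable ([set z : R * R | 0 <= z.2 /\ 0 < z.1 /\ z.2 < g z.1]).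
  pose gP : R -> R := g \_ (`]0, +oo[%classic).
  have mgP : measurable_fun setT gP by apply/(measurable_restrictT _ _).1.
  have -> : [set z : R * R | 0 <= z.2 /\ 0 < z.1 /\ z.2 < g z.1] =
    ((fun z : R * R => z.2) @^-1` `[0, +oo[%classic) `&`
    (((fun z : R * R => z.1) @^-1` `]0, +oo[%classic) `&`
    ((fun z : R * R => gP z.1 - z.2) @^-1` `]0, +oo[%classic)).
    apply/seteqP; split => [[x r]|[x r]] /=; rewrite !in_itv/= !andbT.
      move=> [r0 [x0 rx]]; split => //; split => //; rewrite /gP patchE mem_set ?subr_gt0//=.
      by rewrite in_itv/= x0.
    move=> [r0 [x0]]; rewrite /gP patchE mem_set ?subr_gt0//=.
    by rewrite in_itv/= x0.
  apply: measurableI; last apply: measurableI.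
  - rewrite -[X in measurable X]setTI; exact: measurable_snd.
  - rewrite -[X in measurable X]setTI; exact: measurable_fst.
  - rewrite -[X in measurable X]setTI.
    apply: (measurable_funB (f := fun z : R * R => gP z.1) (g := snd)) => //.
    by apply: measurableT_comp => //; exact: measurable_fst.
have mF : measurable_fun setT F.
  apply: emeasurable_funM.
    by apply/measurable_EFinP; exact: measurable_indic.
  by apply: measurableT_comp; [exact: measurable_wdens|exact: measurable_fst].
have F0 z : (0 <= F z)%E.
  by apply: mule_ge0; [rewrite lee_fin indicE; case: (_ \in _)|exact: wdens_ge0].
have E1 : int_lambda th g = (\int[mu]_x \int[mu]_y F (x, y))%E.
  rewrite /int_lambda [LHS]integral_mkcond; apply: eq_integral => x _.
  rewrite patchE; case: ifPn => [|xP]; last first.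
    symmetry; rewrite /F/=; apply: integral0_eq => y _; rewrite /wdens ifF ?mule0//.
    by apply/negbTE; apply: contra xP => x0; rewrite inE/= in_itv/= x0.
  rewrite inE/= in_itv/= andbT => x0; rewrite /F/=.
  rewrite (_ : (fun y => _) = (fun y => wdens th x * (\1_(`[0, g x[%classic) y)%:E)%E); last first.
    apply/funext => y; rewrite muleC; congr (_ * (_)%:E)%E.
    rewrite !indicE; congr ((_ : bool)%:R); apply/idP/idP; rewrite !inE/= in_itv/=.
      by move=> [-> [_ ->]].
    by move=> /andP[-> ->].
  symmetry; rewrite ge0_integralZl//; last 2 first.
  - by apply/measurable_EFinP; exact: measurable_indic.
  - exact: wdens_ge0.
  have I1 : (\int[mu]_y (\1_(`[0%R, g x[%classic) y)%:E = (g x)%:E)%E.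
    rewrite integral_indic// setIT.
    rewrite [LHS](@lebesgue_measure_itv R `[0, g x[) /= lte_fin.
    by have := g0 x x0; rewrite le_eqVlt => /predU1P[<-|->]; rewrite ?ltxx// sube0.
  by rewrite I1 /wdens x0 muleC -EFinM.
apply: (etrans E1); apply: (etrans (@fubini_tonelli _ _ _ _ R mu mu F mF F0)).
rewrite [RHS]integral_mkcond; apply: eq_integral => r _.
rewrite patchE; case: ifPn => [|rP].
  rewrite inE/= in_itv/= andbT => r0; rewrite /wlam [RHS]integral_mkcond.
  apply: eq_integral => x _; rewrite /F/= patchE indicE.
  have [H|H] := pselect (above g r x).
    rewrite (mem_set H) (_ : _ \in _) ?mul1e//.
    by rewrite inE/=; case: H.
  rewrite (memNset H) (_ : _ \in _ = false) ?mul0e//.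
  by apply/negbTE; rewrite notin_setE/= => -[_ ?]; apply: H.
apply: integral0_eq => x _; rewrite /F indicE memNset ?mul0e//= => -[r0 _].
by move/negP: rP; apply; rewrite inE/= in_itv/= r0.
Qed.

(** The set where phi exceeds r is empty or an upper interval, open at its left end by
    continuity. The superlevel sets of phi o g are then superlevel sets of g, at a level
    that does not depend on g. *)
Lemma above_comp (f phi : R -> R) r :
  (forall x, 0 < x -> 0 <= f x) -> 0 <= r ->
  (forall x y, 0 <= x -> x <= y -> phi x <= phi y) -> phi 0 = 0 ->
  (forall t, 0 < t -> {for t, continuous phi}) ->
  (forall t, 0 <= t -> phi t <= r) /\ above (phi \o f) r = set0 \/
  exists2 h, 0 <= h & forall g, (forall x, 0 < x -> 0 <= g x) -> above (phi \o g) r = above g h.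
Proof.
move=> f0 r0 ndphi phi0 cphi.
pose S := [set t | 0 <= t /\ phi t <= r].
have S0 : S 0 by split => //; rewrite phi0.
have [Sub|Sub] := pselect (has_ubound S); last first.
  have H t : 0 <= t -> phi t <= r.
    move=> t0; apply: contra_notP Sub => tr; exists t => s [s0 sr].
    rewrite leNgt; apply/negP => ts; apply: tr.
    by apply: le_trans sr; apply: ndphi => //; exact: ltW.
  left; split => //; apply/seteqP; split => // x [x0 /=]; rewrite ltNge H//; exact: f0.
right; pose h := sup S.
have h0 : 0 <= h by exact: ub_le_sup.
have hr : phi h <= r.
  rewrite leNgt; apply/negP => rh.
  have hp : 0 < h by rewrite lt_neqAle h0 andbT; apply/negP => /eqP E; move: rh; rewrite -E phi0 ltNge r0.
  have [e /= e0 He] : \forall y \near h, r < phi y by exact: (cvgr_gt _ (cphi h hp)).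
  have [s [s0 sr] hs] := sup_adherent e0 (conj (ex_intro _ 0 S0) Sub).
  have sh : s <= h by exact: ub_le_sup.
  have := He s; rewrite /ball/= ger0_norm ?subr_ge0// ltrBlDr -ltrBlDl.
  by move=> /(_ hs); rewrite ltNge sr.
exists h => // g g0; apply/seteqP; split => x [x0 /= H]; split => //=.
  rewrite ltNge; apply/negP => gh; move: H; rewrite ltNge => /negP; apply.
  by apply: le_trans hr; apply: ndphi => //; exact: g0.
rewrite ltNge; apply/negP => gr.
have : g x <= h by apply: ub_le_sup => //; split => //; exact: g0.
by rewrite leNgt H.
Qed.

Lemma int_lambda_equidistr (f g phi : R -> R) :
  measurable_fun (`]0, +oo[ : set R) f -> measurable_fun (`]0, +oo[ : set R) g ->
  (forall x, 0 < x -> 0 <= f x) -> (forall x, 0 < x -> 0 <= g x) ->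
  (forall h, 0 <= h -> distr th g h = distr th f h) ->
  measurable_fun setT phi ->
  (forall x y, 0 <= x -> x <= y -> phi x <= phi y) -> phi 0 = 0 ->
  (forall t, 0 < t -> {for t, continuous phi}) ->
  int_lambda th (phi \o g) = int_lambda th (phi \o f).
Proof.
move=> mf mg f0 g0 fg mphi ndphi phi0 cphi.
have phi_ge0 t : 0 <= t -> 0 <= phi t by move=> t0; rewrite -phi0 ndphi.
have mc k : measurable_fun (`]0, +oo[ : set R) k -> measurable_fun (`]0, +oo[ : set R) (phi \o k).
  by move=> mk; exact: measurableT_comp.
rewrite (int_lambda_tonelli (mc f mf)); last by move=> x x0; apply: phi_ge0; exact: f0.
rewrite (int_lambda_tonelli (mc g mg)); last by move=> x x0; apply: phi_ge0; exact: g0.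
apply: eq_integral => r; rewrite inE/= in_itv/= andbT => r0.
have [[H fr]|[h h0 H]] := above_comp f0 r0 ndphi phi0 cphi; last by rewrite !H//; exact: fg.
rewrite fr (_ : above (phi \o g) r = set0)//.
apply/seteqP; split => // x [x0 /=]; rewrite ltNge H//; exact: g0.
Qed.

End layer_cake.

(** * Discrete energy *)

Lemma midr_lt (R : realType) (y d : R) : 0 <= y -> y < d ->
  [/\ 0 < (y + d) / 2, (y + d) / 2 < d & y < (y + d) / 2].
Proof. by move=> y0 yd; split; lra. Qed.

(** States that the supremum of the sums of chord energies is at most e, without naming
    that supremum: only upper bounds on energies occur. *)
Definition energy_le (R : realType) (p : R) (v : R -> R) (e : R) : Prop :=
  forall (n : nat) (a b : 'I_n -> R), (forall i, 0 < a i /\ a i <= b i) ->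
    trivIset setT (fun i => `]a i, b i[%classic) ->
    \sum_(i < n) seg p v (a i) (b i) <= e.

Section segment_families.
Context {R : realType}.
Notation mu := (@lebesgue_measure R).

Lemma sum_integral_le (T : finType) (F : T -> set R) (D : set R) (f : R -> \bar R) :
  (forall i, measurable (F i)) -> trivIset setT F -> measurable D -> (forall i, F i `<=` D) ->
  measurable_fun D f -> (forall x, D x -> 0 <= f x)%E ->
  (\sum_i \int[mu]_(x in F i) f x <= \int[mu]_(x in D) f x)%E.
Proof.
move=> mF tF mD FD mf f0.
have UD : \big[setU/set0]_(i <- index_enum T) F i `<=` D.
  by apply: (big_ind (fun A => A `<=` D)) => // A B AD BD x [/AD|/BD].
have mU : measurable (\big[setU/set0]_(i <- index_enum T) F i) by exact: bigsetU_measurable.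
rewrite -(@ge0_integral_bigsetU _ _ R mu _ F f (index_enum T)) => //.
- exact: ge0_subset_integral.
- exact: index_enum_uniq.
- by apply: sub_trivIset tF.
- exact: measurable_funS mf.
- by move=> x /UD /f0.
Qed.

Lemma disjoint_oo (a b c d : R) : a < b -> c < d -> `]a, b[ `&` `]c, d[ = set0 -> b <= c \/ d <= a.
Proof.
move=> ab cd E; have [bc|cb] := leP b c; first by left.
have [da|ad] := leP d a; first by right.
exfalso; pose x := (Num.max a c + Num.min b d) / 2.
have m1 : Num.max a c < Num.min b d by rewrite gt_max !lt_min ab cb ad cd.
suff : (`]a, b[ `&` `]c, d[) x by rewrite E.
have x1 : Num.max a c < x by rewrite /x; lra.
have x2 : x < Num.min b d by rewrite /x; lra.
move: x1 x2; rewrite gt_max lt_min => /andP[? ?] /andP[? ?].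
by split; rewrite /= in_itv/=; apply/andP.
Qed.

End segment_families.

Section dominated_segments.
Context {R : realType}.
Variable p : R.
Hypothesis p1 : 1 < p.
Notation mu := (@lebesgue_measure R).

Variables (w : R -> R) (rho : R -> \bar R).
Hypothesis mrho : measurable_fun (`]0, +oo[ : set R) rho.
Hypothesis rho0 : forall x : R, 0 < x -> (0 <= rho x)%E.

Let dominated a b := ((seg p w a b)%:E <= \int[mu]_(x in `]a, b[) rho x)%E.

Let sub_pos a b : 0 < a -> `]a, b[ `<=` (`]0, +oo[ : set R).
Proof. by move=> a0 x /=; rewrite !in_itv/= andbT => /andP[ax _]; exact: lt_trans ax. Qed.

(** Domination of chord energies by the integral of rho needs to be checked only on the
    pieces between given points: cutting a segment does not lower the sum of the chord
    energies, and integrals are additive. *)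
Lemma seg_glue s c : 0 < c ->
  (forall a b, 0 < a -> s <= a -> a < b -> b <= c -> dominated a b) ->
  (forall a b, 0 < a -> c <= a -> a < b -> dominated a b) ->
  forall a b, 0 < a -> s <= a -> a < b -> dominated a b.
Proof.
move=> c0 Hl Hr a b a0 sa ab.
have [bc|cb] := leP b c; first exact: Hl.
have [ca|ac] := leP c a; first exact: Hr.
have S : seg p w a b <= seg p w a c + seg p w c b.
  by apply: seg_split => //; exact: ltW.
have mac : measurable (`]a, c[%classic : set R) by exact: measurable_itv.
have mcb : measurable (`]c, b[%classic : set R) by exact: measurable_itv.
have mU := measurableU _ _ mac mcb.
have sU : `]a, c[ `|` `]c, b[ `<=` (`]a, b[%classic : set R).
  by move=> x /=; rewrite !in_itv/= => -[|] /andP[? ?]; apply/andP; split => //;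
    [exact: lt_trans cb|exact: lt_trans ac _].
have mab : measurable_fun (`]a, b[ : set R) rho.
  by apply: measurable_funS mrho => //; exact: sub_pos.
have rab x : (`]a, b[%classic : set R) x -> (0 <= rho x)%E.
  by move=> /(sub_pos a0) /=; rewrite in_itv/= andbT; exact: rho0.
apply: (@le_trans _ _ (\int[mu]_(x in `]a, c[) rho x + \int[mu]_(x in `]c, b[) rho x)%E).
  apply: (@le_trans _ _ ((seg p w a c)%:E + (seg p w c b)%:E)%E); first by rewrite -EFinD lee_fin.
  by apply: leeD; [exact: Hl|exact: Hr].
rewrite -ge0_integral_setU//.
- exact: ge0_subset_integral.
- by apply: measurable_funS mab.
- by move=> x /sU; exact: rab.
- apply/disj_setPS => x [/=]; rewrite !in_itv/= => /andP[_ xc] /andP[cx _].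
  by move: (lt_trans cx xc); rewrite ltxx.
Qed.

Lemma dominated_energy (k : R) : (forall a b, 0 < a -> a < b -> dominated a b) ->
  (\int[mu]_(x in `]0%R, +oo[) rho x <= k%:E)%E -> energy_le p w k.
Proof.
move=> H Ek n a b ab tab; rewrite -lee_fin -sumEFin; apply: le_trans Ek.
apply: (@le_trans _ _ (\sum_(i < n) \int[mu]_(x in `]a i, b i[) rho x)%E).
  apply: lee_sum => i _; have [a0 aib] := ab i.
  move: aib; rewrite le_eqVlt => /predU1P[<-|aib]; last exact: H.
  by rewrite segxx// set_itvoo0 integral_set0.
apply: (@sum_integral_le _ _ (fun i => `]a i, b i[%classic)) => //.
- by move=> i; apply: sub_pos; have [] := ab i.
- by move=> x /=; rewrite in_itv/= andbT; exact: rho0.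
Qed.

End dominated_segments.

Section gradient_energy.
Context {R : realType}.
Variable p : R.
Hypothesis p1 : 1 < p.
Notation mu := (@lebesgue_measure R).

Section W.
Variable u : R -> R.
Hypothesis acu : loc_abs_cont u.
Hypothesis mu' : measurable_fun (`]0, +oo[ : set R) (derive1 u).
Let P : set R := `]0, +oo[%classic.

Definition grad_density (x : R) : \bar R := (`|derive1 u x| `^ p * x `^ (p - 1))%:E.

Lemma grad_density_ge0 x : (0 <= grad_density x)%E.
Proof. by rewrite lee_fin mulr_ge0 ?powR_ge0. Qed.

Lemma measurable_grad_density : measurable_fun (`]0, +oo[ : set R) grad_density.
Proof.
apply/measurable_EFinP; apply: measurable_funM.
  apply: (@measurableT_comp _ _ _ _ _ _ (fun y : R => y `^ p)); first exact: measurable_powR.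
  exact: measurableT_comp.
by apply: measurable_funTS; exact: measurable_powR.
Qed.

Lemma seg_le_grad a b : 0 < a -> a <= b ->
  ((seg p u a b)%:E <= \int[mu]_(x in `]a, b[) grad_density x)%E.
Proof.
move=> a0; rewrite le_eqVlt => /predU1P[<-|ab].
  by rewrite segxx// set_itvoo0 integral_set0.
by apply: seg_le_integral => //; [exact: ltW|exact: acu].
Qed.

Lemma W_energy (k : R) : (\int[mu]_(x in `]0%R, +oo[) grad_density x <= k%:E)%E -> energy_le p u k.
Proof.
apply: (dominated_energy p1 measurable_grad_density) => [x _|a b a0 ab]; first exact: grad_density_ge0.
by apply: seg_le_grad => //; exact: ltW.
Qed.

Variable th : R.
Hypothesis th0 : 0 <= th.
Hypothesis cu : forall x : R, 0 < x -> {for x, continuous u}.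
Hypothesis uoo : u x @[x --> +oo] --> (0 : R).

Let f (x : R) : R := `|u x|.
Let cf x : 0 < x -> {for x, continuous f}.
Proof. by move=> x0; apply: continuous_comp; [exact: cu|exact: norm_continuous]. Qed.
Let f0 x : 0 < x -> 0 <= f x. Proof. by move=> _; exact: normr_ge0. Qed.
Let foo : f x @[x --> +oo] --> (0 : R).
Proof. by rewrite -(normr0 R); apply: cvg_norm. Qed.
Let v := rearr th f.

Let S s t := [set x | 0 < x /\ v t < f x < v s].

Let mS s t : measurable (S s t).
Proof.
have mf := continuous_measurable_pos cf.
have := mf (measurable_itv `]0, +oo[) `]v t, v s[%classic (measurable_itv _).
by congr (measurable _); apply/seteqP; split => x /=; rewrite !in_itv/= !andbT.
Qed.

Let SP s t : S s t `<=` P. Proof. by move=> x [x0 _]; rewrite /P/= in_itv/= x0. Qed.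

(** Every descent of the rearrangement over [s, t] is matched by a descent of |u| inside
    the set of points where |u| lies between the two end values (rearr_crossing). The
    starting level h has to stay strictly below the value at s and tends to it at the end. *)
Lemma seg_rearr s t : 0 < s -> s <= t ->
  ((seg p v s t)%:E <= \int[mu]_(x in S s t) grad_density x)%E.
Proof.
move=> s0 st.
have I0 : (0 <= \int[mu]_(x in S s t) grad_density x)%E.
  by apply: integral_ge0 => x _; exact: grad_density_ge0.
have vts : v t <= v s by exact: rearr_nonincr.
move: (vts); rewrite le_eqVlt => /predU1P[E|ltv].
  by rewrite /seg E subrr normr0 powR0 ?mul0r//; apply: lt0r_neq0; exact: lt_trans p1.
have ltst : s < t by rewrite lt_neqAle st andbT; apply/negP => /eqP E; move: ltv; rewrite E ltxx.
case E : (\int[mu]_(x in S s t) grad_density x)%E I0 => [e| |//] e0; last by rewrite leey.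
have t0 := lt_trans s0 ltst.
have lts : 0 < ln (t / s) by rewrite ln_gt0// ltr_pdivlMr// mul1r.
have ltsp : 0 < ln (t / s) `^ (p - 1) by exact: powR_gt0.
have p0 : 0 < p by exact: lt_trans p1.
have pm0 : 0 < p - 1 by rewrite subr_gt0.
have key h : v t < h -> h < v s -> (h - v t) `^ p <= e * ln (t / s) `^ (p - 1).
  move=> vh hs; have [a [b [a0 ab [fa fb] Hab ratio]]] := rearr_crossing th0 cf foo s0 st vh hs.
  change (f b = v t) in fb.
  have ltab : a < b.
    by rewrite lt_neqAle ab andbT; apply/negP => /eqP E'; move: vh; rewrite -fb -E' fa ltxx.
  have b0 := lt_trans a0 ltab.
  have lab : 0 < ln (b / a) by rewrite ln_gt0// ltr_pdivlMr// mul1r.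
  have lle : ln (b / a) <= ln (t / s) by rewrite ler_ln ?posrE ?divr_gt0.
  have : seg p u a b <= e.
    rewrite -lee_fin -E; apply: le_trans (seg_le_grad a0 ab) _.
    apply: ge0_subset_integral => //; first exact: mS.
    - by apply: measurable_funS measurable_grad_density => //; exact: SP.
    - by move=> x _; exact: grad_density_ge0.
    - move=> x /=; rewrite in_itv/= => /andP[ax xb]; split; first exact: lt_trans ax.
      exact: Hab.
  rewrite /seg ler_pdivrMr ?powR_gt0// => H.
  apply: (@le_trans _ _ (`|u b - u a| `^ p)).
    apply: ge0_ler_powR; rewrite ?nnegrE ?(ltW p0)//; first by rewrite subr_ge0 ltW.
    by rewrite -fb -fa /f distrC; apply: le_trans (ler_norm _) _; exact: ler_dist_dist.
  apply: (le_trans H); apply: ler_wpM2l; first by rewrite -lee_fin.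
  by apply: ge0_ler_powR; rewrite ?nnegrE//; exact: ltW.
rewrite lee_fin /seg ler_pdivrMr// leNgt; apply/negP => Hlt.
set c := e * _ in key Hlt.
have c0 : 0 <= c by rewrite mulr_ge0 ?(ltW ltsp)// -lee_fin.
rewrite distrC ger0_norm ?subr_ge0// in Hlt.
pose y := c `^ p^-1.
have yp : y `^ p = c by rewrite /y -powRrM mulVf ?gt_eqF// powRr1.
have y0 : 0 <= y by exact: powR_ge0.
have yd : y < v s - v t.
  rewrite ltNge; apply/negP => H; move: Hlt; rewrite -yp ltNge => /negP; apply.
  by apply: ge0_ler_powR; rewrite ?nnegrE ?(ltW p0) ?subr_ge0.
have [m0 md ym] := midr_lt y0 yd.
have h1 : v t < v t + (y + (v s - v t)) / 2 by rewrite ltrDl.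
have h2 : v t + (y + (v s - v t)) / 2 < v s by rewrite -ltrBrDl.
have := key _ h1 h2; rewrite -yp addrC addKr leNgt => /negP; apply.
by apply: gt0_ltr_powR => //; rewrite nnegrE ltW.
Qed.

(** Disjoint segments give disjoint ranges of values of the monotone rearrangement, hence
    disjoint sets of points for u. *)
Lemma rearr_energy (k : R) : (\int[mu]_(x in `]0%R, +oo[) grad_density x <= k%:E)%E -> energy_le p v k.
Proof.
move=> Ek n a b ab tab; rewrite -lee_fin -sumEFin; apply: le_trans Ek.
apply: (@le_trans _ _ (\sum_(i < n) \int[mu]_(x in S (a i) (b i)) grad_density x)%E).
  by apply: lee_sum => i _; have [? ?] := ab i; exact: seg_rearr.
apply: (@sum_integral_le _ _ (fun i => S (a i) (b i))) => //.
- move=> i j _ _ [x [[x0 /andP[i1 i2]] [_ /andP[j1 j2]]]].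
  apply: contrapT => /eqP ij.
  have lt_ab l : v (b l) < f x -> f x < v (a l) -> a l < b l.
    move=> h1 h2; have [_ le] := ab l; rewrite lt_neqAle le andbT.
    by apply/negP => /eqP E; have := lt_trans h1 h2; rewrite E ltxx.
  have D : `]a i, b i[ `&` `]a j, b j[ = set0.
    apply/eqP; apply: contraNT ij => /set0P H; apply/eqP; exact: tab.
  have [ai _] := ab i; have [aj _] := ab j.
  have [bi|bj] := disjoint_oo (lt_ab i i1 i2) (lt_ab j j1 j2) D.
    have H := rearr_nonincr th0 cf foo (lt_trans ai (lt_ab i i1 i2)) bi.
    by have := lt_le_trans j2 H; rewrite ltNge (ltW i1).
  have H := rearr_nonincr th0 cf foo (lt_trans aj (lt_ab j j1 j2)) bj.
  by have := lt_le_trans i2 H; rewrite ltNge (ltW j1).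
- exact: measurable_grad_density.
- by move=> x _; exact: grad_density_ge0.
Qed.

End W.
End gradient_energy.

(** * Measurability of the derivative *)

Section measurable_derivative.
Context {R : realType}.
Variable v : R -> R.
Hypothesis cv : forall x : R, 0 < x -> {for x, continuous v}.
Let P : set R := `]0, +oo[%classic.
Let w := v \_ P.

Let wE x : 0 < x -> w x = v x.
Proof. by move=> x0; rewrite /w patchE mem_set// /P/= in_itv/= x0. Qed.

Let mw : measurable_fun setT w.
Proof. by apply/(measurable_restrictT _ _).1; [exact: measurable_itv|exact: continuous_measurable_pos]. Qed.

Let q (h x : R) := h^-1 * (v (h + x) - v x).
Let Q (h x : R) := h^-1 * (w (h + x) - w x).

Let mQ h : measurable_fun setT (Q h).
Proof.
apply: measurable_funM => //; apply: measurable_funB => //.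
by apply: measurableT_comp => //; exact: measurable_funD.
Qed.

Let QE h x : 0 < x -> 0 < h + x -> Q h x = q h x.
Proof. by move=> x0 hx; rewrite /Q /q !wE. Qed.

Let B (k m : nat) (r : rat * rat) : set R :=
  if (0 < `|ratr r.1 : R| < m.+1%:R^-1) && (0 < `|ratr r.2 : R| < m.+1%:R^-1)
  then [set x | `|Q (ratr r.1) x - Q (ratr r.2) x| <= k.+1%:R^-1] else setT.

Let rr (n : nat) : rat * rat := odflt (0, 0) (unpickle n).

(* For every k there is m such that the difference quotients for rational increments
   smaller than 1/(m+1) differ by at most 1/(k+1). *)
Let D : set R := \bigcap_k \bigcup_m \bigcap_n B k m (rr n).

Let mD : measurable D.
Proof.
apply: bigcap_measurable => // k _; apply: bigcup_measurable => m _.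
apply: bigcap_measurable => // n _; move: (rr n) => r.
rewrite /B; case: ifP => // _.
have mf : measurable_fun setT (fun x => `|Q (ratr r.1) x - Q (ratr r.2) x|).
  by apply: measurableT_comp => //; exact: measurable_funB.
have := mf measurableT `]-oo, k.+1%:R^-1]%classic (measurable_itv _).
by rewrite setTI; congr measurable; apply/seteqP; split => x /=; rewrite in_itv.
Qed.

Let derivable_pos x := cvg (q h x @[h --> 0^']).

Let cvg_D x : 0 < x -> derivable_pos x -> D x.
Proof.
move=> x0 /cvg_ex[l /= ql] k _.
have k0 : 0 < (k.+1%:R^-1 : R) / 2 by rewrite divr_gt0.
have [e /= e0 He] : \forall h \near 0^', `|l - q h x| < k.+1%:R^-1 / 2.
  by move/cvgrPdist_lt : ql; apply.
have [m _ Hm] : \forall m \near \oo, (m.+1%:R^-1 : R) < Num.min e x.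
  by have := @cvg_harmonic R; move/cvgr_lt; apply; rewrite lt_min e0 x0.
have {}Hm := Hm m (leqnn m); move: Hm; rewrite /= lt_min => /andP[me mx].
exists m => // n _; move: (rr n) => r; rewrite /B; case: ifP => // /andP[/andP[r10 r1m] /andP[r20 r2m]] /=.
have E s : 0 < `|s : R| -> `|s| < m.+1%:R^-1 -> `|l - Q s x| < k.+1%:R^-1 / 2.
  move=> s0 sm; rewrite QE//; last first.
    have := lt_trans sm mx; rewrite ltr_norml => /andP[h1 _].
    by rewrite -(opprK s) addrC subr_gt0 -ltrNl.
  apply: He; last by rewrite -normr_gt0.
  by rewrite /ball_/= sub0r normrN; exact: lt_trans me.
have := E _ r10 r1m; have := E _ r20 r2m => h2 h1.
rewrite (_ : _ - _ = (l - Q (ratr r.2) x) - (l - Q (ratr r.1) x)); last by ring.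
apply: le_trans (ler_normB _ _) _; rewrite [leRHS]splitr.
by rewrite lerD// ltW.
Qed.

Let q_continuous x h : 0 < x -> 0 < h + x -> h != 0 -> {for h, continuous (q ^~ x)}.
Proof.
move=> x0 hx h0; apply: cvgM; first exact: inv_continuous.
apply: cvgB; last exact: cvg_cst.
apply: (@continuous_comp _ _ _ (fun h => h + x) v); last exact: cv.
by apply: cvgD; [exact: cvg_id|exact: cvg_cst].
Qed.

Let D_cvg x : 0 < x -> D x -> derivable_pos x.
Proof.
move=> x0 Dx; apply/cauchy_cvgP/cauchyP => e e0.
have [k _ Hk] : \forall m \near \oo, (m.+1%:R^-1 : R) < e.
  by have := @cvg_harmonic R; move/cvgr_lt; apply.
have {}Hk := Hk k (leqnn k).
have [m _ Hm0] := Dx k I.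
have Hm r : B k m r x by have := Hm0 (pickle r) I; rewrite /rr pickleK.
have [m' _ Hm'] : \forall j \near \oo, (j.+1%:R^-1 : R) < Num.min m.+1%:R^-1 x.
  by have := @cvg_harmonic R; move/cvgr_lt; apply; rewrite lt_min x0 invr_gt0 ltr0n.
have {}Hm' := Hm' m' (leqnn m'); move: Hm'; rewrite /= lt_min => /andP[m'm m'x].
pose r0 : rat := m'.+1%:R^-1.
have r0E : ratr r0 = (m'.+1%:R^-1 : R) by rewrite /r0 fmorphV rmorph_nat.
exists (Q (ratr r0) x).
exists (Num.min m.+1%:R^-1 x) => /=; first by rewrite lt_min x0 invr_gt0 ltr0n.
move=> h; rewrite /ball_/= sub0r normrN lt_min => /andP[hm hx] h0.
have hx0 : 0 < h + x.
  by move: hx; rewrite ltr_norml => /andP[h1 _]; rewrite -(opprK h) addrC subr_gt0 -ltrNl.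
apply: le_lt_trans Hk; rewrite leNgt; apply/negP => /= Hlt.
have cq := q_continuous x0 hx0 h0.
have cq' : {for h, continuous (fun h => `|Q (ratr r0) x - q h x|)}.
  by apply: cvg_norm; apply: cvgB; [exact: cvg_cst|exact: cq].
have N1 : \forall h' \near h, k.+1%:R^-1 < `|Q (ratr r0) x - q h' x| by exact: (cvgr_gt _ cq').
have N2 : \forall h' \near h, `|h'| < Num.min m.+1%:R^-1 x.
  by apply: (cvgr_lt _ (@norm_continuous _ _ h)); rewrite lt_min hm.
have N3 : \forall h' \near h, 0 < `|h'|.
  by apply: (cvgr_gt _ (@norm_continuous _ _ h)); rewrite normr_gt0.
have : \forall h' \near h, [/\ k.+1%:R^-1 < `|Q (ratr r0) x - q h' x|, `|h'| < Num.min m.+1%:R^-1 x & 0 < `|h'|].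
  by near=> h'; split; near: h'.
move=> [e' /= e'0 HU].
have neb : ball h e' !=set0 by exists h; exact: ballxx.
have [h' [/HU[h1 h2 h3] [r _ rE]]] := dense_rat neb (@ball_open _ _ h e').
have := Hm (r0, r); rewrite /B /= r0E ger0_norm// invr_gt0 ltr0n m'm/= rE.
move: h2; rewrite lt_min => /andP[h2 h2x]; rewrite h3 h2/=.
have r0x : 0 < ratr r0 + x by rewrite r0E addr_gt0// invr_gt0 ltr0n.
have hx' : 0 < h' + x.
  by move: h2x; rewrite ltr_norml => /andP[h4 _]; rewrite -ltrNl in h4; rewrite addrC -ltrBlDr sub0r; exact: h4.
rewrite (QE x0 hx') -r0E leNgt h1//.
Unshelve. all: by end_near. Qed.

(** By Cauchy's criterion, derivability at x is expressed with rational increments only,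
    as v is continuous; so the set D of these points is measurable. On D the derivative is
    a limit of difference quotients, and elsewhere derive1 takes a constant junk value. *)
Lemma measurable_derive1_pos : measurable_fun (`]0, +oo[ : set R) (derive1 v).
Proof.
have mP : measurable P by exact: measurable_itv.
have -> : (`]0, +oo[%classic : set R) = (P `&` D) `|` (P `\` D).
  by rewrite setUIDK.
apply/measurable_funU; [exact: measurableI|exact: measurableD|split].
- apply: (@measurable_fun_cvg _ _ R _ (fun n => Q n.+1%:R^-1)).
    by move=> n; exact: measurable_funTS.
  move=> x []; rewrite /P/= in_itv/= andbT => x0 /(D_cvg x0) dx.
  have : q h x @[h --> 0^'] --> derive1 v x by exact: dx.
  move=> /cvgr_dnbhsP H.
  rewrite (_ : (fun n => _) = (fun n => q n.+1%:R^-1 x)).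
    apply: H; split; last exact: cvg_harmonic.
    by move=> n; rewrite gt_eqF// invr_gt0 ltr0n.
  by apply/funext => n; rewrite QE// addr_gt0// invr_gt0 ltr0n.
- apply: (eq_measurable_fun (cst (0 : R))) => // x; rewrite inE => -[].
  rewrite /P/= in_itv/= andbT => x0 nD; rewrite /derive1.
  symmetry; apply: dvgP => cvx; apply: nD; apply: cvg_D => //.
Qed.

End measurable_derivative.

(** * From the discrete energy back to the gradient *)

Lemma loc_abs_cont_continuous (R : realType) (v : R -> R) : loc_abs_cont v ->
  forall x : R, 0 < x -> {for x, continuous v}.
Proof.
move=> acv x x0; apply/cvgrPdist_lt => e e0.
have s0 : 0 < x / 2 by rewrite divr_gt0.
have st : x / 2 < x + 1 by lra.
have [d d0 H] := acv _ _ s0 st e e0.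
have K a b : x / 2 <= a -> a <= b -> b <= x + 1 -> b - a < d -> `|v b - v a| < e.
  move=> sa ab bt bad; have := H 1%N (fun _ => a) (fun _ => b); rewrite !big_ord1; apply => //.
  by move=> i j _ _ _; rewrite (ord1 i) (ord1 j).
exists (Num.min d (Num.min (x / 2) 1)) => /=; first by rewrite !lt_min d0 s0 ltr01.
move=> y /=; rewrite !lt_min => /and3P[].
have [xy|yx] := leP x y.
  rewrite ler0_norm ?subr_le0// opprB => h1 h2 h3; rewrite distrC.
  by apply: K => //; lra.
rewrite gtr0_norm ?subr_gt0// => h1 h2 h3.
by apply: K => //; lra.
Qed.

Section energy_regularity.
Context {R : realType}.
Variables (p : R) (v : R -> R) (e : R).
Hypothesis p1 : 1 < p.
Hypothesis Ev : energy_le p v e.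
Notation mu := (@lebesgue_measure R).

Let p0 : 0 < p. Proof. exact: lt_trans p1. Qed.
Let pm0 : 0 < p - 1. Proof. by rewrite subr_gt0. Qed.

Lemma energy_ge0 : 0 <= e.
Proof.
have := Ev (n := 0) (a := fun=> 1) (b := fun=> 1); rewrite big_ord0; apply; first by case.
by move=> [].
Qed.

Lemma ln_ratio_le (s a b : R) : 0 < s -> s <= a -> a <= b -> ln (b / a) <= (b - a) / s.
Proof.
move=> s0 sa ab; have a0 := lt_le_trans s0 sa.
have -> : b / a = 1 + (b - a) / a by field; rewrite gt_eqF.
apply: (@le_trans _ _ ((b - a) / a)).
  by apply: le_ln1Dx; rewrite (lt_le_trans (ltrN10 _))// divr_ge0 ?subr_ge0// ltW.
by rewrite ler_wpM2l ?subr_ge0// lef_pV2 ?posrE.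
Qed.

(** Summing the tangent inequality bounds the sum of the increments by (e + c k^p L) / (p
    k^(p-1)), where L is the total logarithmic length. A large slope k makes the first
    term small, and then a small L the second one. *)
Lemma energy_loc_abs_cont : loc_abs_cont v.
Proof.
move=> s t s0 st eps eps0.
have e0 := energy_ge0.
pose K := 2 * (e + 1) / (p * eps).
have K0 : 0 < K by rewrite divr_gt0 ?mulr_gt0// ltr_wpDl.
pose k := K `^ (p - 1)^-1.
have k0 : 0 < k by exact: powR_gt0.
have kK : k `^ (p - 1) = K by rewrite /k -powRrM mulVf ?gt_eqF// powRr1 ?ltW.
pose c := (p - 1) * k `^ p.
have c0 : 0 < c by rewrite mulr_gt0// powR_gt0.
exists (s / c); first by rewrite divr_gt0.
move=> n a b ab tab sab.
have ab' i : 0 < a i /\ a i <= b i.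
  by have [sa ? _] := ab i; split => //; exact: lt_le_trans sa.
have H1 := Ev ab' tab.
have H2 : p * K * \sum_(i < n) `|v (b i) - v (a i)| <= e + c * (\sum_(i < n) (b i - a i) / s).
  rewrite mulr_sumr; apply: (@le_trans _ _ (\sum_(i < n) (seg p v (a i) (b i) + c * ((b i - a i) / s)))).
    apply: ler_sum => i _; have [sa aibi _] := ab i; have [ai0 _] := ab' i.
    rewrite -kK; apply: le_trans (seg_tangent p1 v ai0 aibi (ltW k0)) _.
    by rewrite lerD2l -/c ler_wpM2l ?(ltW c0)//; exact: ln_ratio_le.
  by rewrite big_split/= -mulr_sumr lerD.
have H3 : c * (\sum_(i < n) (b i - a i) / s) < 1.
  by rewrite -mulr_suml mulrCA -ltr_pdivlMr ?divr_gt0// div1r invf_div.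
have H4 : p * K * \sum_(i < n) `|v (b i) - v (a i)| < e + 1 by apply: le_lt_trans H2 _; rewrite ltrD2l.
have pKe : p * K * eps = 2 * (e + 1) by rewrite /K; field; rewrite !gt_eqF.
have pK0 : 0 < p * K by exact: mulr_gt0.
rewrite -(ltr_pM2l pK0) pKe; apply: lt_le_trans H4 _.
by rewrite ler_peMl ?ler1n// addr_ge0.
Qed.

Lemma energy_continuous (x : R) : 0 < x -> {for x, continuous v}.
Proof. exact/loc_abs_cont_continuous/energy_loc_abs_cont. Qed.

(** At a point of derivability the slopes of chords containing the point converge too, not
    only those of chords that start at it. *)
Lemma slope_cvg (x : R) (a b : nat -> R) : derivable v x 1 ->
  (forall n, a n <= x) -> (forall n, x < b n) -> b n - a n @[n --> \oo] --> (0 : R) ->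
  (v (b n) - v (a n)) / (b n - a n) @[n --> \oo] --> derive1 v x.
Proof.
move=> dv ax xb ab0; apply/cvgrPdist_le => eps eps0.
have : h^-1 *: (v (h + x) - v x) @[h --> 0^'] --> derive1 v x.
  have := dv; rewrite /derivable /derive1.
  by under eq_fun do rewrite /= [_%:A]mulr1.
move=> /cvgrPdist_le /(_ eps eps0)[d /= d0 Hd].
have Hd' h : `|h| < d -> `|v (h + x) - v x - h * derive1 v x| <= eps * `|h|.
  move=> hd; have [->|h0] := eqVneq h 0.
    by rewrite add0r subrr mul0r subr0 normr0 mulr0.
  have := Hd h; rewrite /= sub0r normrN => /(_ hd h0).
  rewrite -[X in _ -> `|X| <= _](_ : h * (h^-1 *: (v (h + x) - v x) - derive1 v x) = _); last first.
    by rewrite mulrBr /GRing.scale/= mulrA mulfV// mul1r.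
  by rewrite normrM mulrC distrC => H; rewrite ler_wpM2r.
have [N _ HN] : \forall n \near \oo, b n - a n < d by exact: (cvgr_lt _ ab0).
exists N => // n Nn; have abd := HN n Nn.
have abn : 0 < b n - a n by rewrite subr_gt0 (le_lt_trans (ax n)).
have := Hd' (b n - x); rewrite subrK => /(_ _).
have := Hd' (a n - x); rewrite subrK => /(_ _).
have xb' : 0 < b n - x by rewrite subr_gt0.
have ax' : a n - x <= 0 by rewrite subr_le0.
rewrite (gtr0_norm xb') (ler0_norm ax') opprB.
have l1 : x - a n < d by apply: le_lt_trans abd; rewrite lerD2r ltW.
have l2 : b n - x < d by apply: le_lt_trans abd; rewrite lerD2l lerN2.
move=> /(_ l1) h1 /(_ l2) h2.
rewrite -(ler_pM2r abn).
have nE z : `|z| * (b n - a n) = `|z * (b n - a n)| by rewrite normrM (gtr0_norm abn).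
rewrite nE mulrBl divfK ?gt_eqF//.
have -> : derive1 v x * (b n - a n) - (v (b n) - v (a n)) =
  (v (a n) - v x - (a n - x) * derive1 v x) - (v (b n) - v x - (b n - x) * derive1 v x) by ring.
apply: le_trans (ler_normB _ _) _; apply: le_trans (lerD h1 h2) _.
by rewrite -mulrDr addrC subrKA.
Qed.

End energy_regularity.

Lemma exists_of_exists2 (T : Type) (A B : T -> Prop) : (exists2 x, A x & B x) -> exists x, A x /\ B x.
Proof. by move=> [x Ax Bx]; exists x. Qed.

Lemma continuous_norm_powR (R : realType) (r : R) : 0 < r -> continuous (fun y : R => `|y| `^ r).
Proof.
move=> r0 y; have [->|y0] := eqVneq y 0.
  apply/cvgrPdist_lt => e e0; rewrite normr0 powR0 ?gt_eqF//.
  exists (e `^ r^-1) => /=; first exact: powR_gt0.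
  move=> x /=; rewrite !sub0r !normrN => xe.
  rewrite ger0_norm ?powR_ge0//.
  have -> : e = (e `^ r^-1) `^ r by rewrite -powRrM mulVf ?gt_eqF// powRr1 ?ltW.
  by apply: gt0_ltr_powR => //; rewrite nnegrE ?powR_ge0.
apply: (@continuous_comp _ _ _ (fun y : R => `|y|) (fun z : R => z `^ r)).
  exact: norm_continuous.
by apply: continuous_powR_pos; rewrite normr_gt0.
Qed.

Lemma limn_einf_ge (R : realType) (u : (\bar R)^nat) (c : \bar R) :
  (forall n, c <= u n)%E -> (c <= limn_einf u)%E.
Proof.
move=> H; rewrite limn_einf_lim; apply: lime_ge; first exact: is_cvg_einfs.
by apply: nearW => n; apply: le_ereal_inf_tmp => _ [m _ <-].
Qed.

Lemma limn_einf_le (R : realType) (u : (\bar R)^nat) (c : \bar R) :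
  (forall n, u n <= c)%E -> (limn_einf u <= c)%E.
Proof.
move=> H; rewrite limn_einf_lim; apply: lime_le; first exact: is_cvg_einfs.
apply: nearW => n; apply: le_trans (H n); apply: ereal_inf_lbound.
by exists n => /=.
Qed.

Section energy_fatou.
Context {R : realType}.
Variables (p : R) (v : R -> R) (e : R).
Hypothesis p1 : 1 < p.
Hypothesis Ev : energy_le p v e.
Notation mu := (@lebesgue_measure R).

Let p0 : 0 < p. Proof. exact: lt_trans p1. Qed.
Let pm0 : 0 < p - 1. Proof. by rewrite subr_gt0. Qed.

Section cell.
Variables (s t : R).
Hypotheses (s0 : 0 < s) (st : s < t).

Let delta n : R := (t - s) / n.+1%:R.
Let X n k : R := s + delta n * k%:R.
Let c n k : R := `|v (X n k.+1) - v (X n k)| `^ p / delta n `^ p * X n k `^ (p - 1).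

Let delta0 n : 0 < delta n. Proof. by rewrite divr_gt0 ?subr_gt0. Qed.

Let XS n k : X n k.+1 = X n k + delta n.
Proof. by rewrite /X -natr1; ring. Qed.

Let Xle n i j : (i <= j)%N -> X n i <= X n j.
Proof. by move=> ij; rewrite lerD2l ler_pM2l ?ler_nat. Qed.

Let X0 n k : 0 < X n k.
Proof. by rewrite ltr_pwDl// mulr_ge0// ltW. Qed.

Let cell_disj n i j x : X n i <= x < X n i.+1 -> X n j <= x < X n j.+1 -> i = j.
Proof.
move=> /andP[i1 i2] /andP[j1 j2]; have [ij|ji|//] := ltngtP i j.
  by have := lt_le_trans i2 (Xle n ij); rewrite ltNge j1.
by have := lt_le_trans j2 (Xle n ji); rewrite ltNge i1.
Qed.

Let c_ge0 n k : 0 <= c n k.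
Proof. by rewrite mulr_ge0 ?powR_ge0// divr_ge0 ?powR_ge0. Qed.

(* As ln (1 + y) <= y, the chord energy of a cell is at least the energy of its slope
   with the weight at the left endpoint. *)
Let c_seg n k : c n k * delta n <= seg p v (X n k) (X n k.+1).
Proof.
have XX : X n k < X n k.+1 by rewrite XS ltrDl.
have l0 : 0 < ln (X n k.+1 / X n k) by rewrite ln_gt0// ltr_pdivlMr ?mul1r.
have lle : ln (X n k.+1 / X n k) <= delta n / X n k.
  apply: le_trans (ln_ratio_le (X0 n k) (lexx _) (ltW XX)) _.
  by rewrite XS addrAC subrr add0r.
have d0 := delta0 n; have x0 := X0 n k.
have dp := powR_gt0 (p - 1) d0.
have lp := powR_gt0 (p - 1) l0.
have H : X n k `^ (p - 1) * (delta n `^ (p - 1))^-1 <= (ln (X n k.+1 / X n k) `^ (p - 1))^-1.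
  rewrite ler_pdivrMr// -[leRHS]mulrC ler_pdivlMr//.
  rewrite -powRM ?(ltW x0) ?(ltW l0)//.
  apply: ge0_ler_powR; rewrite ?nnegrE ?(ltW pm0) ?(ltW d0) ?mulr_ge0 ?(ltW x0) ?(ltW l0)//.
  by rewrite mulrC -ler_pdivlMr.
rewrite /c /seg -mulrA -mulrA; apply: ler_wpM2l; first exact: powR_ge0.
apply: le_trans H; rewrite le_eqVlt; apply/orP; left; apply/eqP.
rewrite -(mulr_powRB1 (ltW d0) p0).
by field; rewrite !gt_eqF.
Qed.

Let G n (x : R) : \bar R := (\sum_(k < n.+1) (c n k)%:E * (\1_(`[X n k, X n k.+1[%classic : set R) x)%:E)%E.

Let G_ge0 n x : (0 <= G n x)%E.
Proof. by apply: sume_ge0 => k _; apply: mule_ge0; rewrite lee_fin// indicE. Qed.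

Let GE n k x : (k < n.+1)%N -> X n k <= x < X n k.+1 -> G n x = (c n k)%:E.
Proof.
move=> kn xk; rewrite /G (bigD1 (Ordinal kn))//= big1.
  by rewrite adde0 indicE mem_set ?mule1//= in_itv/=.
move=> i ik; rewrite indicE memNset ?mule0//= in_itv/= => xi.
by move/eqP: ik; apply; apply: val_inj => /=; exact: cell_disj xi xk.
Qed.

Let mG n : measurable_fun setT (G n).
Proof.
apply: emeasurable_sum => k; apply: measurable_funeM.
by apply/measurable_EFinP; exact: measurable_indic.
Qed.

Let intG n : (\int[mu]_(x in `[s, t[) G n x <= e%:E)%E.
Proof.
rewrite ge0_integral_sum//; last 2 first.
- move=> k; apply: measurable_funeM; apply: measurable_funTS.
  by apply/measurable_EFinP; exact: measurable_indic.
- by move=> k x _; apply: mule_ge0; rewrite lee_fin// indicE.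
apply: (@le_trans _ _ (\sum_(k < n.+1) (seg p v (X n k) (X n k.+1)))%:E); last first.
  rewrite lee_fin; apply: (Ev (a := fun k : 'I_n.+1 => X n k) (b := fun k : 'I_n.+1 => X n k.+1)).
    by move=> i; split; [exact: X0|exact: Xle].
  move=> i j _ _ [x [/=]]; rewrite !in_itv/= => /andP[i1 i2] /andP[j1 j2].
  by apply: val_inj => /=; apply: (@cell_disj n i j x); rewrite ?(ltW i1) ?(ltW j1).
rewrite -sumEFin; apply: lee_sum => k _.
rewrite ge0_integralZl//; last 2 first.
- by apply: measurable_funTS; apply/measurable_EFinP; exact: measurable_indic.
- by rewrite lee_fin.
rewrite integral_indic//.
apply: (@le_trans _ _ ((c n k)%:E * (delta n)%:E)%E); last by rewrite -EFinM lee_fin.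
rewrite lee_wpmul2l ?lee_fin//.
apply: (@le_trans _ _ (mu `[X n k, X n k.+1[)).
  by apply: le_measure; rewrite ?inE//; exact: measurableI.
rewrite [leLHS](@lebesgue_measure_itv R `[X n k, X n k.+1[) /= lte_fin XS ltrDl delta0.
by rewrite -EFinB lee_fin addrAC subrr add0r.
Qed.

Let cell_ex n x : s <= x < t -> exists2 k, (k < n.+1)%N & X n k <= x < X n k.+1.
Proof.
move=> /andP[sx xt]; have d0 := delta0 n.
pose y := (x - s) / delta n.
have y0 : 0 <= y by rewrite divr_ge0 ?subr_ge0// ltW.
have /andP[y1 y2] := truncn_itv y0.
exists (Num.trunc y).
  rewrite -(ltr_nat R); apply: le_lt_trans y1 _.
  rewrite /y ltr_pdivrMr// /delta mulrCA mulfV// mulr1.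
  by rewrite ltrD2r.
rewrite /X -lerBrDl -ltrBlDl.
by rewrite ![delta n * _]mulrC -ler_pdivlMr// -ltr_pdivrMr// y1 y2.
Qed.

(** On a regular grid, the p-th powers of the slopes weighted by the left endpoints form
    step functions G n. Each has integral at most a sum of chord energies (c_seg), and
    they converge to the gradient density wherever v is derivable; Fatou's lemma
    concludes. Where v is not derivable, derive1 v vanishes. *)
Lemma grad_cell_le : (\int[mu]_(x in `[s, t[) grad_density p v x <= e%:E)%E.
Proof.
apply: (@le_trans _ _ (\int[mu]_(x in `[s, t[) limn_einf (G ^~ x))%E); last first.
  apply: le_trans (fatou _ _ _ _) _ => //.
  - by move=> n; apply: measurable_funTS; exact: mG.
  - by apply: limn_einf_le => n; exact: intG.
have cvv := energy_continuous p1 Ev.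
apply: ge0_le_integral => //.
- by move=> x _; exact: grad_density_ge0.
- apply: measurable_funS (measurable_grad_density p (measurable_derive1_pos cvv)) => //.
  by move=> x /=; rewrite !in_itv/= andbT => /andP[sx _]; exact: lt_le_trans sx.
- rewrite (_ : (fun x => _) = fun x => (- limn_esup (fun n => - G n x))%E).
    apply: measurableT_comp => //; apply: measurable_fun_limn_esup => n.
    by apply: measurable_funTS; apply: measurableT_comp => //; exact: mG.
  apply/funext => x; rewrite -[RHS](limn_einfN (fun n => - G n x)%E).
  by congr limn_einf; apply/funext => n /=; rewrite oppeK.
move=> x /=; rewrite in_itv/= => sxt.
have [dv|ndv] := pselect (derivable v x 1); last first.
  rewrite /grad_density (_ : derive1 v x = 0).
    rewrite normr0 powR0 ?gt_eqF// mul0r.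
    exact: limn_einf_ge.
  rewrite /derive1; apply: dvgP.
  move=> H; apply: ndv; rewrite /derivable.
  by under eq_fun do rewrite /= [_%:A]mulr1.
have sx : s <= x by case/andP: sxt.
have [k0 k0P] := choice (fun n => exists_of_exists2 (cell_ex n sxt)).
have kn n : (k0 n < n.+1)%N by case: (k0P n).
have kx n : X n (k0 n) <= x < X n (k0 n).+1 by case: (k0P n).
have d0 : delta n @[n --> \oo] --> (0 : R).
  by rewrite -[X in _ --> X](mulr0 (t - s)); apply: cvgMr; exact: cvg_harmonic.
have slope : (v (X n (k0 n).+1) - v (X n (k0 n))) / (X n (k0 n).+1 - X n (k0 n)) @[n --> \oo] --> derive1 v x.
  apply: slope_cvg => //.
  - by move=> n; case/andP: (kx n).
  - by move=> n; case/andP: (kx n).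
  - by rewrite (_ : (fun n => _) = delta)//; apply/funext => n; rewrite XS addrAC subrr add0r.
have Xx : X n (k0 n) @[n --> \oo] --> x.
  apply: (@squeeze_cvgr _ _ _ _ (fun n => x - delta n) (fun=> x)).
  - apply: nearW => n; case/andP: (kx n) => -> /ltW; rewrite XS => H.
    by rewrite andbT lerBlDr.
  - by rewrite -[X in _ --> X](subr0 x); apply: cvgB => //; exact: cvg_cst.
  - exact: cvg_cst.
have x0 : 0 < x by exact: lt_le_trans sx.
suff cG : G n x @[n --> \oo] --> grad_density p v x by rewrite (cvg_limn_einf_sup cG).
rewrite (_ : (fun n => G n x) = (fun n => (c n (k0 n))%:E)); last first.
  by apply/funext => n; rewrite (GE (kn n) (kx n)).
apply: cvg_EFin; first exact: nearW.
have C1 : X n (k0 n) `^ (p - 1) @[n --> \oo] --> x `^ (p - 1).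
  apply: (@cvg_comp _ _ _ (fun n => X n (k0 n)) (fun y : R => y `^ (p - 1)) _ _ _ Xx).
  exact: continuous_powR_pos.
suff C2 : `|v (X n (k0 n).+1) - v (X n (k0 n))| `^ p / delta n `^ p @[n --> \oo] --> `|derive1 v x| `^ p.
  exact: (cvgM C2 C1).
have := @cvg_comp _ _ _ _ (fun y : R => `|y| `^ p) _ _ _ slope (@continuous_norm_powR R p p0 (derive1 v x)).
rewrite (_ : _ \o _ = (fun n => `|v (X n (k0 n).+1) - v (X n (k0 n))| `^ p / delta n `^ p))//.
have XB n : X n (k0 n).+1 - X n (k0 n) = delta n by rewrite XS addrAC subrr add0r.
apply/funext => n /=; rewrite XB normrM normfV (gtr0_norm (delta0 n)).
rewrite powRM ?invr_ge0 ?(ltW (delta0 n))//; congr (_ * _).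
by rewrite -[in LHS]powR_inv1 ?(ltW (delta0 n))// -powRrM mulN1r powRN.
Qed.

End cell.

Lemma energy_grad_le : (\int[mu]_(x in `]0%R, +oo[) grad_density p v x <= e%:E)%E.
Proof.
have cvv := energy_continuous p1 Ev.
apply: (cvge_ub (@integral_exhaust R (fun n => `[n.+1%:R^-1, n.+2%:R[%classic) _ _ _ _ _ _ _)) => //.
- move=> m n mn x /=; rewrite !in_itv/= => /andP[mx xm]; apply/andP; split.
    by apply: le_trans mx; rewrite lef_pV2 ?posrE// ler_nat.
  by apply: lt_le_trans xm _; rewrite ler_nat.
- apply/seteqP; split => [x [n _]|x]; rewrite /= !in_itv/= andbT.
    by move=> /andP[nx _]; apply: lt_le_trans nx; rewrite invr_gt0.
  move=> x0.
  have [n _ Hn] : \forall n \near \oo, (n.+1%:R^-1 : R) < x.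
    by have := @cvg_harmonic R; move/cvgr_lt; apply.
  exists (maxn n (Num.bound x)) => //=; rewrite in_itv/=; apply/andP; split.
    apply: ltW; apply: Hn; rewrite /= leq_max leqnn//.
  apply: lt_le_trans (archi_boundP (ltW x0)) _; rewrite ler_nat.
  by rewrite -addn2 (leq_trans (leq_maxr n _))// leq_addr.
- exact: measurable_grad_density (measurable_derive1_pos cvv).
- by move=> x _; exact: grad_density_ge0.
- move=> n; apply: grad_cell_le; first by rewrite invr_gt0.
  by rewrite (@le_lt_trans _ _ 1)// ?ltr1n// invf_le1 ?ler1n.
Qed.

End energy_fatou.

(** * Tails of the exponential series *)

Section exponential_tail.
Context {R : realType}.
Implicit Types (x y l : R) (k n : nat).

Definition etail k y : R := expR y - \sum_(j < k) y ^+ j / j`!%:R.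

Lemma etailS k y : etail k y = y ^+ k / k`!%:R + etail k.+1 y.
Proof. by rewrite /etail big_ord_recr/=; ring. Qed.

Lemma etail_cvg k y : \sum_(k <= j < n) y ^+ j / j`!%:R @[n --> \oo] --> etail k y.
Proof.
have H : series (exp_coeff y) n @[n --> \oo] --> expR y by exact: is_cvg_series_exp_coeff.
have H2 : (fun n => series (exp_coeff y) n - \sum_(j < k) y ^+ j / j`!%:R) @ \oo --> etail k y.
  by apply: cvgB => //; exact: cvg_cst.
apply: cvg_trans H2; apply: near_eq_cvg; exists k => // n /= kn.
rewrite /series/= -(big_mkord xpredT (fun j => y ^+ j / j`!%:R)).
rewrite (@big_cat_nat _ _ _ k 0 n)//=.
have E a b : \sum_(a <= i < b) exp_coeff y i = \sum_(a <= j < b) y ^+ j / j`!%:R by exact: eq_bigr.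
by rewrite !E addrAC subrr add0r.
Qed.

Lemma cvgr_le2 (u v : R^nat) a b : u @ \oo --> a -> v @ \oo --> b -> (forall n, u n <= v n) -> a <= b.
Proof. by move=> ua vb uv; apply: (ler_cvg_to ua vb); exact: nearW. Qed.

Lemma etail_ge0 k y : 0 <= y -> 0 <= etail k y.
Proof.
move=> y0; apply: (cvgr_le2 (cvg_cst 0) (etail_cvg (k := k) (y := y))) => n.
by apply: sumr_ge0 => j _; rewrite divr_ge0 ?exprn_ge0.
Qed.

Lemma etail_ge k y : 0 <= y -> y ^+ k / k`!%:R <= etail k y.
Proof. by move=> y0; rewrite etailS lerDl etail_ge0. Qed.

Lemma etail_le k y : 0 <= y -> etail k y <= y ^+ k * expR y.
Proof.
move=> y0.
have H : series (exp_coeff y) n @[n --> \oo] --> expR y by exact: is_cvg_series_exp_coeff.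
have {}H : y ^+ k * series (exp_coeff y) n @[n --> \oo] --> y ^+ k * expR y by exact: cvgMr.
apply: (cvgr_le2 (etail_cvg (k := k) (y := y)) H) => n.
rewrite /series/= mulr_sumr.
have [nk|kn] := leqP n k.
  rewrite big_geq// sumr_ge0// => j _.
  by rewrite mulr_ge0 ?divr_ge0 ?exprn_ge0.
rewrite -{1}(add0n k) big_addn [leRHS](big_cat_nat (n := (n - k)%N)) ?leq_subr//=.
rewrite -[leLHS]addr0 lerD//; last first.
  by apply: sumr_ge0 => j _; rewrite mulr_ge0 ?divr_ge0 ?exprn_ge0.
apply: ler_sum => j _; rewrite exprD /exp_coeff/=.
rewrite [leRHS]mulrA [y ^+ k * _]mulrC ler_wpM2l ?mulr_ge0 ?exprn_ge0//.
by rewrite lef_pV2 ?posrE ?ltr0n ?fact_gt0// ler_nat leq_fact // leq_addr.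
Qed.

Lemma etail_homo k x y : 0 <= x -> x <= y -> etail k x <= etail k y.
Proof.
move=> x0 xy; apply: (cvgr_le2 (etail_cvg (k := k) (y := x)) (etail_cvg (k := k) (y := y))) => n.
apply: ler_sum => j _; rewrite ler_wpM2r//.
by apply: lerXn2r; rewrite ?nnegrE// (le_trans x0).
Qed.

(** All the terms of the tail have degree at least 1 in y. *)
Lemma etail_scale k l y : (0 < k)%N -> 1 <= l -> 0 <= y -> l * etail k y <= etail k (l * y).
Proof.
move=> k0 l1 y0.
have H : l * \sum_(k <= j < n) y ^+ j / j`!%:R @[n --> \oo] --> l * etail k y.
  by apply: cvgMr; exact: etail_cvg.
apply: (cvgr_le2 H (etail_cvg (k := k) (y := l * y))) => n.
rewrite mulr_sumr big_nat [leRHS]big_nat; apply: ler_sum => j /andP[kj _].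
rewrite exprMn mulrA ler_wpM2r// ler_wpM2r ?exprn_ge0//.
by apply: ler_eXnr => //; exact: leq_trans kj.
Qed.

Lemma continuous_etail k : continuous (etail k).
Proof.
elim: k => [|k IH] y.
  have -> : etail 0 = expR by apply/funext => z; rewrite /etail big_ord0 subr0.
  exact: continuous_expR.
have -> : etail k.+1 = (fun z => etail k z - z ^+ k / k`!%:R).
  by apply/funext => z; rewrite (etailS k z); ring.
by apply: cvgB; [exact: IH|apply: cvgMl; exact: exprn_continuous].
Qed.

End exponential_tail.

(** * The growth function *)

Section growth_function.
Context {R : realType}.
Implicit Types (p mu t l : R).

Definition conj_exp p := p / (p - 1).
Definition level p : nat := `|strict_floor p|.
(** The order at which the remainder R starts. At p = level p + 1 the first term of the
    growth function has degree exactly p and is set apart, as lead; otherwise all its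
    terms already have degree above p. *)
Definition remord p : nat := if p == (level p).+1%:R then (level p).+1 else level p.
Definition lead p mu : R :=
  if p == (level p).+1%:R then mu ^+ level p / (level p)`!%:R else 0.
(** The growth function at |t|, which is continuous on the whole line. *)
Definition Aabs p mu t := etail (level p) (mu * `|t| `^ conj_exp p).
Definition Rem p mu t := etail (remord p) (mu * `|t| `^ conj_exp p).

Lemma level_bounds p : 2 <= p ->
  [/\ (0 < level p)%N, (level p)%:R < p & p <= (level p).+1%:R].
Proof.
move=> p2; have [h1 h2] := strict_floorP p.
have s1 : (1 <= strict_floor p) by apply: h2; rewrite (lt_le_trans _ p2)// ltr1n.
have e : strict_floor p = (level p)%:Z by rewrite /level gez0_abs// (le_trans _ s1).
split.
- by move: s1; rewrite e.
- by move: h1; rewrite e.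
- rewrite leNgt; apply/negP => lp.
  have := h2 (level p).+1%:Z; rewrite e => /(_ lp).
  by rewrite lez_nat ltnn.
Qed.

Lemma conj_exp_gt1 p : 2 <= p -> 1 < conj_exp p.
Proof. by move=> p2; rewrite /conj_exp ltr_pdivlMr; lra. Qed.

Lemma powR_conj_nat p t n : (`|t| `^ conj_exp p) ^+ n = `|t| `^ (conj_exp p * n%:R).
Proof. by rewrite powRrM powR_mulrn// powR_ge0. Qed.

Lemma A_funE p mu t : 0 <= t -> A_fun p mu t = Aabs p mu t.
Proof.
move=> t0; rewrite /A_fun /Aabs /etail ger0_norm//; congr (_ - _).
apply: eq_bigr => j _; rewrite exprMn -{2}(ger0_norm t0) powR_conj_nat ger0_norm//.
by rewrite /conj_exp; ring.
Qed.

Lemma Aabs_split p mu t : 2 <= p -> Aabs p mu t = lead p mu * `|t| `^ p + Rem p mu t.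
Proof.
move=> p2; rewrite /Aabs /Rem /lead /remord; case: eqP => [pE|_]; last by rewrite mul0r add0r.
rewrite etailS exprMn powR_conj_nat; congr (_ + _).
have [l0 _ _] := level_bounds p2.
rewrite (_ : conj_exp p * (level p)%:R = p); first by ring.
have -> : (level p)%:R = p - 1 by rewrite {2}pE -natr1 addrK.
by rewrite /conj_exp divfK//; apply/eqP; lra.
Qed.

Lemma remord_gt p : 2 <= p -> p - 1 < (remord p)%:R.
Proof.
move=> p2; have [l0 lp pl] := level_bounds p2.
rewrite /remord; case: eqP => [pE|pE]; first by rewrite {1}pE; lra.
have : p < (level p).+1%:R by rewrite lt_neqAle pl andbT; apply/eqP.
by rewrite -natr1; lra.
Qed.

(** The degree in t of the first term of R; it is larger than p (remexp_gt). *)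
Definition remexp p := conj_exp p * (remord p)%:R.

Lemma remexp_gt p : 2 <= p -> p < remexp p.
Proof.
move=> p2; rewrite /remexp /conj_exp.
rewrite mulrAC ltr_pdivlMr ?ltr_pM2l ?remord_gt//; lra.
Qed.

Lemma remexp_lt p : 2 < p -> p = (level p).+1%:R -> remexp p < 2 * p.
Proof.
move=> p2 pE; rewrite /remexp /conj_exp /remord ifT; last exact/eqP.
by rewrite -pE mulrAC ltr_pdivrMr; nra.
Qed.

Lemma lead_ge0 p mu : 0 < mu -> 0 <= lead p mu.
Proof. by move=> mu0; rewrite /lead; case: ifP => // _; rewrite divr_ge0// exprn_ge0// ltW. Qed.

Section fixed_mu.
Variables p mu : R.
Hypotheses (p2 : 2 <= p) (mu0 : 0 < mu).

Let arg_ge0 t : 0 <= mu * `|t| `^ conj_exp p.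
Proof. by rewrite mulr_ge0 ?powR_ge0// ltW. Qed.

Lemma Rem_ge0 t : 0 <= Rem p mu t.
Proof. exact: etail_ge0. Qed.

Lemma Aabs_ge0 t : 0 <= Aabs p mu t.
Proof. exact: etail_ge0. Qed.

Lemma Rem_ge t : mu ^+ remord p / (remord p)`!%:R * `|t| `^ remexp p <= Rem p mu t.
Proof.
apply: le_trans (etail_ge _ (arg_ge0 t)).
by rewrite exprMn powR_conj_nat /remexp mulrAC.
Qed.

Lemma Rem_le t : Rem p mu t <=
  mu ^+ remord p * `|t| `^ remexp p * expR (mu * `|t| `^ conj_exp p).
Proof.
apply: le_trans (etail_le _ (arg_ge0 t)) _.
by rewrite exprMn powR_conj_nat.
Qed.

Let arg_homo s t : 0 <= s -> s <= t -> mu * `|s| `^ conj_exp p <= mu * `|t| `^ conj_exp p.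
Proof.
move=> s0 st; have t0 := le_trans s0 st.
rewrite ler_pM2l// !ger0_norm// ge0_ler_powR//.
by have := conj_exp_gt1 p2; lra.
Qed.

Lemma Aabs_homo s t : 0 <= s -> s <= t -> Aabs p mu s <= Aabs p mu t.
Proof. by move=> s0 st; apply: etail_homo => //; exact: arg_homo. Qed.

Lemma Aabs_scale l t : 1 <= l -> l * Aabs p mu t <= Aabs p mu (l * t).
Proof.
move=> l1; have [k0 _ _] := level_bounds p2.
have q1 := conj_exp_gt1 p2; have l0 : 0 <= l by rewrite (le_trans _ l1).
have lq : l <= l `^ conj_exp p by rewrite -{1}(powRr1 l0) ler_powR// ltW.
apply: (@le_trans _ _ (l `^ conj_exp p * Aabs p mu t)).
  by rewrite ler_wpM2r// Aabs_ge0.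
rewrite /Aabs normrM (ger0_norm l0) powRM// mulrCA.
by apply: etail_scale => //; rewrite (le_trans l1).
Qed.

Let continuous_arg : continuous (fun t => mu * `|t| `^ conj_exp p).
Proof.
move=> t; apply: cvgMr; apply: continuous_norm_powR.
by have := conj_exp_gt1 p2; lra.
Qed.

Lemma continuous_Rem : continuous (Rem p mu).
Proof.
move=> t; apply: (@continuous_comp _ _ _ (fun t => mu * `|t| `^ conj_exp p) (etail (remord p))).
  exact: continuous_arg.
exact: continuous_etail.
Qed.

Lemma continuous_Aabs : continuous (Aabs p mu).
Proof.
move=> t; apply: (@continuous_comp _ _ _ (fun t => mu * `|t| `^ conj_exp p) (etail (level p))).
  exact: continuous_arg.
exact: continuous_etail.
Qed.

Lemma Rem0 : Rem p mu 0 = 0.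
Proof.
apply/eqP; rewrite eq_le Rem_ge0 andbT; apply: le_trans (Rem_le _) _.
rewrite normr0 powR0 ?mulr0 ?mul0r//.
by have := remexp_gt p2; move: p2 => ?; apply: contraTneq => ->; lra.
Qed.

Lemma Aabs0 : Aabs p mu 0 = 0.
Proof.
rewrite Aabs_split// Rem0 normr0 powR0 ?mulr0 ?addr0//.
by move: p2; apply: contraTneq => ->; lra.
Qed.

End fixed_mu.
End growth_function.

(** * Dilations of the half-line *)

Section dilation.
Context {R : realType}.
Notation mu := (@lebesgue_measure R).

Definition shrink (s x : measurableTypeR R) : measurableTypeR R := x / s.

Lemma measurable_shrink s : measurable_fun setT (shrink s).
Proof. by apply: measurable_funM => //; exact: measurable_cst. Qed.

(** Uniqueness of Lebesgue measure, applied to the image under the dilation divided by its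
    factor. *)
Lemma lebesgue_measure_shrink (s : R) (s0 : 0 < s) (A : set R) : measurable A ->
  (pushforward mu (shrink s) A = s%:E * mu A)%E.
Proof.
move=> mA; have si0 : 0 <= s^-1 by rewrite invr_ge0 ltW.
pose pf : {measure set (measurableTypeR R) -> \bar R} :=
  ltac:(unshelve refine (pushforward mu (shrink s) : {measure set _ -> \bar R});
        exact: measurable_shrink).
pose m := mscale (NngNum si0) pf.
have H : (mu A = m A)%E.
  apply: lebesgue_measure_unique mA => //= _ [[a b]] _ <-.
  rewrite /m /mscale /pf/=.
  rewrite [X in (_ * X)%E](_ : _ = mu (`]s * a, s * b]%classic)); last first.
    congr (mu _).
    have -> : shrink s @^-1` `]a, b]%classic = `]s * a, s * b]%classic.
      apply/seteqP; split => x /=; rewrite !in_itv/= /shrink ltr_pdivlMr// ler_pdivrMr//;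
      by rewrite ![_ * s]mulrC.
    by [].
  rewrite !lebesgue_measure_itv/= !lte_fin ltr_pM2l//.
  case: ifP => _; last by rewrite mule0.
  by rewrite -!EFinB -EFinM; congr (_%:E); field; rewrite gt_eqF.
rewrite H /m /mscale /pf/=.
by rewrite muleA -EFinM mulfV ?gt_eqF// mul1e.
Qed.

Lemma integral_shrink (s : R) (F : R -> \bar R) : 0 < s ->
  measurable_fun (`]0, +oo[ : set R) F -> (forall x : R, 0 < x -> (0 <= F x)%E) ->
  (\int[mu]_(x in `]0%R, +oo[) F (x / s)%R = s%:E * \int[mu]_(x in `]0%R, +oo[) F x)%E.
Proof.
move=> s0 mF F0; have s0' := ltW s0.
have E : (`]0, +oo[%classic : set R) = shrink s @^-1` `]0, +oo[%classic.
  by apply/seteqP; split => x /=; rewrite !in_itv/= !andbT /shrink ?pmulr_lgt0 ?invr_gt0.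
rewrite {1}E.
rewrite -(@ge0_integral_pushforward _ _ _ _ R (shrink s) (measurable_shrink s) mu)//; last first.
  by move=> y; rewrite inE/= in_itv/= andbT; exact: F0.
rewrite -(@ge0_integral_mscale _ _ _ mu _ _ (NngNum s0'))//; last first.
  by move=> x /=; rewrite in_itv/= andbT; exact: F0.
apply: eq_measure_integral => [|Hm A mA _]; first exact: measurable_shrink.
by apply: (etrans (lebesgue_measure_shrink s0 mA)).
Qed.

Variable th : R.
Hypothesis th0 : 0 <= th.

Lemma int_lambda_shrink (s : R) (F : R -> R) : 0 < s ->
  measurable_fun (`]0, +oo[ : set R) F -> (forall x : R, 0 < x -> 0 <= F x) ->
  int_lambda th (fun x => F (x / s)) = ((s `^ (th + 1))%:E * int_lambda th F)%E.
Proof.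
move=> s0 mF F0; rewrite /int_lambda.
pose G x := (F x * (omega th * x `^ th))%:E.
have G0 x : 0 < x -> (0 <= G x)%E.
  by move=> x0; rewrite /G lee_fin; apply: mulr_ge0; [exact: F0|apply: mulr_ge0; [exact: omega_ge0|exact: powR_ge0]].
have mG : measurable_fun (`]0, +oo[ : set R) G.
  apply/measurable_EFinP; apply: measurable_funM => //.
  apply: measurable_funM => //; apply: measurable_funTS; exact: measurable_powR.
have Gs0 x : (`]0, +oo[%classic : set R) x -> (0 <= G (x / s)%R)%E.
  by rewrite /= in_itv/= andbT => x0; apply: G0; rewrite divr_gt0.
have mGs : measurable_fun (`]0, +oo[ : set R) (fun x : R => G (x / s)).
  apply: (@measurable_comp _ _ _ _ _ _ (`]0, +oo[%classic : set R) G _ (shrink s)) => //.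
    by move=> _ [x /= + <-]; rewrite !in_itv/= !andbT => x0; rewrite divr_gt0.
  by apply: measurable_funTS; exact: measurable_shrink.
have c0 : (0 <= (s `^ th)%:E :> \bar R)%E by rewrite lee_fin powR_ge0.
have mP : measurable (`]0, +oo[%classic : set R) by exact: measurable_itv.
have E1 := @ge0_integralZl _ _ R mu _ mP _ mGs _ Gs0 c0.
have E2 := integral_shrink s0 mG G0.
transitivity (\int[mu]_(x in `]0%R, +oo[) ((s `^ th)%:E * G (x / s)%R))%E.
  apply: eq_integral => x; rewrite inE/= in_itv/= andbT => x0.
  rewrite /G -EFinM; congr (_%:E).
  have -> : x `^ th = s `^ th * (x / s) `^ th.
    by rewrite -powRM ?divr_ge0 ?(ltW x0) ?(ltW s0)// mulrC divfK// gt_eqF.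
  by ring.
apply: (etrans E1); rewrite E2 muleA -EFinM; congr (_%:E * _)%E.
by rewrite powRD ?powRr1 ?(ltW s0)//; apply/implyP => _; rewrite gt_eqF.
Qed.
End dilation.

(** * Norms and weighted integrals *)

Section norms.
Context {R : realType}.
Implicit Types (u v F G : R -> R) (b c x : R).
Notation mu := (@lebesgue_measure R).

Lemma int_lambda_ge0 b F : (forall x : R, 0 < x -> 0 <= F x) -> (0 <= int_lambda b F)%E.
Proof.
move=> F0; apply: integral_ge0 => x /=; rewrite in_itv/= andbT => x0.
by rewrite lee_fin mulr_ge0 ?F0// mulr_ge0 ?powR_ge0// omega_ge0.
Qed.

Lemma measurable_lambda b F : measurable_fun (`]0, +oo[ : set R) F ->
  measurable_fun (`]0, +oo[ : set R) (fun x => (F x * (omega b * x `^ b))%:E).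
Proof.
move=> mF; apply/measurable_EFinP; apply: measurable_funM => //.
by apply: measurable_funM => //; apply: measurable_funTS; exact: measurable_powR.
Qed.

Lemma int_lambda_le b F G : measurable_fun (`]0, +oo[ : set R) F ->
  measurable_fun (`]0, +oo[ : set R) G -> (forall x : R, 0 < x -> 0 <= F x) ->
  (forall x : R, 0 < x -> F x <= G x) -> (int_lambda b F <= int_lambda b G)%E.
Proof.
move=> mF mG F0 FG; have G0 x : 0 < x -> 0 <= G x by move=> x0; rewrite (le_trans (F0 _ x0))// FG.
have w0 x : 0 <= omega b * x `^ b by rewrite mulr_ge0 ?powR_ge0// omega_ge0.
apply: ge0_le_integral => //.
- by move=> x /=; rewrite in_itv/= andbT => x0; rewrite lee_fin mulr_ge0 ?F0.
- exact: measurable_lambda.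
- exact: measurable_lambda.
- by move=> x /=; rewrite in_itv/= andbT => x0; rewrite lee_fin ler_wpM2r ?FG.
Qed.

Lemma int_lambdaZ b c F : 0 <= c -> measurable_fun (`]0, +oo[ : set R) F ->
  (forall x : R, 0 < x -> 0 <= F x) ->
  int_lambda b (fun x => c * F x) = (c%:E * int_lambda b F)%E.
Proof.
move=> c0 mF F0; have mP : measurable (`]0, +oo[%classic : set R) by exact: measurable_itv.
have F1 x : (`]0, +oo[%classic : set R) x -> (0 <= (F x * (omega b * x `^ b))%:E)%E.
  rewrite /= in_itv/= andbT => x0.
  by rewrite lee_fin mulr_ge0 ?F0// mulr_ge0 ?powR_ge0// omega_ge0.
have c1 : (0 <= c%:E :> \bar R)%E by rewrite lee_fin.
have := @ge0_integralZl _ _ R mu _ mP _ (measurable_lambda b mF) _ F1 c1.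
move=> E; apply: (etrans _ E); apply: eq_integral => x _; by rewrite -EFinM -mulrA.
Qed.

Lemma int_lambdaD b F G : measurable_fun (`]0, +oo[ : set R) F ->
  measurable_fun (`]0, +oo[ : set R) G -> (forall x : R, 0 < x -> 0 <= F x) ->
  (forall x : R, 0 < x -> 0 <= G x) ->
  int_lambda b (fun x => F x + G x) = (int_lambda b F + int_lambda b G)%E.
Proof.
move=> mF mG F0 G0; have mP : measurable (`]0, +oo[%classic : set R) by exact: measurable_itv.
have F1 H x : (forall x : R, 0 < x -> 0 <= H x) -> (`]0, +oo[%classic : set R) x ->
    (0 <= (H x * (omega b * x `^ b))%:E)%E.
  move=> H0; rewrite /= in_itv/= andbT => x0.
  by rewrite lee_fin mulr_ge0 ?H0// mulr_ge0 ?powR_ge0// omega_ge0.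
have := @ge0_integralD _ _ R mu _ mP _ _ (fun x => F1 F x F0) (measurable_lambda b mF)
   (fun x => F1 G x G0) (measurable_lambda b mG).
move=> E; apply: (etrans _ E); apply: eq_integral => x _; by rewrite -EFinD mulrDl.
Qed.

Lemma eq_int_lambda b F G : (forall x : R, 0 < x -> F x = G x) ->
  int_lambda b F = int_lambda b G.
Proof.
by move=> FG; apply: eq_integral => x; rewrite inE/= in_itv/= andbT => x0; rewrite FG.
Qed.

Variables p : R.
Hypothesis p1 : 1 < p.
Let p0 : 0 < p. Proof. exact: lt_trans p1. Qed.

Lemma norm_LK b u : (norm_L p b u `^ p = int_lambda b (fun x => (`|u x| `^ p)%R))%E.
Proof.
rewrite /norm_L -poweRrM mulVf ?gt_eqF// poweRe1//.
by apply: int_lambda_ge0 => x _; exact: powR_ge0.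
Qed.

Lemma norm_L_lty b u : (norm_L p b u < +oo)%E <-> (int_lambda b (fun x => (`|u x| `^ p)%R) < +oo)%E.
Proof.
split; last exact: poweR_lty.
by apply: lty_poweRy; rewrite invr_eq0 gt_eqF.
Qed.

Lemma int_lambda_grad u : measurable_fun (`]0, +oo[ : set R) (derive1 u) ->
  int_lambda (p - 1) (fun x => `|derive1 u x| `^ p) =
  ((omega (p - 1))%:E * \int[mu]_(x in `]0%R, +oo[) grad_density p u x)%E.
Proof.
move=> mu'; have mP : measurable (`]0, +oo[%classic : set R) by exact: measurable_itv.
have c1 : (0 <= (omega (p - 1))%:E :> \bar R)%E by rewrite lee_fin omega_ge0.
have := @ge0_integralZl _ _ R mu _ mP _ (measurable_grad_density p mu') _
  (fun x _ => grad_density_ge0 p u x) c1.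
move=> E; apply: (etrans _ E); apply: eq_integral => x _; by rewrite /grad_density -EFinM mulrCA.
Qed.

Lemma norm_WE th u : measurable_fun (`]0, +oo[ : set R) (derive1 u) ->
  norm_W p (p - 1) th u = (((omega (p - 1))%:E * \int[mu]_(x in `]0%R, +oo[) grad_density p u x
    + int_lambda th (fun x => (`|u x| `^ p)%R)) `^ p^-1)%E.
Proof. by move=> mu'; rewrite /norm_W !norm_LK int_lambda_grad. Qed.

End norms.

(** * Admissible profiles *)

Section admissible.
Context {R : realType}.
Variables p th : R.
Hypotheses (p2 : 2 <= p) (th0 : 0 <= th).
Notation mu := (@lebesgue_measure R).
Notation W := (omega (p - 1)).

Let p1 : 1 < p. Proof. by rewrite (lt_le_trans _ p2)// ltr1n. Qed.
Let p0 : 0 < p. Proof. exact: lt_trans p1. Qed.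

(** Monotone functions are compared with constants on intervals from 0; this gives decay
    at infinity as well as lower bounds. *)
Lemma int_lambda_ge_cst (F : R -> R) (x c : R) : measurable_fun (`]0, +oo[ : set R) F ->
  (forall y : R, 0 < y -> 0 <= F y) -> 0 < x -> 0 <= c ->
  (forall y, 0 < y -> y < x -> c <= F y) -> ((c * Lam th x)%:E <= int_lambda th F)%E.
Proof.
move=> mF F0 x0 c0 cF.
have mD : measurable (`]0, x[%classic : set R) by exact: measurable_itv.
have sD : `]0, x[ `<=` (`]0, +oo[ : set R) by move=> y /=; rewrite !in_itv/= andbT => /andP[].
have mP : measurable (`]0, +oo[%classic : set R) by exact: measurable_itv.
have w0 y : 0 <= omega th * y `^ th by rewrite mulr_ge0 ?powR_ge0// omega_ge0.
apply: (@le_trans _ _ (\int[mu]_(y in `]0%R, x[) (F y * (omega th * y `^ th))%:E)%E); last first.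
  apply: ge0_subset_integral => //; first exact: measurable_lambda.
  by move=> y /=; rewrite in_itv/= andbT => y0; rewrite lee_fin mulr_ge0 ?F0.
rewrite EFinM -(wlam_0s th0 x0) wlamE//.
have mw : measurable_fun (`]0, x[ : set R) (fun y => (omega th * y `^ th)%:E).
  apply/measurable_EFinP; apply: measurable_funM => //.
  by apply: measurable_funTS; exact: measurable_powR.
have W0 y : (`]0, x[%classic : set R) y -> (0 <= (omega th * y `^ th)%:E)%E by rewrite lee_fin.
have c0' : (0 <= c%:E)%E by rewrite lee_fin.
have E := @ge0_integralZl _ _ R mu _ mD _ mw _ W0 c0'.
apply: (le_trans (eq_ind _ (fun z => z <= _)%E (lexx _) _ E)).
apply: ge0_le_integral => //.
- by move=> y _; rewrite -EFinM lee_fin mulr_ge0.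
- by apply: emeasurable_funM => //.
- by apply: measurable_funS (measurable_lambda th mF).
- move=> y /= yx; rewrite -EFinM lee_fin ler_wpM2r//.
  by move: yx; rewrite in_itv/= => /andP[? ?]; exact: cF.
Qed.

(** The bounds g and l on the energy and on the mass are kept separate: pointwise limits
    preserve the bound l but may lose mass, and dilations act on l only. *)
Definition adm v (g l : R) :=
  [/\ forall x, 0 < x -> 0 <= v x, forall x y, 0 < x -> x <= y -> v y <= v x,
      energy_le p v g & (int_lambda th (fun x => (`|v x| `^ p)%R) <= l%:E)%E].

Definition nonzero (v : R -> R) := exists2 x, 0 < x & v x != 0.

Section one.
Variables (v : R -> R) (g l : R).
Hypothesis av : adm v g l.

Lemma adm_continuous (x : R) : 0 < x -> {for x, continuous v}.
Proof. by case: av => _ _ ev _; exact: (energy_continuous p1 ev). Qed.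

Lemma adm_measurable : measurable_fun (`]0, +oo[ : set R) v.
Proof. by apply: continuous_measurable_pos; exact: adm_continuous. Qed.

Lemma adm_measurable_comp (phi : R -> R) : continuous phi ->
  measurable_fun (`]0, +oo[ : set R) (fun x => phi (v x)).
Proof.
move=> cphi; apply: (@measurableT_comp _ _ _ _ _ _ phi) => //; last exact: adm_measurable.
exact: continuous_measurable_fun.
Qed.

Lemma adm_decay x : 0 < x -> v x `^ p * Lam th x <= l.
Proof.
move=> x0; case: av => v0 nv ev Lv; rewrite -lee_fin; apply: le_trans Lv.
apply: int_lambda_ge_cst => //.
- by apply: (@adm_measurable_comp (fun y => `|y| `^ p)); exact: continuous_norm_powR.
- exact: powR_ge0.
- move=> y y0 yx; rewrite ger0_norm ?v0//.
  by apply: ge0_ler_powR; rewrite ?nnegrE ?v0 ?(ltW p0)// nv// ltW.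
Qed.

Lemma adm_ge0 : 0 <= g /\ 0 <= l.
Proof.
split; first by case: av => _ _ ev _; exact: energy_ge0 ev.
by apply: le_trans (adm_decay ltr01); rewrite mulr_ge0 ?powR_ge0// ltW// Lam_gt0.
Qed.

Lemma adm_cvg0 : v x @[x --> +oo] --> (0 : R).
Proof.
case: av => v0 nv _ _; have [_ l0] := adm_ge0.
apply/cvgrPdist_lt => e e0.
have M0 : 0 < (l + 1) / e `^ p by rewrite divr_gt0 ?powR_gt0// ltr_wpDl.
have [s s0 Ls] := Lam_surj th0 M0.
exists s; split; first exact: num_real.
move=> x sx; rewrite sub0r normrN.
have x0 := lt_trans s0 sx.
rewrite ger0_norm ?v0// ltNge; apply/negP => evx.
have := adm_decay x0; apply/negP; rewrite -ltNge.
apply: (@lt_le_trans _ _ (e `^ p * Lam th s)).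
  by rewrite Ls mulrC divfK ?gt_eqF ?powR_gt0//; lra.
apply: ler_pM; rewrite ?powR_ge0// ?(ltW (Lam_gt0 _ _))//.
  by apply: ge0_ler_powR; rewrite ?nnegrE ?(ltW e0) ?(ltW p0)// v0.
by rewrite Lam_le// ltW.
Qed.

Lemma adm_measurable_derive : measurable_fun (`]0, +oo[ : set R) (derive1 v).
Proof. by apply: measurable_derive1_pos; exact: adm_continuous. Qed.

Let Lv_ge0 : (0 <= int_lambda th (fun x => (`|v x| `^ p)%R))%E.
Proof. by apply: int_lambda_ge0 => x _; exact: powR_ge0. Qed.

Lemma adm_in_W : in_W p (p - 1) th v.
Proof.
case: av => v0 nv ev Lv; split.
- exact: (energy_loc_abs_cont p1 ev).
- split; first exact: adm_measurable.
  by apply/(norm_L_lty p1); rewrite (le_lt_trans Lv)// ltry.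
- split; first exact: adm_measurable_derive.
  apply/(norm_L_lty p1); rewrite int_lambda_grad//; last exact: adm_measurable_derive.
  apply: (@le_lt_trans _ _ (W%:E * g%:E)%E); last by rewrite -EFinM ltry.
  by rewrite lee_wpmul2l// ?lee_fin ?omega_ge0// (energy_grad_le p1 ev).
- exact: adm_cvg0.
Qed.

Lemma adm_norm_W : (norm_W p (p - 1) th v <= ((W * g + l) `^ p^-1)%:E)%E.
Proof.
case: av => v0 nv ev Lv; have [g0 l0] := adm_ge0; have W0 : 0 <= W by exact: omega_ge0.
rewrite norm_WE//; last exact: adm_measurable_derive.
have H : (W%:E * \int[mu]_(x in `]0%R, +oo[) grad_density p v x + int_lambda th (fun x => (`|v x| `^ p)%R)
   <= (W * g + l)%:E)%E.
  rewrite (EFinD (W * g)) (EFinM W g); apply: leeD => //.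
  by apply: lee_wpmul2l; [rewrite lee_fin|exact: (energy_grad_le p1 ev)].
rewrite -poweR_EFin; apply: gt0_ler_poweR => //; rewrite ?invr_ge0 ?(ltW p0)//.
- rewrite in_itv/= leey andbT adde_ge0// mule_ge0 ?lee_fin//.
  by apply: integral_ge0 => x _; exact: grad_density_ge0.
- have Wgl : 0 <= W * g + l by apply: addr_ge0 => //; exact: mulr_ge0.
  by rewrite in_itv/= leey andbT lee_fin.
Qed.

Lemma adm_Lp_gt0 : nonzero v -> (0 < int_lambda th (fun x => (`|v x| `^ p)%R))%E.
Proof.
case: av => v0 nv ev Lv [x x0 vx].
have vx0 : 0 < v x by rewrite lt_neqAle eq_sym vx v0.
apply: (@lt_le_trans _ _ (v x `^ p * Lam th x)%:E).
  by rewrite lte_fin mulr_gt0 ?powR_gt0 ?Lam_gt0.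
apply: int_lambda_ge_cst => //.
- by apply: (@adm_measurable_comp (fun y => `|y| `^ p)); exact: continuous_norm_powR.
- exact: powR_ge0.
- move=> y y0 yx; rewrite ger0_norm ?v0//.
  by apply: ge0_ler_powR; rewrite ?nnegrE ?v0 ?(ltW p0)// nv// ltW.
Qed.

Lemma adm_norm_W_gt0 : nonzero v -> (0 < norm_W p (p - 1) th v)%E.
Proof.
move=> nz; rewrite norm_WE//; last exact: adm_measurable_derive.
apply: poweR_gt0; apply: lt_le_trans (adm_Lp_gt0 nz) _.
rewrite leeDr// mule_ge0 ?lee_fin ?omega_ge0//.
by apply: integral_ge0 => x _; exact: grad_density_ge0.
Qed.

Variable m : R.
Hypothesis m0 : 0 < m.

(** The supremum defining d may be taken over profiles of norm at most 1: dividing by the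
    norm raises the profile, hence the integral. *)
Lemma adm_le_d_sup : nonzero v -> W * g + l <= 1 ->
  (int_lambda th (fun x => Aabs p m (v x)) <= d_sup p th (p - 1) m)%E.
Proof.
move=> nz gl1; case: (av) => v0 nv ev Lv; have [g0 l0] := adm_ge0.
have N1 : (norm_W p (p - 1) th v <= 1%:E)%E.
  apply: le_trans adm_norm_W _; rewrite lee_fin; apply: (@le_trans _ _ (1 `^ p^-1)); last by rewrite powR1.
  apply: ge0_ler_powR; rewrite ?nnegrE ?invr_ge0 ?(ltW p0)//.
  by apply: addr_ge0 => //; apply: mulr_ge0 => //; exact: omega_ge0.
have N0 := adm_norm_W_gt0 nz.
set N := fine (norm_W p (p - 1) th v).
have [n nE] : exists n : R, norm_W p (p - 1) th v = n%:E.
  by case: (norm_W p (p - 1) th v) N1 N0 => [n| |]//= _ _; exists n.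
have Nn : N = n by rewrite /N nE.
move: N1 N0; rewrite nE lee_fin lte_fin -Nn => N1 N0.
apply: (@le_trans _ _ (int_lambda th (fun x => A_fun p m (`|v x| / N)))); last first.
  by apply: ereal_sup_ubound; exists v => //; split; [exact: adm_in_W|].
have E x : A_fun p m (`|v x| / N) = Aabs p m (`|v x| / N).
  by rewrite A_funE// divr_ge0// ltW.
apply: int_lambda_le => [| |x x0|x x0].
- by apply: adm_measurable_comp; exact: continuous_Aabs.
- rewrite (_ : (fun _ => _) = (fun x => (fun y => Aabs p m (`|y| / N)) (v x))); last first.
    by apply/funext => x; rewrite E.
  apply: (@adm_measurable_comp (fun y => Aabs p m (`|y| / N))) => y.
  apply: (@continuous_comp _ _ _ (fun y => `|y| / N) (Aabs p m)); last exact: continuous_Aabs.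
  by apply: cvgMl; exact: norm_continuous.
- exact: Aabs_ge0.
- rewrite E; apply: Aabs_homo => //; first exact: v0.
  by rewrite ger0_norm ?v0// ler_pdivlMr// ler_piMr// v0.
Qed.

End one.
End admissible.

Section rearranged_competitor.
Context {R : realType}.
Variables p th : R.
Hypotheses (p2 : 2 <= p) (th0 : 0 <= th).
Notation mu := (@lebesgue_measure R).
Notation W := (omega (p - 1)).

Let p1 : 1 < p. Proof. by rewrite (lt_le_trans _ p2)// ltr1n. Qed.
Let p0 : 0 < p. Proof. exact: lt_trans p1. Qed.

Lemma omega_pm1_gt0 : 0 < W.
Proof. by apply: omega_gt0; rewrite subr_ge0 ltW. Qed.

Lemma seg_scale (v : R -> R) c a b : 0 <= c ->
  seg p (fun x => c * v x) a b = c `^ p * seg p v a b.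
Proof.
by move=> c0; rewrite /seg -mulrBr normrM (ger0_norm c0) powRM// mulrA.
Qed.

Lemma energy_le_scale (v : R -> R) e c : 0 <= c -> energy_le p v e ->
  energy_le p (fun x => c * v x) (c `^ p * e).
Proof.
move=> c0 ev n a b ab tab; under eq_bigr do rewrite seg_scale//.
by rewrite -mulr_sumr ler_wpM2l ?powR_ge0// ev.
Qed.

Lemma in_W_energy (u : R -> R) : in_W p (p - 1) th u ->
  exists K L : R, [/\ (\int[mu]_(x in `]0%R, +oo[) grad_density p u x)%E = K%:E,
    int_lambda th (fun x => `|u x| `^ p) = L%:E, 0 <= K, 0 <= L &
    norm_W p (p - 1) th u = ((W * K + L) `^ p^-1)%:E].
Proof.
move=> [acu [mu_ uL] [mu' u'L] u0].
have W0 := omega_pm1_gt0.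
have I0 : (0 <= \int[mu]_(x in `]0%R, +oo[) grad_density p u x)%E.
  by apply: integral_ge0 => x _; exact: grad_density_ge0.
have L0 : (0 <= int_lambda th (fun x => (`|u x| `^ p)%R))%E.
  by apply: int_lambda_ge0 => x _; exact: powR_ge0.
move: uL u'L => /(norm_L_lty p1) uL /(norm_L_lty p1); rewrite int_lambda_grad// => u'L.
rewrite norm_WE//.
case E1 : (\int[mu]_(x in `]0%R, +oo[) grad_density p u x)%E I0 u'L => [K| |]//; last first.
  by rewrite gt0_muley ?lte_fin.
rewrite lee_fin => K0 _.
case E2 : (int_lambda th (fun x => (`|u x| `^ p)%R)) L0 uL => [L| |]//.
rewrite lee_fin => L0 _; exists K, L; split => //.
Qed.

(** By continuity |u| exceeds half of its value at x on a segment, so its distribution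
    function is positive there. *)
Lemma rearr_nonzero (u : R -> R) : (forall x : R, 0 < x -> {for x, continuous u}) ->
  u x @[x --> +oo] --> (0 : R) -> nonzero u -> nonzero (rearr th (fun x => `|u x|)).
Proof.
move=> cu uoo [x x0 ux].
have cf y : 0 < y -> {for y, continuous (fun x => `|u x|)}.
  by move=> y0; apply: continuous_comp; [exact: cu|exact: norm_continuous].
have foo : `|u x| @[x --> +oo] --> (0 : R) by rewrite -(normr0 R); apply: cvg_norm.
have ux0 : 0 < `|u x| by rewrite normr_gt0.
pose h : R := `|u x| / 2.
have h0 : 0 < h by rewrite /h divr_gt0.
have hu : h < `|u x| by rewrite /h; lra.
have [e e0 He] : exists2 e : R, 0 < e & forall y : R, `|x - y| < e -> h < `|u y|.
  move/cvgrPdist_lt : (cf x x0) => /(_ h h0) /nbhs_ballP[e /= e0 He].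
  exists e => // y xy; have := He y xy; rewrite ltr_norml => /andP[_].
  by rewrite /h; lra.
have xe : x < x + e / 2 by rewrite ltrDl divr_gt0.
have xe0 := lt_trans x0 xe.
have D : ((Lam th (x + e / 2) - Lam th x)%:E <= distr th (fun x => `|u x|%R) h)%E.
  rewrite -(wlam_ab th0 x0 (ltW xe)); apply: le_measure; rewrite ?inE//.
    by apply: measurable_above; exact: continuous_measurable_pos.
  move=> y /=; rewrite in_itv/= => /andP[xy yx]; split; first exact: lt_trans xy.
  by apply: He; rewrite ltr_norml; lra.
have L0 : 0 < Lam th (x + e / 2) - Lam th x by rewrite subr_gt0 Lam_lt.
have [s s0 sE] := @Lam_surj R th th0 ((Lam th (x + e / 2) - Lam th x) / 2) ltac:(lra).
have : h < rearr th (fun x => `|u x|) s.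
  apply/(lt_rearr th0 cf foo s0 (ltW h0)); apply: lt_le_trans D.
  by rewrite sE lte_fin; lra.
by move=> hs; exists s => //; rewrite gt_eqF// (lt_trans h0).
Qed.

(** The normalized rearrangement of |u|, with the quantities attached to u that later
    estimates need. *)
Lemma rearr_adm (u : R -> R) : in_W_neq0 p (p - 1) th u -> exists N K L w,
  [/\ 0 < N, norm_W p (p - 1) th u = N%:E,
      (\int[mu]_(x in `]0%R, +oo[) grad_density p u x)%E = K%:E,
      int_lambda th (fun x => `|u x| `^ p) = L%:E & W * K + L = N `^ p] /\
  [/\ adm p th w (K / N `^ p) (L / N `^ p), nonzero w &
    forall phi : R -> R, continuous phi -> phi 0 = 0 ->
      (forall x y, 0 <= x -> x <= y -> phi x <= phi y) ->
      int_lambda th (fun x => phi (w x)) = int_lambda th (fun x => phi (`|u x| / N))].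
Proof.
move=> [uW nzu]; have [K [L [KE LE K0 L0 NE]]] := in_W_energy uW.
case: (uW) => acu [mu_ uL] [mu' u'L] uoo.
have cu := loc_abs_cont_continuous acu.
have cf y : 0 < y -> {for y, continuous (fun x => `|u x|)}.
  by move=> y0; apply: continuous_comp; [exact: cu|exact: norm_continuous].
have foo : `|u x| @[x --> +oo] --> (0 : R) by rewrite -(normr0 R); apply: cvg_norm.
pose v := rearr th (fun x => `|u x|).
have v0 x : 0 < x -> 0 <= v x by move=> x0; apply: rearr_ge0.
have nv x y : 0 < x -> x <= y -> v y <= v x by move=> x0 xy; exact: (rearr_nonincr th0 cf foo).
have ev : energy_le p v K.
  by apply: rearr_energy => //; rewrite KE.
have cv := energy_continuous p1 ev.
have mf := continuous_measurable_pos cf.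
have mv := continuous_measurable_pos cv.
have equi (phi : R -> R) : continuous phi -> phi 0 = 0 ->
      (forall x y, 0 <= x -> x <= y -> phi x <= phi y) ->
      int_lambda th (fun x => phi (v x)) = int_lambda th (fun x => phi (`|u x|)).
  move=> cphi phi0 mphi; apply: (int_lambda_equidistr mf mv) => //.
  - by move=> h h0; exact: distr_rearr.
  - exact: continuous_measurable_fun.
  - by move=> t _; exact: cphi.
have nzv : nonzero v by exact: rearr_nonzero.
have mono_p (x y : R) : 0 <= x -> x <= y -> `|x| `^ p <= `|y| `^ p.
  move=> x_ge0 xy; rewrite !ger0_norm ?(le_trans x_ge0)//.
  by apply: ge0_ler_powR; rewrite ?nnegrE ?(ltW p0)// (le_trans x_ge0).
have LvE : int_lambda th (fun x => `|v x| `^ p) = L%:E.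
  have c1 : continuous (fun y : R => `|y| `^ p) by exact: continuous_norm_powR.
  have c2 : `|0 : R| `^ p = 0 by rewrite normr0 powR0// gt_eqF.
  have E := equi (fun y => `|y| `^ p) c1 c2 mono_p.
  by apply: (etrans E); rewrite -LE; apply: eq_int_lambda => x _; rewrite normr_id.
have av : adm p th v K L by split => //; rewrite LvE.
have Lgt : 0 < L.
  by have := adm_Lp_gt0 p2 th0 av nzv; rewrite LvE lte_fin.
have WKL : 0 < W * K + L by rewrite ltr_wpDl// mulr_ge0// ltW// omega_pm1_gt0.
pose N := (W * K + L) `^ p^-1.
have N0 : 0 < N by exact: powR_gt0.
have NpE : N `^ p = W * K + L by rewrite /N -powRrM mulVf ?gt_eqF// powRr1// ltW.
have Np0 : 0 < N `^ p by rewrite NpE.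
pose w x := N^-1 * v x.
have Ni0 : 0 <= N^-1 by rewrite invr_ge0 ltW.
have NiE : N^-1 `^ p = (N `^ p)^-1.
  by rewrite -powR_inv1 ?(ltW N0)// -powRrM mulN1r powRN.
have wequi (phi : R -> R) : continuous phi -> phi 0 = 0 ->
      (forall x y, 0 <= x -> x <= y -> phi x <= phi y) ->
      int_lambda th (fun x => phi (w x)) = int_lambda th (fun x => phi (`|u x| / N)).
  move=> cphi phi0 mphi.
  rewrite (eq_int_lambda th (G := fun x => (fun y => phi (N^-1 * y)) (v x)))//.
  rewrite (equi (fun y => phi (N^-1 * y))).
  - by apply: eq_int_lambda => x _; rewrite mulrC.
  - move=> y; apply: (@continuous_comp _ _ _ (fun y => N^-1 * y) phi); last exact: cphi.
    by apply: cvgMr; exact: cvg_id.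
  - by rewrite mulr0.
  - by move=> x y x_ge0 xy; apply: mphi; [exact: mulr_ge0|rewrite ler_wpM2l].
exists N, K, L, w; split; first by split.
split => //.
- split.
  + by move=> x x0; rewrite mulr_ge0// v0.
  + by move=> x y x0 xy; rewrite ler_wpM2l// nv.
  + by have := energy_le_scale Ni0 ev; rewrite NiE mulrC.
  + rewrite (eq_int_lambda th (G := fun x => (N `^ p)^-1 * `|v x| `^ p)).
      rewrite int_lambdaZ ?LvE ?invr_ge0 ?(ltW Np0)//.
        by rewrite -EFinM mulrC.
      by apply: (adm_measurable_comp p2 av (phi := fun y => `|y| `^ p)); exact: continuous_norm_powR.
    by move=> x x0; rewrite /w normrM (ger0_norm Ni0) powRM// NiE.
- have [x x0 vx] := nzv; exists x => //; rewrite /w mulf_neq0//.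
  by rewrite invr_eq0 gt_eqF.
Qed.

(** Together with adm_le_d_sup: d is the supremum over nonzero admissible profiles of norm
    at most 1. *)
Lemma d_sup_le_class (m : R) (D : \bar R) : 0 < m ->
  (forall v g l, adm p th v g l -> nonzero v -> W * g + l <= 1 ->
    (int_lambda th (fun x => Aabs p m (v x)) <= D)%E) ->
  (d_sup p th (p - 1) m <= D)%E.
Proof.
move=> m0 H; apply: ge_ereal_sup => _ [u uW <-].
have [N [K [L [w [[N0 NE KE LE WKL] [aw nzw equi]]]]]] := rearr_adm uW.
rewrite NE/= (eq_int_lambda th (G := fun x => Aabs p m (`|u x| / N))); last first.
  by move=> x x0; rewrite A_funE// divr_ge0// ltW.
have Np : 0 < N `^ p by exact: powR_gt0.
rewrite -(equi (Aabs p m)).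
- apply: H aw nzw _; rewrite mulrA -mulrDl WKL mulfV// gt_eqF//.
- exact: continuous_Aabs.
- exact: Aabs0.
- by move=> x y x0 xy; exact: Aabs_homo.
Qed.

End rearranged_competitor.

(** * Domination in the subcritical range *)

Section domination.
Context {R : realType}.
Notation mu := (@lebesgue_measure R).

Lemma etail_le_expR k (y : R) : 0 <= y -> etail k y <= expR y.
Proof.
by move=> y0; rewrite /etail lerBlDr lerDl sumr_ge0// => j _; rewrite divr_ge0// exprn_ge0.
Qed.

Lemma powR_inv_base (x r : R) : 0 <= x -> x^-1 `^ r = (x `^ r)^-1.
Proof. by move=> x0; rewrite -powR_inv1// -powRrM mulN1r powRN. Qed.

(** Either a is at most e b, or b is at most a / e. *)
Lemma powRD_le (q e a b : R) : 0 <= q -> 0 < e -> 0 <= a -> 0 <= b ->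
  (a + b) `^ q <= (1 + e) `^ q * b `^ q + (1 + e^-1) `^ q * a `^ q.
Proof.
move=> q0 e0 a0 b0; have e1 : 0 < e^-1 by rewrite invr_gt0.
have A0 : 0 <= 1 + e by lra.
have B0 : 0 <= 1 + e^-1 by lra.
have [ab|ba] := leP a (e * b).
  apply: (@le_trans _ _ ((1 + e) `^ q * b `^ q)); last by rewrite lerDl mulr_ge0 ?powR_ge0.
  rewrite -powRM//; apply: ge0_ler_powR; rewrite ?nnegrE ?addr_ge0 ?mulr_ge0//.
  by rewrite mulrDl mul1r addrC lerD2l.
apply: (@le_trans _ _ ((1 + e^-1) `^ q * a `^ q)); last by rewrite lerDr mulr_ge0 ?powR_ge0.
rewrite -powRM//; apply: ge0_ler_powR; rewrite ?nnegrE ?addr_ge0 ?mulr_ge0//.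
by rewrite mulrDl mul1r lerD2l mulrC ler_pdivlMr// mulrC ltW.
Qed.

Lemma integralZ_lty (D : set R) (f : R -> R) (c : R) : measurable D -> 0 <= c ->
  measurable_fun D (fun x => (f x)%:E) -> (forall x, D x -> 0 <= f x) ->
  (\int[mu]_(x in D) (f x)%:E < +oo)%E -> (\int[mu]_(x in D) (c * f x)%:E < +oo)%E.
Proof.
move=> mD c0 mf f0 foo.
have f0' x : D x -> (0 <= (f x)%:E)%E by rewrite lee_fin; exact: f0.
have c0' : (0 <= c%:E :> \bar R)%E by rewrite lee_fin.
have E := @ge0_integralZl _ _ R mu _ mD _ mf _ f0' c0'.
have E' : (\int[mu]_(x in D) (c * f x)%:E = c%:E * \int[mu]_(x in D) (f x)%:E)%E by [].
rewrite E'; have : (0 <= \int[mu]_(x in D) (f x)%:E)%E by exact: integral_ge0.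
by case: (\int[mu]_(x in D) (f x)%:E)%E foo => [y| |]//= _ _; rewrite -EFinM ltry.
Qed.

Variables p th m : R.
Hypotheses (p2 : 2 <= p) (th0 : 0 <= th) (m0 : 0 < m).
Notation W := (omega (p - 1)).
Notation q := (conj_exp p).

Let p1 : 1 < p. Proof. by rewrite (lt_le_trans _ p2)// ltr1n. Qed.
Let p0 : 0 < p. Proof. exact: lt_trans p1. Qed.
Let pm0 : 0 < p - 1. Proof. by rewrite subr_gt0. Qed.
Let q0 : 0 < q. Proof. by have := conj_exp_gt1 p2; exact: lt_trans. Qed.
Let W0 : 0 < W. Proof. exact: omega_pm1_gt0. Qed.

Lemma powR_root_le (a b : R) : 0 <= a -> a `^ p <= b -> a <= b `^ p^-1.
Proof.
move=> a0 ab; have b0 : 0 <= b by rewrite (le_trans _ ab)// powR_ge0.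
apply: (@le_trans _ _ ((a `^ p) `^ p^-1)); last first.
  by apply: ge0_ler_powR; rewrite ?nnegrE ?powR_ge0 ?invr_ge0 ?(ltW p0).
by rewrite -powRrM mulfV ?gt_eqF// powRr1.
Qed.

Lemma energy_osc v e a b : energy_le p v e -> 0 < a -> a <= b ->
  `|v b - v a| `^ p <= e * ln (b / a) `^ (p - 1).
Proof.
move=> ev a0; rewrite le_eqVlt => /predU1P[<-|ab].
  rewrite subrr normr0 powR0 ?gt_eqF// mulr_ge0 ?powR_ge0//; exact: energy_ge0 ev.
have := ev 1%N (fun=> a) (fun=> b); rewrite big_ord1 /seg ler_pdivrMr; last first.
  by apply: powR_gt0; apply: ln_gt0; rewrite ltr_pdivlMr// mul1r.
apply; first by split => //; exact: ltW.
by apply/trivIsetP => i j _ _; rewrite !ord1.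
Qed.

(** The strict inequality mu < mu_crit leaves room for the factor (1 + e)^q that separates
    the constant from the logarithm in adm_core. *)
Lemma subcritical_slack : m < mu_crit (p - 1) th ->
  exists2 e, 0 < e & m * ((1 + e) `^ q * W `^ (- (p - 1)^-1)) < th + 1.
Proof.
rewrite /mu_crit => mc.
have Wp0 : 0 < W `^ (p - 1)^-1 by exact: powR_gt0.
pose rho := (1 + th) * W `^ (p - 1)^-1 / m.
have rho1 : 1 < rho by rewrite /rho ltr_pdivlMr// mul1r.
(* a = 1 + e is chosen so that a^q lies halfway between 1 and rho. *)
pose a := ((1 + rho) / 2) `^ q^-1.
have a1 : 1 < a.
  apply: (@le_lt_trans _ _ (1 `^ q^-1)); first by rewrite powR1.
  by apply: gt0_ltr_powR; rewrite ?nnegrE ?invr_gt0//; lra.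
have aq : a `^ q = (1 + rho) / 2.
  by rewrite /a -powRrM mulVf ?gt_eqF// powRr1//; lra.
exists (a - 1); first by rewrite subr_gt0.
rewrite addrC subrK aq powRN.
have -> : th + 1 = m * (rho * (W `^ (p - 1)^-1)^-1).
  by rewrite /rho; field; rewrite !gt_eqF.
by rewrite ltr_pM2l// ltr_pM2r ?invr_gt0//; lra.
Qed.

Lemma adm_le1 v g l : adm p th v g l -> W * g + l <= 1 -> g <= W^-1 /\ l <= 1.
Proof.
move=> av gl; have [g0 l0] := adm_ge0 p2 th0 av; split.
  rewrite -[leRHS]mul1r ler_pdivlMr// mulrC; apply: le_trans gl.
  by rewrite lerDl.
by apply: le_trans gl; rewrite lerDr mulr_ge0// ltW.
Qed.

Definition tail_cst : R := (Lam th 1) `^ (- p^-1).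

Lemma adm_tail v g l x : adm p th v g l -> W * g + l <= 1 -> 0 < x ->
  v x <= tail_cst * x `^ (- ((th + 1) / p)).
Proof.
move=> av gl x0; have [_ l1] := adm_le1 av gl.
have L1 : 0 < Lam th 1 by rewrite Lam_gt0.
have := le_trans (adm_decay p2 th0 av x0) l1.
have v0 : 0 <= v x by case: av => + _ _ _; apply.
have -> : Lam th x = Lam th 1 * x `^ (th + 1) by rewrite /Lam powR1 mulr1 mulrA.
have xt : 0 < x `^ (th + 1) by exact: powR_gt0.
rewrite /tail_cst; move: (Lam th 1) L1 => L L1 H.
have Lx : 0 < L * x `^ (th + 1) by exact: mulr_gt0.
have {}H : v x `^ p <= (L * x `^ (th + 1))^-1.
  by rewrite -[leRHS]mul1r ler_pdivlMr.
apply: le_trans (powR_root_le v0 H) _.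
rewrite powR_inv_base ?(ltW Lx)// -powRN powRM ?(ltW L1) ?(ltW xt)//.
by rewrite -powRrM mulrN.
Qed.

(** The energy between x and 1 bounds v x - v 1 by (ln (1/x)^(p-1) / W)^(1/p), and the
    q-th power of this is linear in ln (1/x). *)
Lemma adm_core e v g l x : 0 < e -> adm p th v g l -> W * g + l <= 1 -> 0 < x -> x <= 1 ->
  v x `^ q <= (1 + e) `^ q * (W `^ (- (p - 1)^-1) * - ln x) + (1 + e^-1) `^ q * tail_cst `^ q.
Proof.
move=> e0 av gl x0 x1; have [gW _] := adm_le1 av gl.
have [v0 nv ev Lv] := av.
have T0 : 0 <= - ln x by rewrite oppr_ge0 ln_le0.
have c1 : v 1 <= tail_cst by have := adm_tail av gl ltr01; rewrite powR1 mulr1.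
have tc0 : 0 <= tail_cst by exact: powR_ge0.
pose S := (W^-1 * (- ln x) `^ (p - 1)) `^ p^-1.
have S0 : 0 <= S by exact: powR_ge0.
have B0 : 0 <= W^-1 * (- ln x) `^ (p - 1) by rewrite mulr_ge0 ?powR_ge0// invr_ge0 ltW.
have vS : v x <= tail_cst + S.
  suff : v x - v 1 <= S by lra.
  have d0 : 0 <= v x - v 1 by rewrite subr_ge0 nv.
  apply: powR_root_le => //.
  have := energy_osc ev x0 x1; rewrite distrC ger0_norm// div1r lnV ?posrE//.
  by move=> H; apply: (le_trans H); rewrite ler_wpM2r ?powR_ge0.
have Sq : S `^ q = W `^ (- (p - 1)^-1) * - ln x.
  rewrite /S -powRrM (_ : p^-1 * q = (p - 1)^-1); last first.
    by rewrite /conj_exp; field; rewrite !gt_eqF.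
  rewrite powRM ?powR_ge0 ?invr_ge0 ?(ltW W0)// powR_inv_base ?(ltW W0)// -powRN.
  by rewrite -powRrM mulfV ?gt_eqF// powRr1.
apply: (@le_trans _ _ ((tail_cst + S) `^ q)).
  by apply: ge0_ler_powR; rewrite ?nnegrE ?(ltW q0) ?v0 ?addr_ge0.
by apply: le_trans (powRD_le (ltW q0) e0 tc0 S0) _; rewrite Sq.
Qed.

(** Beyond 1 the decay of v makes R(v) of order x^(-(th+1) r/p), integrable against x^th
    because r > p. Before 1, R(v) is at most exp (mu v^q), hence at most a constant times
    x^(-kap) with kap < th + 1. *)
Lemma adm_dominated : m < mu_crit (p - 1) th ->
  exists G : R -> R, [/\ measurable_fun (`]0, +oo[ : set R) G, forall x : R, 0 < x -> 0 <= G x,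
    (int_lambda th G < +oo)%E &
    forall v g l, adm p th v g l -> W * g + l <= 1 ->
      forall x, 0 < x -> Rem p m (v x) <= G x].
Proof.
move=> mc; have [e e0 he] := subcritical_slack mc.
pose kap := m * ((1 + e) `^ q * W `^ (- (p - 1)^-1)).
pose C2 := m * ((1 + e^-1) `^ q * tail_cst `^ q).
pose r := remexp p.
have rp : p < r by exact: remexp_gt.
pose C4 := m ^+ remord p * tail_cst `^ r * expR (m * tail_cst `^ q).
have C40 : 0 <= C4 by rewrite !mulr_ge0 ?powR_ge0 ?expR_ge0// exprn_ge0// ltW.
pose G (x : R) := if x <= 1 then expR C2 * x `^ (- kap) else C4 * x `^ (- ((th + 1) / p) * r).
have G0 (x : R) : 0 < x -> 0 <= G x.
  by move=> x0; rewrite /G; case: ifP => _; rewrite mulr_ge0 ?powR_ge0 ?expR_ge0.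
have mG : measurable_fun (`]0, +oo[ : set R) G.
  apply: measurable_funTS; apply: measurable_fun_if => //.
  - exact: measurable_fun_ler.
  - by apply: measurable_funTS; apply: measurable_funM => //; exact: measurable_powR.
  - by apply: measurable_funTS; apply: measurable_funM => //; exact: measurable_powR.
exists G; split => //.
- rewrite /int_lambda (ge0_integral_split ltr01); last 2 first.
  + exact: measurable_lambda.
  + move=> x x0; rewrite lee_fin; apply: mulr_ge0; first exact: G0.
    by apply: mulr_ge0; [exact: omega_ge0|exact: powR_ge0].
  apply: lte_add_pinfty.
    have -> : (\int[mu]_(x in `]0%R, 1%R[) (G x * (omega th * x `^ th))%:E =
        \int[mu]_(x in `]0%R, 1%R[) ((omega th * expR C2) * x `^ (th - kap))%:E)%E.
      apply: eq_integral.
      move=> x; rewrite inE/= in_itv/= => /andP[x0 x1]; congr (_%:E).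
      rewrite /G ltW// powRD; first by ring.
      by apply/implyP => _; rewrite gt_eqF.
    apply: integralZ_lty => //.
    + by rewrite mulr_ge0 ?omega_ge0 ?expR_ge0.
    + exact: measurable_powR_E.
    + by move=> x _; exact: powR_ge0.
    + by rewrite integral_powR0// ?ltry//; move: he; rewrite -/kap; lra.
  have -> : (\int[mu]_(x in `]1%R, +oo[) (G x * (omega th * x `^ th))%:E =
      \int[mu]_(x in `]1%R, +oo[) ((omega th * C4) * x `^ (th + - ((th + 1) / p) * r))%:E)%E.
    apply: eq_integral.
    move=> x; rewrite inE/= in_itv/= andbT => x1; congr (_%:E).
    rewrite /G leNgt x1/= powRD; first by ring.
    by apply/implyP => _; rewrite gt_eqF// (lt_trans ltr01).
  apply: integralZ_lty => //.
  + by rewrite mulr_ge0 ?omega_ge0.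
  + exact: measurable_powR_E.
  + by move=> x _; exact: powR_ge0.
  + apply: integral_powRy; rewrite mulNr -mulrA mulrCA.
    suff : 1 < p^-1 * r by move=> H; have : (th + 1) * 1 < (th + 1) * (p^-1 * r) by [rewrite ltr_pM2l// ltr_wpDl]; rewrite mulrCA; lra.
    by rewrite mulrC ltr_pdivlMr// mul1r.
- move=> v g l av gl x x0; have v0 : 0 <= v x by case: av => + _ _ _; apply.
  rewrite /G; case: ifPn => [x1|]; last rewrite -ltNge => x1.
  + apply: le_trans (etail_le_expR _ _) _; first by rewrite mulr_ge0 ?powR_ge0// ltW.
    rewrite {2}/powR gt_eqF// -expRD ler_expR ger0_norm//.
    have := adm_core e0 av gl x0 x1; rewrite -(ler_pM2l m0) => /le_trans; apply.
    by rewrite /C2 /kap; lra.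
  + apply: le_trans (Rem_le p m0 (v x)) _; rewrite ger0_norm//.
    have vt := adm_tail av gl x0.
    have xp1 : x `^ (- ((th + 1) / p)) <= 1.
      rewrite -[leRHS](powRr0 x) ler_powR ?(ltW x1)// oppr_le0 divr_ge0 ?(ltW p0)//.
      by rewrite addr_ge0.
    have tc0 : 0 <= tail_cst by exact: powR_ge0.
    have vt1 : v x <= tail_cst by apply: (le_trans vt); rewrite ler_piMr.
    rewrite /C4 -!mulrA ler_wpM2l ?exprn_ge0 ?(ltW m0)//.
    have r0 : 0 <= r by rewrite ltW// (lt_trans p0).
    rewrite -/r [expR (m * tail_cst `^ q) * _]mulrC mulrA (powRrM x _ r).
    move: (x `^ (- ((th + 1) / p))) (powR_ge0 x (- ((th + 1) / p))) vt => Y Y0 vt.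
    rewrite -(powRM r tc0 Y0); apply: ler_pM; [exact: powR_ge0|exact: expR_ge0| |].
      by apply: ge0_ler_powR => //; rewrite nnegrE mulr_ge0.
    rewrite ler_expR ler_pM2l//.
    by apply: ge0_ler_powR; rewrite ?nnegrE ?(ltW q0).
Qed.

End domination.

(** * Compactness *)

Section ultralimit.
Context {R : realType}.

(** A cluster point of a sequence along an ultrafilter is its limit. *)
Lemma ultra_bounded_cvg (U : set_system nat) (u : nat -> R) (a b : R) : UltraFilter U ->
  (forall n, a <= u n <= b) -> exists c : R, u @ U --> c.
Proof.
move=> UU uab; have FF : ProperFilter (u @ U) by exact: fmap_proper_filter.
have Fab : (u @ U) `[a, b]%classic.
  change (U [set n | `[a, b]%classic (u n)]).
  by apply: filterE => n /=; rewrite in_itv/=; exact: uab.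
have [c [_ cl]] := @segment_compact R a b (u @ U) FF Fab.
exists c => B nB; case: (in_ultra_setVsetC (u @^-1` B) UU) => // HC; exfalso.
by have [x [nBx Bx]] := cl (~` B) B HC nB.
Qed.

Lemma cvg_sum_seq (T I : Type) (F : set_system T) {FF : Filter F} (s : seq I)
    (f : I -> T -> R) (c : I -> R) :
  (forall i, f i @ F --> c i) -> (fun n => \sum_(i <- s) f i n) @ F --> \sum_(i <- s) c i.
Proof.
move=> fc; elim: s => [|i s IH].
  rewrite big_nil (_ : (fun _ => _) = cst 0); first exact: cvg_cst.
  by apply/funext => n; rewrite big_nil.
rewrite big_cons (_ : (fun n => _) = (fun n => f i n + \sum_(j <- s) f j n)); last first.
  by apply/funext => n; rewrite big_cons.
exact: cvgD.
Qed.

Lemma filter_forall_lt (U : set_system nat) (P : nat -> set nat) k : Filter U ->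
  (forall j, U (P j)) -> U [set n | forall j, (j < k)%N -> P j n].
Proof.
move=> FU UP; elim: k => [|k IH]; first by apply: filterE.
apply: filterS (filterI IH (UP k)) => n [H1 H2] j; rewrite ltnS leq_eqVlt => /predU1P[->//|].
exact: H1.
Qed.

Definition nth_rat (j : nat) : R := if (unpickle j : option rat) is Some q then ratr q else 0.

Lemma nth_rat_dense (x y : R) : x < y -> exists j, x < nth_rat j < y.
Proof.
move=> xy; have [q] := rat_in_itvoo xy; rewrite in_itv/= => H.
by exists (pickle q); rewrite /nth_rat pickleK.
Qed.

(** Monotone functions that converge at the rational points to a continuous function
    converge everywhere, being squeezed between nearby rational points. *)
Lemma monotone_squeeze_cvg (f : nat -> R -> R) (fs : R -> R) (x : R) : 0 < x ->
  (forall n s t, 0 < s -> s <= t -> f n t <= f n s) -> {for x, continuous fs} ->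
  (forall j, 0 < nth_rat j -> f n (nth_rat j) @[n --> \oo] --> fs (nth_rat j)) ->
  f n x @[n --> \oo] --> fs x.
Proof.
move=> x0 mf cfs fr; apply/cvgrPdist_lt => e e0.
have e2 : 0 < e / 2 by rewrite divr_gt0.
move/cvgrPdist_lt : cfs => /(_ _ e2) /nbhs_ballP[d /= d0 Hd].
have [i /andP[i1 i2]] : exists i, Num.max 0 (x - d) < nth_rat i < x.
  by apply: nth_rat_dense; rewrite gt_max x0/= ltrBlDr ltrDl.
have [j /andP[j1 j2]] : exists j, x < nth_rat j < x + d.
  by apply: nth_rat_dense; rewrite ltrDl.
move: i1; rewrite gt_max => /andP[i0 i1].
have j0 : 0 < nth_rat j by exact: lt_trans j1.
have Hi : `|fs x - fs (nth_rat i)| < e / 2.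
  by apply: Hd; rewrite /ball/= ltr_norml; lra.
have Hj : `|fs x - fs (nth_rat j)| < e / 2.
  by apply: Hd; rewrite /ball/= ltr_norml; lra.
move/cvgrPdist_lt : (fr i i0) => /(_ _ e2) Ci.
move/cvgrPdist_lt : (fr j j0) => /(_ _ e2) Cj.
apply: filterS (filterI Ci Cj) => n /= [Hni Hnj].
have := mf n _ _ i0 (ltW i2); have := mf n _ _ x0 (ltW j1).
move: Hni Hnj Hi Hj; rewrite !ltr_norml => /andP[? ?] /andP[? ?] /andP[? ?] /andP[? ?] ? ?.
by apply/andP; split; lra.
Qed.

Variables p th : R.
Hypotheses (p2 : 2 <= p) (th0 : 0 <= th).
Notation W := (omega (p - 1)).
Let p1 : 1 < p. Proof. by rewrite (lt_le_trans _ p2)// ltr1n. Qed.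
Let p0 : 0 < p. Proof. exact: lt_trans p1. Qed.
Let W0 : 0 < W. Proof. exact: omega_pm1_gt0. Qed.

(** Limits along an ultrafilter exist at all points at once and inherit monotonicity and
    the bounds on sums of chord energies, hence continuity. The integral theorems need
    sequences: indices are then picked that are close to the limits at more and more
    rational points. *)
Lemma adm_precompact (v : nat -> R -> R) (g l : nat -> R) :
  (forall n, adm p th (v n) (g n) (l n)) -> (forall n, W * g n + l n <= 1) ->
  exists (phi : nat -> nat) (vs : R -> R) (ls : R), [/\ forall k, (k <= phi k)%N,
    forall x : R, 0 < x -> v (phi k) x @[k --> \oo] --> vs x,
    l (phi k) @[k --> \oo] --> ls &
    [/\ forall x, 0 < x -> 0 <= vs x, forall x y, 0 < x -> x <= y -> vs y <= vs x &
        energy_le p vs ((1 - ls) / W)]].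
Proof.
move=> av gl.
have [U [UU ooU]] := @ultraFilterLemma nat \oo _.
have PU : ProperFilter U by exact: ultra_proper.
have v0 n x : 0 < x -> 0 <= v n x by case: (av n) => + _ _ _; apply.
have nv n x y : 0 < x -> x <= y -> v n y <= v n x by case: (av n) => _ + _ _; apply.
have [vs Hvs] : {vs : R -> R & forall x, 0 < x -> (fun n => v n x) @ U --> vs x}.
  apply: (@choice _ _ (fun x c => 0 < x -> (fun n => v n x) @ U --> c)) => x.
  have [x0|x0] := ltP 0 x; last by exists 0.
  have B n : 0 <= v n x <= tail_cst p th * x `^ (- ((th + 1) / p)).
    by rewrite v0//= (adm_tail p2 th0 (av n)).
  by have [c Hc] := ultra_bounded_cvg UU B; exists c.
have [ls Hls] : exists ls : R, l @ U --> ls.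
  apply: (@ultra_bounded_cvg U l 0 1 UU) => n.
  have [_ l0] := adm_ge0 p2 th0 (av n).
  by have [_ ->] := adm_le1 p2 th0 (av n) (gl n); rewrite l0.
have vs0 x : 0 < x -> 0 <= vs x.
  move=> x0; apply: (ler_cvg_to (cvg_cst 0 : cst 0 @ U --> 0) (Hvs x x0)).
  by apply: filterE => n; exact: v0.
have nvs x y : 0 < x -> x <= y -> vs y <= vs x.
  move=> x0 xy; apply: (ler_cvg_to (Hvs y (lt_le_trans x0 xy)) (Hvs x x0)).
  by apply: filterE => n; exact: nv.
have Evs : energy_le p vs ((1 - ls) / W).
  move=> n a b ab tab.
  have segc i : (fun k => seg p (v k) (a i) (b i)) @ U --> seg p vs (a i) (b i).
    have [a0 aib] := ab i.
    apply: cvgMl; apply: (@cvg_comp _ _ _ (fun k => v k (b i) - v k (a i)) (fun y => `|y| `^ p)).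
      by apply: cvgB; apply: Hvs => //; exact: lt_le_trans aib.
    exact: continuous_norm_powR.
  have R1 : (fun k => (1 - l k) / W) @ U --> (1 - ls) / W.
    by apply: cvgMl; apply: cvgB => //; exact: cvg_cst.
  apply: (ler_cvg_to (cvg_sum_seq (s := index_enum 'I_n) segc) R1).
  apply: filterE => k; case: (av k) => _ _ ek _; apply: le_trans (ek n a b ab tab) _.
  by rewrite ler_pdivlMr// mulrC lerBrDr.
have cvs := energy_continuous p1 Evs.
(* The indices in A k are at least k and 1/(k+1)-close to the limits at the positive ones
   among the first k rational points; A k belongs to the ultrafilter, so it is not empty. *)
pose P k j : set nat := [set n | 0 < nth_rat j -> `|vs (nth_rat j) - v n (nth_rat j)| < k.+1%:R^-1].
pose A k : set nat := [set n | (k <= n)%N /\ `|ls - l n| < k.+1%:R^-1 /\ forall j, (j < k)%N -> P k j n].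
have UA k : U (A k).
  have k0 : 0 < k.+1%:R^-1 :> R by rewrite invr_gt0.
  apply: filterI; first by apply: ooU; exists k.
  apply: filterI; first by move/cvgrPdist_lt : Hls => /(_ _ k0).
  apply: filter_forall_lt => j; rewrite /P.
  have [r0|r0] := ltP 0 (nth_rat j); last by apply: filterE.
  move/cvgrPdist_lt : (Hvs _ r0) => /(_ _ k0).
  by apply: filterS => n H _; exact: H.
have [phi Hphi] : {phi : nat -> nat & forall k, A k (phi k)}.
  by apply: (@choice _ _ (fun k n => A k n)) => k; exact: filter_ex (UA k).
exists phi, vs, ls; split.
- by move=> k; case: (Hphi k).
- move=> x x0; apply: (@monotone_squeeze_cvg (fun k => v (phi k))) => //.
  + by move=> n s t; exact: nv.
  + exact: cvs.
  + move=> j r0; apply/cvgrPdist_lt => e e0.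
    have H1 : \forall k \near \oo, (k.+1%:R^-1 < e) by exact: (near_infty_natSinv_lt (PosNum e0)).
    have H2 : \forall k \near \oo, (j < k)%N by exists j.+1.
    apply: filterS (filterI H1 H2) => k [k1 k2].
    by have [_ [_ H]] := Hphi k; apply: lt_trans (H j k2 r0) k1.
- apply/cvgrPdist_lt => e e0.
  have H1 : \forall k \near \oo, (k.+1%:R^-1 < e) by exact: (near_infty_natSinv_lt (PosNum e0)).
  apply: filterS H1 => k k1.
  by have [_ [H _]] := Hphi k; apply: lt_trans H k1.
- by split.
Qed.

End ultralimit.

(** * Limits of maximizing sequences *)

Section maximizing_profile.
Context {R : realType}.
Variables p th m : R.
Hypotheses (p2 : 2 <= p) (th0 : 0 <= th) (m0 : 0 < m).
Notation mu := (@lebesgue_measure R).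
Notation W := (omega (p - 1)).
Let p1 : 1 < p. Proof. by rewrite (lt_le_trans _ p2)// ltr1n. Qed.
Let p0 : 0 < p. Proof. exact: lt_trans p1. Qed.
Let W0 : 0 < W. Proof. exact: omega_pm1_gt0. Qed.

Lemma adm_measurable_Lp v g l : adm p th v g l ->
  measurable_fun (`]0, +oo[ : set R) (fun x => `|v x| `^ p).
Proof.
move=> av; apply: (adm_measurable_comp p2 av (phi := fun y => `|y| `^ p)).
exact: continuous_norm_powR.
Qed.

Lemma adm_measurable_Rem v g l : adm p th v g l ->
  measurable_fun (`]0, +oo[ : set R) (fun x => Rem p m (v x)).
Proof.
by move=> av; apply: (adm_measurable_comp p2 av (phi := Rem p m)); exact: continuous_Rem.
Qed.

Lemma int_Aabs_split v g l : adm p th v g l ->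
  int_lambda th (fun x => Aabs p m (v x)) =
  ((lead p m)%:E * int_lambda th (fun x => (`|v x| `^ p)%R)
   + int_lambda th (fun x => Rem p m (v x)))%E.
Proof.
move=> av; have mL := adm_measurable_Lp av; have mR := adm_measurable_Rem av.
rewrite -(int_lambdaZ th (lead_ge0 p m0) mL); last by move=> x _; exact: powR_ge0.
rewrite -int_lambdaD.
- by apply: eq_int_lambda => x _; rewrite Aabs_split.
- by apply: measurable_funM => //.
- exact: mR.
- by move=> x _; rewrite mulr_ge0 ?powR_ge0// lead_ge0.
- by move=> x _; exact: Rem_ge0.
Qed.

Lemma int_fatou (f : nat -> R -> R) (fs : R -> R) (c : nat -> R) (cs : R) :
  (forall n, measurable_fun (`]0, +oo[ : set R) (f n)) ->
  (forall n x, 0 < x -> 0 <= f n x) ->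
  (forall x : R, 0 < x -> f n x @[n --> \oo] --> fs x) ->
  (forall n, (int_lambda th (f n) <= (c n)%:E)%E) -> c @ \oo --> cs ->
  (int_lambda th fs <= cs%:E)%E.
Proof.
move=> mf f0 ffs fc ccs.
have mP : measurable (`]0, +oo[%classic : set R) by exact: measurable_itv.
pose F n x : \bar R := (f n x * (omega th * x `^ th))%:E.
have F0 n x : (`]0, +oo[%classic : set R) x -> (0 <= F n x)%E.
  rewrite /= in_itv/= andbT => x0; rewrite lee_fin; apply: mulr_ge0; first exact: f0.
  by apply: mulr_ge0; [exact: omega_ge0|exact: powR_ge0].
have -> : int_lambda th fs = (\int[mu]_(x in `]0%R, +oo[) limn_einf (F ^~ x))%E.
  apply: eq_integral => x; rewrite inE/= in_itv/= andbT => x0.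
  apply/esym/(cvg_limn_einf_sup _).1; apply: cvg_EFin; first by apply: nearW.
  by apply: cvgMl; exact: ffs.
apply: le_trans (@fatou _ _ _ mu _ mP F (fun n => measurable_lambda th (mf n)) F0) _.
have cE : (EFin \o c) @ \oo --> cs%:E by apply: cvg_EFin => //; apply: nearW.
rewrite -(cvg_limn_einf_sup cE).1.
rewrite !limn_einf_lim; apply: lee_lim; [exact: is_cvg_einfs|exact: is_cvg_einfs|].
apply: nearW => n; apply: le_ereal_inf_tmp => _ [k /= nk <-].
by apply: le_trans (fc k); apply: ereal_inf_lbound; exists k.
Qed.

Lemma int_dominated (f : nat -> R -> R) (fs G : R -> R) :
  (forall n, measurable_fun (`]0, +oo[ : set R) (f n)) ->
  (forall n x, 0 < x -> 0 <= f n x) ->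
  (forall x : R, 0 < x -> f n x @[n --> \oo] --> fs x) ->
  measurable_fun (`]0, +oo[ : set R) G -> (int_lambda th G < +oo)%E ->
  (forall n x, 0 < x -> f n x <= G x) ->
  int_lambda th (f n) @[n --> \oo] --> int_lambda th fs.
Proof.
move=> mf f0 ffs mG Goo fG.
have mP : measurable (`]0, +oo[%classic : set R) by exact: measurable_itv.
have w0 x : 0 <= omega th * x `^ th :> R.
  by apply: mulr_ge0; [exact: omega_ge0|exact: powR_ge0].
have G0 x : 0 < x -> 0 <= G x by move=> x0; apply: le_trans (fG 0%N x x0); exact: f0.
apply: (@dominated_cvg _ _ R mu _ mP (fun n x => (f n x * (omega th * x `^ th))%:E)
   (fun x => (fs x * (omega th * x `^ th))%:E) (fun x => (G x * (omega th * x `^ th))%:E)).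
- by move=> n; exact: measurable_lambda.
- move=> x /=; rewrite in_itv/= andbT => x0.
  apply: cvg_EFin; first by apply: nearW.
  by apply: cvgMl; exact: ffs.
- by [].
- apply/integrableP; split; first exact: measurable_lambda.
  apply: le_lt_trans Goo; rewrite le_eqVlt; apply/orP; left; apply/eqP.
  apply: eq_integral => x; rewrite inE/= in_itv/= andbT => x0.
  by rewrite ger0_norm//; apply: mulr_ge0; [exact: G0|exact: w0].
- move=> n x /=; rewrite in_itv/= andbT => x0.
  rewrite ger0_norm; last by apply: mulr_ge0; [exact: f0|exact: w0].
  by rewrite lee_fin; apply: ler_wpM2r; [exact: w0|exact: fG].
Qed.

Hypothesis mc : m < mu_crit (p - 1) th.

Lemma adm_Rem_lty v g l : adm p th v g l -> W * g + l <= 1 ->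
  (int_lambda th (fun x => Rem p m (v x)) < +oo)%E.
Proof.
move=> av gl; have [G [mG G0 Goo RG]] := adm_dominated p2 th0 m0 mc.
apply: le_lt_trans Goo; apply: int_lambda_le => //.
- exact: adm_measurable_Rem av.
- by move=> x _; exact: Rem_ge0.
- by move=> x x0; exact: RG av gl x x0.
Qed.

Lemma d_sup_lty : (d_sup p th (p - 1) m < +oo)%E.
Proof.
have [G [mG G0 Goo RG]] := adm_dominated p2 th0 m0 mc.
apply: (@le_lt_trans _ _ ((lead p m)%:E + int_lambda th G)%E); last first.
  by apply: lte_add_pinfty => //; exact: ltry.
apply: d_sup_le_class => // v g l av nz gl; rewrite (int_Aabs_split av); apply: leeD.
  case: (av) => _ _ _ Lv; have [_ l1] := adm_le1 p2 th0 av gl.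
  rewrite -[leRHS]mule1; apply: lee_wpmul2l; first by rewrite lee_fin lead_ge0.
  by apply: (le_trans Lv); rewrite lee_fin.
apply: int_lambda_le => //.
- exact: adm_measurable_Rem av.
- by move=> x _; exact: Rem_ge0.
- by move=> x x0; exact: RG av gl x x0.
Qed.

(** Fatou's lemma bounds the mass of the limit by the limit l of the masses, and dominated
    convergence passes to the limit in the integral of R. *)
Lemma maximizing_profile (d : R) : d_sup p th (p - 1) m = d%:E ->
  exists (v : R -> R) (g l : R), [/\ adm p th v g l, W * g + l <= 1 &
    (d%:E <= (lead p m * l)%:E + int_lambda th (fun x => Rem p m (v x)))%E].
Proof.
move=> dE.
have H n : exists z : (R -> R) * (R * R), [/\ adm p th z.1 z.2.1 z.2.2, W * z.2.1 + z.2.2 <= 1 &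
    ((d - n.+1%:R^-1)%:E <= (lead p m * z.2.2)%:E + int_lambda th (fun x => Rem p m (z.1 x)))%E].
  apply: contrapT => H.
  have : (d_sup p th (p - 1) m <= (d - n.+1%:R^-1)%:E)%E.
    apply: d_sup_le_class => // v g l av nz gl; rewrite (int_Aabs_split av).
    rewrite leNgt; apply/negP => dN; apply: H; exists (v, (g, l)); split => //=.
    apply: (le_trans (ltW dN)); apply: leeD => //.
    rewrite EFinM; apply: lee_wpmul2l; first by rewrite lee_fin lead_ge0.
    by case: av.
  by rewrite dE lee_fin; apply/negP; rewrite -ltNge ltrBlDr ltrDl invr_gt0.
have [z Hz] := choice H.
have [phi [vs [ls [kphi cv cl [vs0 nvs Evs]]]]] := @adm_precompact R p th p2 th0 (fun n => (z n).1)
  (fun n => (z n).2.1) (fun n => (z n).2.2) (fun n => ltac:(by case: (Hz n))) (fun n => ltac:(by case: (Hz n))).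
have az n : adm p th (z n).1 (z n).2.1 (z n).2.2 by case: (Hz n).
have glz n : W * (z n).2.1 + (z n).2.2 <= 1 by case: (Hz n).
have Ls : (int_lambda th (fun x => (`|vs x| `^ p)%R) <= ls%:E)%E.
  apply: (@int_fatou (fun k x => `|(z (phi k)).1 x| `^ p) _ (fun k => (z (phi k)).2.2)) => //.
  - by move=> k; exact: adm_measurable_Lp (az _).
  - move=> x x0; apply: (@cvg_comp _ _ _ (fun k => (z (phi k)).1 x) (fun y => `|y| `^ p)).
      exact: cv.
    exact: continuous_norm_powR.
  - by move=> k; case: (az (phi k)).
have avs : adm p th vs ((1 - ls) / W) ls by split.
exists vs, ((1 - ls) / W), ls; split => //.
  by rewrite mulrC divfK ?gt_eqF// subrK.
have [G [mG G0 Goo RG]] := adm_dominated p2 th0 m0 mc.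
have cR : int_lambda th (fun x => Rem p m ((z (phi k)).1 x)) @[k --> \oo] -->
    int_lambda th (fun x => Rem p m (vs x)).
  apply: (@int_dominated (fun k x => Rem p m ((z (phi k)).1 x)) _ G) => //.
  - by move=> k; exact: adm_measurable_Rem (az _).
  - by move=> k x _; exact: Rem_ge0.
  - move=> x x0; apply: (@cvg_comp _ _ _ (fun k => (z (phi k)).1 x) (Rem p m)); first exact: cv.
    exact: continuous_Rem.
  - by move=> k x x0; exact: RG (az _) (glz _) x x0.
have c1 : (d - k.+1%:R^-1)%:E @[k --> \oo] --> d%:E.
  apply: cvg_EFin; first by apply: nearW.
  rewrite -[X in _ --> X]subr0; apply: cvgB; first exact: cvg_cst.
  exact: cvg_harmonic.
have c2 : ((lead p m * (z (phi k)).2.2)%:E + int_lambda th (fun x => Rem p m ((z (phi k)).1 x)))%E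
    @[k --> \oo] --> ((lead p m * ls)%:E + int_lambda th (fun x => Rem p m (vs x)))%E.
  apply: cvgeD => //; apply: cvg_EFin; first by apply: nearW.
  exact: cvgMr.
apply: (lee_cvg_to c1 c2); apply: nearW => k.
case: (Hz (phi k)) => _ _; apply: le_trans; rewrite lee_fin lerB// lef_pV2 ?posrE//.
by rewrite ler_nat ltnS.
Qed.

End maximizing_profile.

(** * Changing the amplitude and the scale of a profile *)

Section scaling_competitors.
Context {R : realType}.
Variables p th m : R.
Hypotheses (p2 : 2 <= p) (th0 : 0 <= th) (m0 : 0 < m).
Notation W := (omega (p - 1)).
Notation r := (remexp p).
Let p1 : 1 < p. Proof. by rewrite (lt_le_trans _ p2)// ltr1n. Qed.
Let p0 : 0 < p. Proof. exact: lt_trans p1. Qed.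
Let W0 : 0 < W. Proof. exact: omega_pm1_gt0. Qed.
Let t1 : 0 < th + 1. Proof. exact: th1_gt0. Qed.

Lemma energy_le_shrink (v : R -> R) e s : 0 < s -> energy_le p v e ->
  energy_le p (fun x => v (x / s)) e.
Proof.
move=> s0 ev n a b ab tab.
have E i : seg p (fun x => v (x / s)) (a i) (b i) = seg p v (a i / s) (b i / s).
  rewrite /seg; congr (_ / (ln _) `^ _).
  by rewrite invf_div mulrA divfK ?gt_eqF.
under eq_bigr do rewrite E.
apply: ev => [i|]; first by have [? ?] := ab i; rewrite divr_gt0// ler_pM2r ?invr_gt0.
move=> i j _ _ [x /= []]; rewrite !in_itv/= => /andP[ax xb] /andP[ax' xb'].
apply: tab => //; exists (x * s); rewrite /= !in_itv/=; split; apply/andP; split.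
- by rewrite -ltr_pdivrMr.
- by rewrite -ltr_pdivlMr.
- by rewrite -ltr_pdivrMr.
- by rewrite -ltr_pdivlMr.
Qed.

Lemma adm_shrink v g l s : 0 < s -> adm p th v g l ->
  adm p th (fun x => v (x / s)) g (s `^ (th + 1) * l).
Proof.
move=> s0 av; have mL := adm_measurable_Lp p2 av; case: av => v0 nv ev Lv; split.
- by move=> x x0; apply: v0; rewrite divr_gt0.
- by move=> x y x0 xy; apply: nv; rewrite ?divr_gt0// ler_pM2r ?invr_gt0.
- exact: energy_le_shrink.
- rewrite (int_lambda_shrink th s0 mL); last by move=> x _; exact: powR_ge0.
  by rewrite EFinM; apply: lee_wpmul2l => //; rewrite lee_fin powR_ge0.
Qed.

Lemma int_Lp_scale v g l c : 0 <= c -> adm p th v g l ->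
  int_lambda th (fun x => `|c * v x| `^ p) =
  ((c `^ p)%:E * int_lambda th (fun x => (`|v x| `^ p)%R))%E.
Proof.
move=> c0 av; have mL := adm_measurable_Lp p2 av.
rewrite -(int_lambdaZ th (powR_ge0 c p) mL); last by move=> x _; exact: powR_ge0.
by apply: eq_int_lambda => x x0; rewrite normrM (ger0_norm c0) powRM.
Qed.

Lemma adm_scale v g l c : 0 <= c -> adm p th v g l ->
  adm p th (fun x => c * v x) (c `^ p * g) (c `^ p * l).
Proof.
move=> c0 av; have LE := int_Lp_scale c0 av; case: av => v0 nv ev Lv; split.
- by move=> x x0; rewrite mulr_ge0 ?v0.
- by move=> x y x0 xy; rewrite ler_wpM2l ?nv.
- exact: energy_le_scale.
- by rewrite LE EFinM; apply: lee_wpmul2l => //; rewrite lee_fin powR_ge0.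
Qed.

Lemma nonzero_shrink (v : R -> R) s : 0 < s -> nonzero v -> nonzero (fun x => v (x / s)).
Proof.
move=> s0 [x x0 vx]; exists (x * s); first exact: mulr_gt0.
by rewrite mulfK// gt_eqF.
Qed.

Lemma nonzero_scale (v : R -> R) c : 0 < c -> nonzero v -> nonzero (fun x => c * v x).
Proof. by move=> c0 [x x0 vx]; exists x => //; rewrite mulf_neq0// gt_eqF. Qed.

Lemma powR_root s : 0 < s -> (s `^ (th + 1)^-1) `^ (th + 1) = s.
Proof. by move=> s0; rewrite -powRrM mulVf ?gt_eqF// powRr1// ltW. Qed.

(** The profile t^(1/p) v(x/s), with s chosen to make the norm equal to 1. The energy
    takes t W g of the budget; the rest is mass, which R multiplies by at least b (M/L)
    t^(r/p-1), on top of lead. *)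
Lemma dilation_gap v g (L M t : R) : adm p th v g L ->
  int_lambda th (fun x => `|v x| `^ p) = L%:E -> nonzero v -> 0 < L ->
  (M%:E <= int_lambda th (fun x => (`|v x| `^ r)%R))%E -> 0 < t -> t * (W * g) < 1 ->
  (((1 - t * (W * g)) * (lead p m + m ^+ remord p / (remord p)`!%:R * M / L * t `^ (r / p - 1)))%:E
    <= d_sup p th (p - 1) m)%E.
Proof.
move=> av LE nz L0 ME t0 tg.
pose c := t `^ p^-1.
have c0 : 0 < c by exact: powR_gt0.
have cp : c `^ p = t by rewrite /c -powRrM mulVf ?gt_eqF// powRr1// ltW.
pose sg := (1 - t * (W * g)) / (t * L).
have sg0 : 0 < sg by rewrite /sg divr_gt0 ?mulr_gt0// subr_gt0.
pose s := sg `^ (th + 1)^-1.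
have s0 : 0 < s by exact: powR_gt0.
have sE : s `^ (th + 1) = sg by exact: powR_root.
have aw0 := adm_scale (ltW c0) av; rewrite cp in aw0.
have aw := adm_shrink s0 aw0; rewrite sE in aw.
have gl : W * (t * g) + sg * (t * L) <= 1.
  rewrite /sg divfK; last by rewrite gt_eqF// mulr_gt0.
  by rewrite mulrCA addrC subrK.
apply: le_trans (adm_le_d_sup p2 th0 aw m0 (nonzero_shrink s0 (nonzero_scale c0 nz)) gl).
rewrite (int_lambda_shrink (F := fun x => Aabs p m (c * v x)) th s0); first last.
- by move=> x _; exact: Aabs_ge0.
- by apply: (adm_measurable_comp p2 aw0 (phi := Aabs p m)); exact: continuous_Aabs.
rewrite sE (int_Aabs_split p2 m0 aw0) (int_Lp_scale (ltW c0) av) cp LE.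
set b := m ^+ remord p / (remord p)`!%:R.
have b0 : 0 <= b by rewrite /b divr_ge0// exprn_ge0// ltW.
have mr : measurable_fun (`]0, +oo[ : set R) (fun x => `|v x| `^ r).
  apply: (adm_measurable_comp p2 av (phi := fun y => `|y| `^ r)).
  by apply: continuous_norm_powR; apply: lt_trans (remexp_gt p2).
have IR : ((b * c `^ r * M)%:E <= int_lambda th (fun x => Rem p m (c * v x)))%E.
  apply: (@le_trans _ _ (int_lambda th (fun x => b * c `^ r * `|v x| `^ r))).
    rewrite (int_lambdaZ th _ mr); last 2 first.
    - by apply: mulr_ge0 => //; exact: powR_ge0.
    - by move=> x _; exact: powR_ge0.
    rewrite EFinM; apply: lee_wpmul2l => //.
    by rewrite lee_fin; apply: mulr_ge0 => //; exact: powR_ge0.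
  apply: int_lambda_le.
  - by apply: measurable_funM.
  - exact: adm_measurable_Rem aw0.
  - by move=> x _; apply: mulr_ge0; [apply: mulr_ge0 => //|]; exact: powR_ge0.
  - move=> x x0; apply: le_trans (Rem_ge p m0 _); rewrite normrM (ger0_norm (ltW c0)).
    by rewrite powRM ?(ltW c0)// -/b mulrA.
apply: (@le_trans _ _ (sg%:E * ((lead p m)%:E * (t%:E * L%:E) + (b * c `^ r * M)%:E))%E); last first.
  apply: lee_wpmul2l; first by rewrite lee_fin ltW.
  by apply: leeD.
rewrite -(EFinM t L) -(EFinM (lead p m)) -EFinD -EFinM lee_fin.
have cr : c `^ r = t * t `^ (r / p - 1).
  rewrite /c -powRrM (_ : p^-1 * r = 1 + (r / p - 1)); last by ring.
  by rewrite powRD ?powRr1 ?(ltW t0)//; apply/implyP => _; rewrite gt_eqF.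
rewrite cr /sg; move: (t `^ (r / p - 1)) => T.
rewrite le_eqVlt; apply/orP; left; apply/eqP; field.
by rewrite !gt_eqF.
Qed.

(** If part of the constraint is unused, v can be multiplied by a factor c > 1, and the
    integral grows at least by this factor, so it was smaller than d. *)
Lemma adm_strict v g l (d : R) : d_sup p th (p - 1) m = d%:E -> 0 < d ->
  adm p th v g l -> nonzero v -> W * g + l < 1 ->
  (int_lambda th (fun x => Aabs p m (v x)) < d%:E)%E.
Proof.
move=> dE d0 av nz gl; have [g0 l0] := adm_ge0 p2 th0 av.
have Lpos : 0 < l.
  have := adm_Lp_gt0 p2 th0 av nz; case: av => _ _ _ Lv => H.
  by rewrite -lte_fin; exact: lt_le_trans H Lv.
have S0 : 0 < W * g + l by rewrite ltr_wpDl// mulr_ge0// ltW.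
pose c := (W * g + l)^-1 `^ p^-1.
have cp : c `^ p = (W * g + l)^-1.
  by rewrite /c -powRrM mulVf ?gt_eqF// powRr1// invr_ge0 ltW.
have c1 : 1 < c.
  apply: (@le_lt_trans _ _ (1 `^ p^-1)); first by rewrite powR1.
  by apply: gt0_ltr_powR; rewrite ?nnegrE ?invr_gt0 ?invr_ge0 ?(ltW S0)// invf_gt1.
have c0 : 0 < c by exact: lt_trans c1.
have aw := adm_scale (ltW c0) av; rewrite cp in aw.
have gl1 : W * ((W * g + l)^-1 * g) + (W * g + l)^-1 * l <= 1.
  by rewrite mulrCA -mulrDr mulVf// gt_eqF.
have := adm_le_d_sup p2 th0 aw m0 (nonzero_scale c0 nz) gl1; rewrite dE => H.
have mA : measurable_fun (`]0, +oo[ : set R) (fun x => Aabs p m (v x)).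
  by apply: (adm_measurable_comp p2 av (phi := Aabs p m)); exact: continuous_Aabs.
have {}H : (c%:E * int_lambda th (fun x => Aabs p m (v x)) <= d%:E)%E.
  apply: le_trans H; rewrite -(int_lambdaZ th (ltW c0) mA); last by move=> x _; exact: Aabs_ge0.
  apply: int_lambda_le.
  - by apply: measurable_funM.
  - by apply: (adm_measurable_comp p2 aw (phi := Aabs p m)); exact: continuous_Aabs.
  - by move=> x _; apply: mulr_ge0; [exact: ltW|exact: Aabs_ge0].
  - by move=> x _; exact: Aabs_scale (ltW c1).
have I0 : (0 <= int_lambda th (fun x => Aabs p m (v x)))%E.
  by apply: int_lambda_ge0 => x _; exact: Aabs_ge0.
case: (int_lambda th (fun x => Aabs p m (v x))) H I0 => [I| |]//.
  rewrite -EFinM !lee_fin lte_fin => H I0; rewrite ltNge; apply/negP => dI.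
  have : c * d <= d by apply: le_trans H; rewrite ler_pM2l.
  by rewrite leNgt ltr_pMl// c1.
by rewrite gt0_muley ?lte_fin.
Qed.

Hypothesis mc : m < mu_crit (p - 1) th.

(** The limit profile v is dilated so that its mass becomes l. As l is at least the mass
    of v, the integral of R grows and d is reached. The profile 0 would only give lead l,
    which is below d. *)
Lemma exists_maximizer (d : R) : d_sup p th (p - 1) m = d%:E -> lead p m < d ->
  exists (v : R -> R) (g l : R), [/\ adm p th v g l, nonzero v, W * g + l <= 1 &
    int_lambda th (fun x => Aabs p m (v x)) = d%:E].
Proof.
move=> dE ld; have [v [g [l [av gl dN]]]] := maximizing_profile p2 th0 m0 mc dE.
have [_ l1] := adm_le1 p2 th0 av gl; have [_ l0] := adm_ge0 p2 th0 av.
have nz : nonzero v.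
  apply: contrapT => nz; move: dN; apply/negP; rewrite -ltNge.
  rewrite (eq_int_lambda th (G := fun x => 0 * 0)); last first.
    move=> x x0; rewrite (_ : v x = 0) ?Rem0 ?mulr0//.
    by apply: contrapT => /eqP vx; apply: nz; exists x.
  rewrite int_lambdaZ// mul0e adde0 lte_fin; apply: le_lt_trans ld.
  by rewrite ler_piMr// lead_ge0.
have Lgt := adm_Lp_gt0 p2 th0 av nz.
have [L LE] : exists L, int_lambda th (fun x => `|v x| `^ p) = L%:E.
  case: (av) => _ _ _; case: (int_lambda th (fun x => (`|v x| `^ p)%R)) Lgt => [L| |]//= _ _.
  by exists L.
move: Lgt; rewrite LE lte_fin => L0.
have Ll : L <= l by case: (av) => _ _ _; rewrite LE lee_fin.
have sg1 : 1 <= l / L by rewrite ler_pdivlMr// mul1r.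
have sg0 : 0 < l / L by rewrite (lt_le_trans ltr01).
pose s := (l / L) `^ (th + 1)^-1.
have s0 : 0 < s by exact: powR_gt0.
have sE : s `^ (th + 1) = l / L by exact: powR_root.
have av' : adm p th v g L by case: av => ? ? ? _; split => //; rewrite LE.
have aw := adm_shrink s0 av'; rewrite sE divfK ?gt_eqF// in aw.
have nzw := nonzero_shrink s0 nz.
exists (fun x => v (x / s)), g, l; split => //.
apply/eqP; rewrite eq_le; apply/andP; split.
  by rewrite -dE; exact: (adm_le_d_sup p2 th0 aw m0 nzw gl).
apply: (le_trans dN).
rewrite (int_lambda_shrink (F := fun x => Aabs p m (v x)) th s0); first last.
- by move=> x _; exact: Aabs_ge0.
- by apply: (adm_measurable_comp p2 av (phi := Aabs p m)); exact: continuous_Aabs.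
rewrite sE (int_Aabs_split p2 m0 av) LE.
have := adm_Rem_lty p2 th0 m0 mc av gl.
have : (0 <= int_lambda th (fun x => Rem p m (v x)))%E.
  by apply: int_lambda_ge0 => x _; exact: Rem_ge0.
case: (int_lambda th (fun x => Rem p m (v x))) => [I| |]//; rewrite lee_fin => I0 _.
rewrite -(EFinM (lead p m)) -!EFinD -(EFinM (l / L)) lee_fin mulrDr.
apply: lerD; last by rewrite ler_peMl.
rewrite mulrCA; apply: ler_wpM2l; first exact: lead_ge0.
by rewrite divfK// gt_eqF.
Qed.

End scaling_competitors.

(** * Extension by a plateau and a logarithmic ramp *)

Section capped_extension.
Context {R : realType}.
Variable p : R.
Hypothesis p1 : 1 < p.
Notation mu := (@lebesgue_measure R).
Let p0 : 0 < p. Proof. exact: lt_trans p1. Qed.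

(** Affine in ln x from 1 at z to 0 at 2 z: the descent of least energy between these
    points. *)
Definition log_ramp (z x : R) : R := Num.max 0 (ln (2 * z / x) / ln 2).

(** Used twice: with u = 1 it is a test function, and with u a maximizer it is the
    competitor that rules out a bounded support. *)
Definition capped (u : R -> R) (h x1 x0 x : R) : R :=
  if x <= x1 then u x else if x <= x0 then h else h * log_ramp x0 x.

Let ln20 : 0 < ln 2 :> R. Proof. by rewrite ln_gt0// ltr1n. Qed.

Lemma log_ramp_ge0 z x : 0 <= log_ramp z x.
Proof. by rewrite /log_ramp le_max lexx. Qed.

Lemma log_ramp_le1 z x : 0 < z -> z <= x -> log_ramp z x <= 1.
Proof.
move=> z0 zx; have x0 := lt_le_trans z0 zx.
rewrite /log_ramp ge_max ler01/= ler_pdivrMr// mul1r ler_ln ?posrE ?divr_gt0 ?mulr_gt0//.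
by rewrite ler_pdivrMr// ler_pM2l.
Qed.

Lemma log_rampE z x : 0 < z -> 0 < x -> x <= 2 * z -> log_ramp z x = (ln (2 * z) - ln x) / ln 2.
Proof.
move=> z0 x0 xz; have z20 : 0 < 2 * z by rewrite mulr_gt0.
rewrite /log_ramp ln_div ?posrE//; apply: max_r.
by rewrite divr_ge0 ?(ltW ln20)// subr_ge0 ler_ln ?posrE.
Qed.

Lemma log_ramp_out z x : 0 < z -> 2 * z <= x -> log_ramp z x = 0.
Proof.
move=> z0 zx; have z20 : 0 < 2 * z by rewrite mulr_gt0.
have x0 := lt_le_trans z20 zx.
rewrite /log_ramp ln_div ?posrE//; apply: max_l.
by rewrite pmulr_lle0 ?invr_gt0// subr_le0 ler_ln ?posrE.
Qed.

Lemma log_ramp1 z : 0 < z -> log_ramp z z = 1.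
Proof.
move=> z0; rewrite log_rampE//; last by lra.
by rewrite lnM ?posrE// addrK divff// gt_eqF.
Qed.

Lemma log_ramp_noninc z x y : 0 < z -> 0 < x -> x <= y -> log_ramp z y <= log_ramp z x.
Proof.
move=> z0 x0 xy; have y0 := lt_le_trans x0 xy.
rewrite /log_ramp ge_max le_max lexx/= le_max; apply/orP; right.
rewrite ler_pM2r ?invr_gt0// ler_ln ?posrE ?divr_gt0 ?mulr_gt0//.
by rewrite ler_pM2l ?mulr_gt0// lef_pV2 ?posrE.
Qed.

Variables (u : R -> R) (gd : R -> \bar R) (h x1 x0 : R).
Hypotheses (x1_gt0 : 0 < x1) (x10 : x1 <= x0) (h0 : 0 <= h) (uh : u x1 = h).
Let x0_gt0 : 0 < x0. Proof. exact: lt_le_trans x10. Qed.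
Let w := capped u h x1 x0.

Lemma capped_left x : x <= x1 -> w x = u x.
Proof. by rewrite /w /capped => ->. Qed.

Lemma capped_mid x : x1 <= x -> x <= x0 -> w x = h.
Proof.
rewrite /w /capped le_eqVlt => /predU1P[<-|xx1 xx0]; first by rewrite lexx.
by rewrite leNgt xx1/= xx0.
Qed.

Lemma capped_right x : x0 <= x -> w x = h * log_ramp x0 x.
Proof.
rewrite le_eqVlt => /predU1P[<-|xx0]; first by rewrite capped_mid// log_ramp1// mulr1.
by rewrite /w /capped !leNgt (le_lt_trans x10 xx0) xx0.
Qed.

Lemma capped_ge0 : (forall x, 0 < x -> 0 <= u x) -> forall x, 0 < x -> 0 <= w x.
Proof.
move=> u0 x x_gt0; rewrite /w /capped; case: ifP => _; first exact: u0.
by case: ifP => _ //; rewrite mulr_ge0// log_ramp_ge0.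
Qed.

Lemma capped_noninc : (forall x y, 0 < x -> x <= y -> u y <= u x) ->
  forall x y, 0 < x -> x <= y -> w y <= w x.
Proof.
move=> nu x y x_gt0 xy.
have [yx1|yx1] := leP y x1; first by rewrite !capped_left ?nu// (le_trans xy).
have wyh : w y <= h.
  have [yx0|yx0] := leP y x0; first by rewrite capped_mid// ltW.
  rewrite capped_right ?(ltW yx0)// ler_piMr// log_ramp_le1// ltW//.
have [xx1|xx1] := leP x x1.
  by apply: (le_trans wyh); rewrite capped_left// -uh nu.
have [xx0|xx0] := leP x x0; first by rewrite (capped_mid (ltW xx1) xx0).
rewrite !capped_right ?(ltW xx0) ?(le_trans (ltW xx0))//.
by rewrite ler_wpM2l// log_ramp_noninc.
Qed.

Hypothesis mgd : measurable_fun (`]0, +oo[ : set R) gd.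
Hypothesis gd0 : forall x : R, 0 < x -> (0 <= gd x)%E.
Hypothesis ugd : forall a b, 0 < a -> a < b -> b <= x1 ->
  ((seg p u a b)%:E <= \int[mu]_(x in `]a, b[) gd x)%E.

Let c := (h / ln 2) `^ p.
Let A : set R := `]0, x1[%classic.
Let B : set R := `]x0, 2 * x0[%classic.
Let inv (x : R) : \bar R := (c * x^-1)%:E.
Let rho x := ((gd \_ A) x + (inv \_ B) x)%E.

Let c0 : 0 <= c. Proof. exact: powR_ge0. Qed.
Let mA : measurable A. Proof. exact: measurable_itv. Qed.
Let mB : measurable B. Proof. exact: measurable_itv. Qed.
Let P : set R := `]0, +oo[%classic.
Let mP : measurable P. Proof. exact: measurable_itv. Qed.
Let AP : A `<=` P. Proof. by move=> x; rewrite /A /P/= !in_itv/= andbT => /andP[]. Qed.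
Let BP : B `<=` P.
Proof. by move=> x; rewrite /B /P/= !in_itv/= andbT => /andP[xx0 _]; exact: lt_trans xx0. Qed.

Let minv : measurable_fun P inv.
Proof.
apply/measurable_EFinP; apply: measurable_funM => //.
apply: continuous_measurable_pos => x xx; apply: inv_continuous; by rewrite gt_eqF.
Qed.

Let inv0 x : P x -> (0 <= inv x)%E.
Proof. by rewrite /P/= in_itv/= andbT => xx; rewrite lee_fin mulr_ge0// invr_ge0 ltW. Qed.

Let gdP x : P x -> (0 <= gd x)%E.
Proof. by rewrite /P/= in_itv/= andbT; exact: gd0. Qed.

Let patch_ge0 (f : R -> \bar R) (D : set R) x : D `<=` P -> (forall y, P y -> (0 <= f y)%E) ->
  (0 <= (f \_ D) x)%E.
Proof. by move=> DP f0; rewrite patchE; case: ifPn => // /[1!inE] /DP /f0. Qed.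

Let mrA : measurable_fun setT (gd \_ A).
Proof. by apply/(measurable_restrictT _ mA); exact: measurable_funS mgd. Qed.

Let mrB : measurable_fun setT (inv \_ B).
Proof. by apply/(measurable_restrictT _ mB); exact: measurable_funS minv. Qed.

Let mrho : measurable_fun P rho.
Proof. by apply: measurable_funTS; apply: emeasurable_funD. Qed.

Let rho0 x : 0 < x -> (0 <= rho x)%E.
Proof. by move=> _; apply: adde_ge0; exact: patch_ge0. Qed.

Let rho_ge_gd a b : 0 < a -> b <= x1 ->
  (\int[mu]_(x in `]a, b[) gd x <= \int[mu]_(x in `]a, b[) rho x)%E.
Proof.
move=> a0 bx1; have sab : `]a, b[ `<=` P.
  by move=> x; rewrite /P/= !in_itv/= andbT => /andP[ax _]; exact: lt_trans ax.
apply: ge0_le_integral => //.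
- by move=> x /sab; exact: gdP.
- exact: measurable_funS mgd.
- exact: measurable_funS mrho.
- move=> x xab; rewrite /rho [X in (X + _)%E]patchE mem_set.
    by rewrite leeDl// patch_ge0.
  by move: xab; rewrite /A/= !in_itv/= => /andP[ax xb]; rewrite (lt_trans a0 ax) (lt_le_trans xb).
Qed.

Let rho_ge_inv a b : x0 <= a -> b <= 2 * x0 ->
  (\int[mu]_(x in `]a, b[) inv x <= \int[mu]_(x in `]a, b[) rho x)%E.
Proof.
move=> a0 bx1; have sab : `]a, b[ `<=` P.
  move=> x; rewrite /P/= !in_itv/= andbT => /andP[ax _].
  exact: lt_trans (lt_le_trans x0_gt0 a0) ax.
apply: ge0_le_integral => //.
- by move=> x /sab; exact: inv0.
- exact: measurable_funS minv.
- exact: measurable_funS mrho.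
- move=> x xab; rewrite /rho [X in (_ + X)%E]patchE mem_set.
    by rewrite leeDr// patch_ge0.
  by move: xab; rewrite /B/= !in_itv/= => /andP[ax xb]; rewrite (le_lt_trans a0 ax) (lt_le_trans xb).
Qed.

Let int_inv a b : 0 < a -> a <= b -> (\int[mu]_(x in `]a, b[) inv x = (c * (ln b - ln a))%:E)%E.
Proof.
move=> a0 ab; have mab : measurable (`]a, b[%classic : set R) by exact: measurable_itv.
have sab : `]a, b[ `<=` P.
  by move=> x; rewrite /P/= !in_itv/= andbT => /andP[ax _]; exact: lt_trans ax.
have mi : measurable_fun (`]a, b[ : set R) (fun x => (x^-1)%:E).
  apply: (measurable_funS mP sab); apply/measurable_EFinP.
  by apply: continuous_measurable_pos => x xx; apply: inv_continuous; rewrite gt_eqF.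
have i0 x : (`]a, b[%classic : set R) x -> (0 <= (x^-1)%:E)%E.
  by move=> /sab; rewrite /P/= in_itv/= andbT => xx; rewrite lee_fin invr_ge0 ltW.
have c0' : (0 <= c%:E)%E by rewrite lee_fin.
have E := @ge0_integralZl _ _ R mu _ mab _ mi _ i0 c0'.
by apply: (etrans E); rewrite integral_inv.
Qed.

Let rho_int0 a b : 0 < a -> (0 <= \int[mu]_(x in `]a, b[) rho x)%E.
Proof.
move=> a0; apply: integral_ge0 => x /=; rewrite in_itv/= => /andP[ax _].
by apply: rho0; exact: lt_trans ax.
Qed.

Let seg_cst a b : 0 < a -> w a = w b -> ((seg p w a b)%:E <= \int[mu]_(x in `]a, b[) rho x)%E.
Proof.
by move=> a0 E; rewrite /seg E subrr normr0 powR0 ?gt_eqF// mul0r; exact: rho_int0.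
Qed.

Lemma capped_dominated a b : 0 < a -> a < b ->
  ((seg p w a b)%:E <= \int[mu]_(x in `]a, b[) rho x)%E.
Proof.
have z0 : 0 < 2 * x0 by rewrite mulr_gt0.
move=> a0; apply: (seg_glue p1 mrho rho0 x1_gt0) (a0) (ltW a0).
  move=> {}a {}b {}a0 _ ab bx; apply: le_trans (rho_ge_gd a0 bx).
  rewrite /seg !capped_left ?(le_trans (ltW ab))//.
  exact: ugd.
apply: (seg_glue p1 mrho rho0 x0_gt0).
  move=> {}a {}b {}a0 xa ab bx; apply: seg_cst => //.
  by rewrite !capped_mid// ?(le_trans (ltW ab))// (le_trans xa (ltW ab)).
apply: (seg_glue p1 mrho rho0 z0) => {}a {}b {}a0 xa ab; last first.
  have xz : x0 <= 2 * x0 by lra.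
  have xb := le_trans xa (ltW ab).
  by apply: seg_cst => //; rewrite !capped_right ?(le_trans xz)// !log_ramp_out.
move=> bz; apply: le_trans (rho_ge_inv xa bz); rewrite int_inv ?(ltW ab)// lee_fin.
have b0 := lt_trans a0 ab.
rewrite /seg !capped_right ?(le_trans xa (ltW ab))// !log_rampE// ?(le_trans (ltW ab))//.
have lba : 0 < ln (b / a) by rewrite ln_gt0// ltr_pdivlMr// mul1r.
have -> : ln b - ln a = ln (b / a) by rewrite ln_div ?posrE.
have -> : h * ((ln (2 * x0) - ln b) / ln 2) - h * ((ln (2 * x0) - ln a) / ln 2) =
    - (h / ln 2 * ln (b / a)).
  by rewrite ln_div ?posrE//; field; rewrite gt_eqF.
have hl : 0 <= h / ln 2 by rewrite divr_ge0// ltW.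
rewrite normrN ger0_norm; last by rewrite mulr_ge0// ltW.
rewrite powRM ?(ltW lba)// -/c.
have -> : ln (b / a) `^ p = ln (b / a) * ln (b / a) `^ (p - 1).
  rewrite -{2}(powRr1 (ltW lba)) -powRD; first by congr (_ `^ _); ring.
  by apply/implyP => _; rewrite gt_eqF.
by rewrite mulrA mulfK// gt_eqF// powR_gt0.
Qed.

(** The energy of the plateau is 0 and that of the ramp is h^p / ln(2)^(p-1), wherever x0
    is. *)
Lemma capped_energy (k : R) : (\int[mu]_(x in `]0%R, x1[) gd x <= k%:E)%E ->
  energy_le p w (k + h `^ p / ln 2 `^ (p - 1)).
Proof.
move=> gk; apply: (dominated_energy p1 mrho rho0 capped_dominated).
have pA x : P x -> (0 <= (gd \_ A) x)%E by move=> _; exact: patch_ge0.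
have pB x : P x -> (0 <= (inv \_ B) x)%E by move=> _; exact: patch_ge0.
have E := @ge0_integralD _ _ R mu _ mP _ _ pA (measurable_funTS mrA) pB (measurable_funTS mrB).
apply: (le_trans (eq_ind _ (fun z => (z <= _)%E) (lexx _) _ (esym E))).
rewrite EFinD; apply: leeD.
  by rewrite -integral_mkcondr setIidr.
have xz : x0 <= 2 * x0 by move: x0_gt0 => ?; lra.
rewrite -integral_mkcondr setIidr// (int_inv x0_gt0 xz).
rewrite lnM ?posrE// addrK lee_fin le_eqVlt; apply/orP; left; apply/eqP.
rewrite /c powRM ?invr_ge0 ?(ltW ln20)// powR_inv_base ?(ltW ln20)//.
have -> : ln 2 `^ p = ln 2 * ln 2 `^ (p - 1) :> R.
  rewrite -{2}(powRr1 (ltW ln20)) -powRD; first by congr (_ `^ _); ring.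
  by apply/implyP => _; rewrite gt_eqF.
by field; rewrite !gt_eqF// powR_gt0.
Qed.

End capped_extension.

(** * The strict inequality *)

Section test_function.
Context {R : realType}.
Variables p th m : R.
Hypotheses (p2 : 2 <= p) (th0 : 0 <= th) (m0 : 0 < m).
Notation mu := (@lebesgue_measure R).
Notation W := (omega (p - 1)).
Notation r := (remexp p).
Let p1 : 1 < p. Proof. by rewrite (lt_le_trans _ p2)// ltr1n. Qed.
Let p0 : 0 < p. Proof. exact: lt_trans p1. Qed.
Let W0 : 0 < W. Proof. exact: omega_pm1_gt0. Qed.

Lemma measurable_step (z c : R) : measurable_fun (`]0, +oo[ : set R) (fun x => if x < z then c else 0).
Proof. by apply: measurable_funTS; apply: measurable_fun_if => //; exact: measurable_fun_ltr. Qed.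

Lemma int_lambda_step (z c : R) : 0 < z -> 0 <= c ->
  int_lambda th (fun x => if x < z then c else 0) = (c * Lam th z)%:E.
Proof.
move=> z0 c0; rewrite /int_lambda (ge0_integral_split z0); last 2 first.
- by apply: measurable_lambda; exact: measurable_step.
- move=> x x0; rewrite lee_fin; apply: mulr_ge0; first by case: ifP.
  by apply: mulr_ge0; [exact: omega_ge0|exact: powR_ge0].
have I2 : (\int[mu]_(x in `]z, +oo[) ((if (x < z)%R then c else 0%R) * (omega th * x `^ th))%:E = 0)%E.
  apply: integral0_eq => x /=; rewrite in_itv/= andbT => zx.
  by rewrite ltNge (ltW zx)/= mul0r.
rewrite I2 adde0 EFinM -(wlam_0s th0 z0) wlamE; last first.
  by move=> x /=; rewrite !in_itv/= andbT => /andP[].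
have mD : measurable (`]0, z[%classic : set R) by exact: measurable_itv.
have mw : measurable_fun (`]0, z[ : set R) (fun y => (omega th * y `^ th)%:E).
  apply/measurable_EFinP; apply: measurable_funM => //.
  by apply: measurable_funTS; exact: measurable_powR.
have w0 y : (`]0, z[%classic : set R) y -> (0 <= (omega th * y `^ th)%:E)%E.
  by move=> _; rewrite lee_fin; apply: mulr_ge0; [exact: omega_ge0|exact: powR_ge0].
have c0' : (0 <= c%:E)%E by rewrite lee_fin.
have E := @ge0_integralZl _ _ R mu _ mD _ mw _ w0 c0'.
apply: (etrans _ E); apply: eq_integral => x; rewrite inE/= in_itv/= => /andP[_ xz].
by rewrite xz EFinM.
Qed.

Lemma adm_powR_gt0 v g l s : 0 < s -> adm p th v g l -> nonzero v ->
  exists2 M : R, 0 < M & (M%:E <= int_lambda th (fun x => (`|v x| `^ s)%R))%E.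
Proof.
move=> s0 av [x x0 vx]; case: (av) => v0 nv ev Lv.
have vx0 : 0 < v x by rewrite lt_neqAle eq_sym vx v0.
exists (v x `^ s * Lam th x); first by rewrite mulr_gt0 ?powR_gt0 ?Lam_gt0.
apply: int_lambda_ge_cst => //.
- apply: (adm_measurable_comp p2 av (phi := fun y => `|y| `^ s)).
  exact: continuous_norm_powR.
- exact: powR_ge0.
- move=> y y0 yx; rewrite ger0_norm ?v0//.
  by apply: ge0_ler_powR; rewrite ?nnegrE ?v0 ?(ltW s0)// nv// ltW.
Qed.

(** The plateau 1 followed by the ramp from 1 to 2 serves as a test function. *)
Lemma capped_one_adm : exists v g l, adm p th v g l /\ nonzero v.
Proof.
pose v := capped (fun=> 1 : R) 1 1 1.
have v0 : forall x, 0 < x -> 0 <= v x by exact: capped_ge0.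
have nv : forall x y, 0 < x -> x <= y -> v y <= v x by exact: capped_noninc.
have ev : energy_le p v (0 + 1 `^ p / ln 2 `^ (p - 1)).
  apply: (capped_energy p1 ltr01 (lexx 1) ler01 erefl (gd := fun=> 0%E)) => //.
  - move=> a b a0 ab b1; rewrite /seg subrr normr0 powR0 ?gt_eqF// mul0r.
    exact: integral_ge0.
  - by rewrite integral0.
exists v, (0 + 1 `^ p / ln 2 `^ (p - 1)), (1 * Lam th 2); split; last first.
  by exists 1 => //; rewrite /v /capped lexx oner_neq0.
split => //; rewrite -int_lambda_step//; apply: int_lambda_le.
- apply: (@measurableT_comp _ _ _ _ _ _ (fun y : R => `|y| `^ p)).
    by apply: continuous_measurable_fun; exact: continuous_norm_powR.
  by apply: continuous_measurable_pos; exact: (energy_continuous p1 ev).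
- exact: measurable_step.
- by move=> x _; exact: powR_ge0.
- move=> x x0; case: ltP => [_|x2].
    rewrite ger0_norm ?v0//.
    apply: (@le_trans _ _ (1 `^ p)); last by rewrite powR1.
    apply: ge0_ler_powR; rewrite ?nnegrE ?(ltW p0) ?v0//.
    have [x1|x1] := leP x 1; first by rewrite /v capped_left.
    have -> : v x = 1 * log_ramp 1 x by apply: capped_right => //; exact: ltW.
    by rewrite mul1r; apply: log_ramp_le1 => //; exact: ltW.
  have x1 : 1 <= x by rewrite (le_trans _ x2)// ler1n.
  have -> : v x = 1 * log_ramp 1 x by exact: capped_right.
  by rewrite log_ramp_out ?mulr1// mulr0 normr0 powR0// gt_eqF.
Qed.

End test_function.

Section strict_gap.
Context {R : realType}.

(** If c vanishes any small t works; otherwise A t^s beats the loss c K t as s < 1. *)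
Lemma gap_sublinear (K c A s : R) : 0 <= K -> 0 <= c -> 0 < A -> c = 0 \/ s < 1 ->
  exists t, [/\ 0 < t, t * K < 1 & c < (1 - t * K) * (c + A * t `^ s)].
Proof.
move=> K0 c0 A0 cs.
pose t1 := (2 * (K + 1))^-1; have t10 : 0 < t1 by rewrite invr_gt0; lra.
have small t : 0 < t -> t <= t1 -> t * K <= 2^-1.
  move=> t0 tt; apply: (@le_trans _ _ (t1 * K)); first by rewrite ler_wpM2r.
  by rewrite /t1 invfM -mulrA ler_piMr// mulrC ler_pdivrMr; lra.
have half : 2^-1 < 1 :> R by lra.
case: cs => [->|s1].
  exists t1; have h := small t1 t10 (lexx _); split => //; first exact: le_lt_trans half.
  by rewrite add0r mulr_gt0 ?subr_gt0 ?(le_lt_trans h)// mulr_gt0// powR_gt0.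
have cK0 : 0 <= c * K by rewrite mulr_ge0.
have d0 : 0 < 2 * (c * K + 1) by lra.
(* At t0 the loss c K t is at most half of A t^s; t1 keeps 1 - t K above one half. *)
pose t0 := (A / (2 * (c * K + 1))) `^ (1 - s)^-1.
have t00 : 0 < t0 by rewrite powR_gt0// divr_gt0.
pose t := Num.min t0 t1.
have tpos : 0 < t by rewrite lt_min t00.
have h : t * K <= 2^-1 by apply: small => //; rewrite ge_min lexx orbT.
exists t; split => //; first exact: le_lt_trans half.
have s10 : 0 < 1 - s by rewrite subr_gt0.
have ts : t `^ (1 - s) <= A / (2 * (c * K + 1)).
  apply: (@le_trans _ _ (t0 `^ (1 - s))).
    by apply: ge0_ler_powR; rewrite ?nnegrE ?(ltW s10) ?(ltW tpos) ?(ltW t00)// ge_min lexx.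
  by rewrite /t0 -powRrM mulVf ?gt_eqF// powRr1// ltW// divr_gt0.
have T0 : 0 < t `^ s by exact: powR_gt0.
have tE : t = t `^ (1 - s) * t `^ s.
  rewrite -powRD; first by rewrite subrK powRr1// ltW.
  by apply/implyP => _; rewrite gt_eqF.
have cKt : c * K * t < A / 2 * t `^ s.
  rewrite {1}tE mulrA ltr_pM2r//; apply: (@le_lt_trans _ _ (c * K * (A / (2 * (c * K + 1))))).
    by rewrite ler_wpM2l.
  rewrite mulrA ltr_pdivrMr//.
  have -> : A / 2 * (2 * (c * K + 1)) = A * (c * K + 1) by field.
  by rewrite mulrC ltr_pM2l//; lra.
have AT : 0 < A * t `^ s by rewrite mulr_gt0.
have : 2^-1 * (A * t `^ s) <= (1 - t * K) * (A * t `^ s) by rewrite ler_wpM2r ?(ltW AT)//; lra.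
move: cKt; rewrite mulrDr; lra.
Qed.

(** The first-order coefficient in t is A - c K. *)
Lemma gap_linear (K c A : R) : 0 <= K -> 0 < A -> c * K < A ->
  exists t, [/\ 0 < t, t * K < 1 & c < (1 - t * K) * (c + A * t)].
Proof.
move=> K0 A0 cK.
pose D := K * A + K + 1.
have KA0 : 0 <= K * A by rewrite mulr_ge0// ltW.
have D0 : 0 < D by rewrite /D; lra.
pose e := Num.min 1 (A - c * K).
have e0 : 0 < e by rewrite lt_min ltr01 subr_gt0.
have e1 : e <= 1 by rewrite ge_min lexx.
have eA : e <= A - c * K by rewrite ge_min lexx orbT.
pose t := e / D / 2; have t0 : 0 < t by rewrite !divr_gt0.
have tD : t * D = e / 2 by rewrite /t; field; rewrite gt_eqF.
have tK : t * K <= e / 2 by rewrite -tD ler_pM2l// /D; lra.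
have tKA : t * (K * A) <= e / 2 by rewrite -tD ler_pM2l// /D; lra.
exists t; split => //; first by lra.
have -> : (1 - t * K) * (c + A * t) = c + t * (A - c * K - t * (K * A)) by ring.
by rewrite ltrDl mulr_gt0//; lra.
Qed.

Variables p th m : R.
Hypotheses (p2 : 2 <= p) (th0 : 0 <= th) (m0 : 0 < m).
Notation W := (omega (p - 1)).
Notation r := (remexp p).
Let p1 : 1 < p. Proof. by rewrite (lt_le_trans _ p2)// ltr1n. Qed.
Let p0 : 0 < p. Proof. exact: lt_trans p1. Qed.
Let W0 : 0 < W. Proof. exact: omega_pm1_gt0. Qed.

Lemma adm_exact v g l : adm p th v g l -> nonzero v ->
  exists L : R, [/\ 0 < L, int_lambda th (fun x => `|v x| `^ p) = L%:E & adm p th v g L].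
Proof.
move=> av nz; have := adm_Lp_gt0 p2 th0 av nz; case: av => v0 nv ev.
case E : (int_lambda th (fun x => (`|v x| `^ p)%R)) => [L| |]//= _.
by rewrite lte_fin => L0; exists L; split => //; split => //; rewrite E.
Qed.

Lemma rem_coef_gt0 : 0 < m ^+ remord p / (remord p)`!%:R :> R.
Proof. by rewrite divr_gt0 ?exprn_gt0// ltr0n fact_gt0. Qed.

Lemma lead_lt_d_sup : 3 <= p -> ((lead p m)%:E < d_sup p th (p - 1) m)%E.
Proof.
move=> p3; have [v [g [l [av nz]]]] := capped_one_adm p2 th0.
have [L [L0 LE {}av]] := adm_exact av nz.
have r0 : 0 < r by apply: lt_trans (remexp_gt p2).
have [M M0 ME] := adm_powR_gt0 p2 th0 r0 av nz.
have [g0 _] := adm_ge0 p2 th0 av.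
have A0 : 0 < m ^+ remord p / (remord p)`!%:R * M / L.
  by rewrite divr_gt0// mulr_gt0// rem_coef_gt0.
have K0 : 0 <= W * g by rewrite mulr_ge0// ltW.
have cs : lead p m = 0 \/ r / p - 1 < 1.
  rewrite /lead; case: eqP => [pE|]; [right|by left].
  by rewrite ltrBlDr ltr_pdivrMr// -[1 + 1]/(2 : R) remexp_lt//; lra.
have [t [t0 tK ct]] := gap_sublinear K0 (lead_ge0 p m0) A0 cs.
apply: lt_le_trans (dilation_gap p2 th0 m0 av LE nz L0 ME t0 tK).
by rewrite lte_fin.
Qed.

End strict_gap.

Section quadratic_case.
Context {R : realType}.

Lemma norm_L_expe n b (u : R -> R) : (0 < n)%N ->
  (norm_L n%:R b u ^+ n = int_lambda b (fun x => (`|u x| `^ n%:R)%R))%E.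
Proof.
case: n => // n _; rewrite /norm_L.
have I0 : (0 <= int_lambda b (fun x => (`|u x| `^ n.+1%:R)%R))%E.
  by apply: int_lambda_ge0 => x _; exact: powR_ge0.
move: (int_lambda b (fun x => (`|u x| `^ n.+1%:R)%R)) I0 => [y| |]//.
  rewrite lee_fin => y0; rewrite poweR_EFin -EFin_expe -powR_mulrn ?powR_ge0//.
  by rewrite -powRrM mulVf// powRr1.
move=> _; rewrite poweRyr ?invr_eq0//; elim: n => // n IH.
by rewrite expeS IH mulyy.
Qed.

Lemma level2 : level (2 : R) = 1%N.
Proof.
have [l0 l2 _] := level_bounds (lexx (2 : R)).
by apply/eqP; rewrite eqn_leq l0 andbT -ltnS -(ltr_nat R).
Qed.

Lemma remord2 : remord (2 : R) = 2%N.
Proof. by rewrite /remord level2 eqxx. Qed.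

Lemma lead2 (m : R) : lead 2 m = m.
Proof. by rewrite /lead level2 eqxx factS fact0 muln1 expr1 divr1. Qed.

Lemma remexp2 : remexp 2 = 4 :> R.
Proof. by rewrite /remexp remord2 /conj_exp; field. Qed.

(** As B(2,th) is the inverse of an infimum, the hypothesis says that some quotient is
    below m / 2. *)
Lemma B2_witness (th m : R) : (2%:E / B2 th < m%:E)%E ->
  exists2 u, in_W_neq0 2 1 th u &
   (norm_L 2 1 (derive1 u) ^+ 2 * norm_L 2 th u ^+ 2 / norm_L 4 th u ^+ 4 < (m / 2)%:E)%E.
Proof.
rewrite /B2 inveK => H; apply: contrapT => nu.
have : ((m / 2)%:E <= ereal_inf [set (norm_L 2 1 (derive1 u) ^+ 2 * norm_L 2 th u ^+ 2
   / norm_L 4 th u ^+ 4)%E | u in [set u | in_W_neq0 2 1 th u]])%E.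
  apply: le_ereal_inf_tmp => _ [u uW <-]; rewrite leNgt; apply/negP => uq.
  by apply: nu; exists u.
have two0 : (0 <= 2%:E :> \bar R)%E by rewrite lee_fin.
move=> /(lee_wpmul2l two0); apply/negP; rewrite -ltNge; apply: (lt_le_trans H).
by rewrite -EFinM lee_fin mulrC divfK.
Qed.

Variables th m : R.
Hypotheses (th0 : 0 <= th) (m0 : 0 < m).
Notation W := (omega (2 - 1 : R)).
Let p2 : (2 : R) <= 2. Proof. by []. Qed.
Let p1 : (1 : R) < 2. Proof. by rewrite ltr1n. Qed.
Let W0 : 0 < W. Proof. exact: omega_pm1_gt0. Qed.

(** With lead = m and R starting with m^2 t^4 / 2, the condition of gap_linear reads W g L
    < (m / 2) M, where M is the integral of w^4 for the rearranged w: the quotient of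
    B2_witness is below m / 2, since the normalization cancels in it. *)
Lemma lead_lt_d_sup2 : (2%:E / B2 th < m%:E)%E ->
  ((lead 2 m)%:E < d_sup 2 th (2 - 1) m)%E.
Proof.
move=> /B2_witness [u uW1 uq].
have e21 : 2 - 1 = 1 :> R by ring.
have uW : in_W_neq0 2 (2 - 1) th u by rewrite e21.
have [N [K [L [w [[N0 NE KE LE WKL] [aw nzw equi]]]]]] := rearr_adm p2 th0 uW.
have [[_ [muu _] [mu' _] _] _] := uW.
have {}uq : (norm_L 2 (2 - 1) (derive1 u) ^+ 2 * norm_L 2 th u ^+ 2 / norm_L 4 th u ^+ 4
    < (m / 2)%:E)%E by rewrite e21.
have n2 : (norm_L 2 (2 - 1) (derive1 u) ^+ 2 = (W * K)%:E)%E.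
  apply: (etrans (@norm_L_expe 2 (2 - 1) _ isT)); apply: (etrans (@int_lambda_grad R 2 u mu')).
  by rewrite KE.
have n2' : (norm_L 2 th u ^+ 2 = L%:E)%E by apply: (etrans (@norm_L_expe 2 th u isT)).
have n4 : (norm_L 4 th u ^+ 4 = int_lambda th (fun x => (`|u x| `^ 4)%R))%E.
  exact: (@norm_L_expe 4 th u isT).
move: uq; rewrite n2 n2' n4 -(EFinM (W * K) L) => uq.
have Np : 0 < N `^ 2 by exact: powR_gt0.
have gen f : 0 < f -> f = 2 + 2 ->
    ((W * K * L)%:E / int_lambda th (fun x => (`|u x| `^ f)%R) < (m / 2)%:E)%E ->
    exists2 M : R, (M%:E <= int_lambda th (fun x => (`|w x| `^ f)%R))%E &
      (W * (K / N `^ 2)) * (L / N `^ 2) < m / 2 * M.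
  move=> {uq} four0 fE uq.
  have I4 : (int_lambda th (fun x => (`|w x| `^ f)%R) =
     (N^-1 `^ f)%:E * int_lambda th (fun x => (`|u x| `^ f)%R))%E.
    have c1 : continuous (fun y : R => `|y| `^ f) by exact: continuous_norm_powR.
    have c2 : `|0 : R| `^ f = 0 by rewrite normr0 powR0// gt_eqF.
    have c3 (x y : R) : 0 <= x -> x <= y -> `|x| `^ f <= `|y| `^ f.
      move=> x0 xy; rewrite !ger0_norm ?(le_trans x0)//.
      by apply: ge0_ler_powR; rewrite ?nnegrE ?(ltW four0)// (le_trans x0).
    have E := equi (fun y => `|y| `^ f) c1 c2 c3; apply: (etrans E).
    rewrite -int_lambdaZ.
    - apply: eq_int_lambda => x _; rewrite ger0_norm; last by rewrite divr_ge0// ltW.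
      by rewrite mulrC powRM// invr_ge0 ltW.
    - exact: powR_ge0.
    - apply: (@measurableT_comp _ _ _ _ _ _ (fun y : R => `|y| `^ f)) => //.
      exact: continuous_measurable_fun.
    - by move=> x _; exact: powR_ge0.
  have [M0 M00 M0E] := adm_powR_gt0 p2 th0 four0 aw nzw.
    have Ni : 0 < N^-1 `^ f by rewrite powR_gt0// invr_gt0.
    have NiE : N^-1 `^ f = (N `^ 2)^-1 * (N `^ 2)^-1.
      rewrite powR_inv_base ?(ltW N0)// -invfM -powRD; last by apply/implyP => _; rewrite gt_eqF.
      by rewrite fE.
    move: uq M0E; rewrite I4.
    have : (0 <= int_lambda th (fun x => (`|u x| `^ f)%R))%E.
      by apply: int_lambda_ge0 => x _; exact: powR_ge0.
    case: (int_lambda th (fun x => (`|u x| `^ f)%R)) => [y| |]//.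
      rewrite lee_fin -EFinM lee_fin => y0 uq M0y.
      have y1 : 0 < y by rewrite -(pmulr_rgt0 _ Ni) (lt_le_trans M00).
      move: uq; rewrite inver gt_eqF// -EFinM lte_fin ltr_pdivrMr// => uq.
      exists (N^-1 `^ f * y); first exact: lexx.
      rewrite NiE; apply: (@le_lt_trans _ _ ((N `^ 2)^-1 * (N `^ 2)^-1 * (W * K * L))).
        by rewrite le_eqVlt; apply/orP; left; apply/eqP; ring.
      by rewrite -NiE [m / 2 * _]mulrCA ltr_pM2l.
    (* The fourth moment may be infinite; any large enough M then serves. *)
    move=> _ _ _; rewrite gt0_muley ?lte_fin//.
    exists (2 / m * (W * (K / N `^ 2) * (L / N `^ 2) + 1)); first by rewrite leey.
    move: (_ * _ * (L / N `^ 2)) => Y.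
    have -> : m / 2 * (2 / m * (Y + 1)) = Y + 1 by field; rewrite gt_eqF.
    by rewrite ltrDl.
have [M ME gLM] := gen 4 ltac:(by []) ltac:(by ring) uq.
have [L' [L'0 L'E aw']] := adm_exact p2 th0 aw nzw.
have L'L : L' <= L / N `^ 2 by case: (aw) => _ _ _; rewrite L'E lee_fin.
have [g0 _] := adm_ge0 p2 th0 aw.
have K0 : 0 <= W * (K / N `^ 2) by rewrite mulr_ge0// ltW.
have gLM' : W * (K / N `^ 2) * L' < m / 2 * M.
  by apply: le_lt_trans gLM; rewrite ler_wpM2l.
have Mpos : 0 < M.
  have : 0 < m / 2 * M by apply: le_lt_trans gLM'; rewrite mulr_ge0// ltW.
  by rewrite pmulr_rgt0// divr_gt0.
have coefE : m ^+ remord (2 : R) / (remord (2 : R))`!%:R = m * (m / 2).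
  by rewrite remord2 expr2 mulrA.
have A0 : 0 < m ^+ remord (2 : R) / (remord (2 : R))`!%:R * M / L'.
  by rewrite coefE !mulr_gt0 ?invr_gt0.
have cK : lead 2 m * (W * (K / N `^ 2)) < m ^+ remord (2 : R) / (remord (2 : R))`!%:R * M / L'.
  rewrite lead2 coefE ltr_pdivlMr//.
  have : m * (W * (K / N `^ 2) * L') < m * (m / 2 * M) by rewrite ltr_pM2l.
  by rewrite !mulrA.
have [t [t0 tK ct]] := gap_linear K0 A0 cK.
have ME' : (M%:E <= int_lambda th (fun x => (`|w x| `^ remexp 2)%R))%E by rewrite remexp2.
apply: lt_le_trans (dilation_gap p2 th0 m0 aw' L'E nzw L'0 ME' t0 tK).
rewrite lte_fin remexp2 (_ : 4 / 2 - 1 = 1) ?powRr1 ?(ltW t0)//.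
by field.
Qed.

End quadratic_case.

(** * Properties of the maximizers *)

Section maximizer_properties.
Context {R : realType}.
Variables p th m d : R.
Hypotheses (p2 : 2 <= p) (th0 : 0 <= th) (m0 : 0 < m).
Hypotheses (dE : d_sup p th (p - 1) m = d%:E) (d0 : 0 < d).
Notation mu := (@lebesgue_measure R).
Notation W := (omega (p - 1)).
Let p1 : 1 < p. Proof. by rewrite (lt_le_trans _ p2)// ltr1n. Qed.
Let p0 : 0 < p. Proof. exact: lt_trans p1. Qed.
Let pm0 : 0 < p - 1. Proof. by rewrite subr_gt0. Qed.
Let W0 : 0 < W. Proof. exact: omega_pm1_gt0. Qed.
Let ln20 : 0 < ln 2 :> R. Proof. by rewrite ln_gt0// ltr1n. Qed.

(** The exact energy and mass of a maximizer also use up the whole constraint, by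
    adm_strict. *)
Lemma maximizer_saturates v g l : adm p th v g l -> nonzero v -> W * g + l <= 1 ->
  int_lambda th (fun x => Aabs p m (v x)) = d%:E ->
  exists K L : R, [/\ adm p th v K L, W * K + L = 1,
    (\int[mu]_(x in `]0%R, +oo[) grad_density p v x)%E = K%:E &
    norm_W p (p - 1) th v = 1%E].
Proof.
move=> av nz gl Nd; have vW := adm_in_W p2 th0 av.
have [K [L [KE LE K0 L0 NE]]] := in_W_energy p2 vW.
have [v0 nv ev Lv] := av.
have aKL : adm p th v K L.
  split => //; last by rewrite LE.
  case: vW => acv _ [mv' _] _; apply: W_energy => //.
  by rewrite KE.
have KL1 : W * K + L <= 1.
  have Kg : K <= g by rewrite -lee_fin -KE; exact: (energy_grad_le p1 ev).
  have Ll : L <= l by rewrite -lee_fin -LE.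
  by apply: le_trans gl; rewrite lerD// ler_pM2l.
have KL : W * K + L = 1.
  apply/eqP; rewrite eq_le KL1/= leNgt; apply/negP => H.
  by have := adm_strict p2 th0 m0 dE d0 aKL nz H; rewrite Nd ltxx.
by exists K, L; split => //; rewrite NE KL powR1.
Qed.

Lemma support_end v g l z : adm p th v g l -> nonzero v -> 0 < z -> v z = 0 ->
  exists x0, [/\ 0 < x0, forall x, 0 < x -> x < x0 -> 0 < v x & forall x, x0 <= x -> v x = 0].
Proof.
move=> av [y y0 vy] z0 vz; have [v0 nv ev Lv] := av.
have vy0 : 0 < v y by rewrite lt_neqAle eq_sym vy v0.
pose S := [set x | 0 < x /\ 0 < v x].
have Sy : S y by [].
have ubS : has_ubound S.
  exists z => x [x0 vx]; rewrite leNgt; apply/negP => zx.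
  by have := nv z x z0 (ltW zx); rewrite vz leNgt vx.
have x0y : y <= sup S by exact: ub_le_sup.
have x00 : 0 < sup S by exact: lt_le_trans x0y.
have after x : sup S < x -> v x = 0.
  move=> Sx; have x_gt0 := lt_trans x00 Sx.
  apply/eqP; rewrite eq_le v0// andbT leNgt; apply/negP => vx.
  have : x <= sup S by apply: ub_le_sup.
  by rewrite leNgt Sx.
exists (sup S); split => // [x x_gt0 xS|x].
  have [s [s0 vs] xs] : exists2 s, S s & x < s by apply: sup_gt => //; exists y.
  by apply: lt_le_trans vs _; apply: nv => //; exact: ltW.
rewrite le_eqVlt => /predU1P[<-|]; last exact: after.
apply/eqP; rewrite eq_le v0// andbT leNgt; apply/negP => vS.
move/cvgrPdist_lt : (adm_continuous p2 av x00) => /(_ _ vS) /nbhs_ballP[e /= e0 He].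
have e2 : 0 < e / 2 by rewrite divr_gt0.
have E : v (sup S + e / 2) = 0 by apply: after; rewrite ltrDl.
have : ball (sup S) e (sup S + e / 2).
  by rewrite /ball/= opprD addrA subrr sub0r normrN gtr0_norm//; lra.
by move=> /He; rewrite E subr0 gtr0_norm// ltxx.
Qed.

(** Otherwise the profile comes down to 0 at some x0. Replacing its part after x1 < x0 by
    a plateau and a ramp saves at least h^p / ln(x0/x1)^(p-1) of energy and costs h^p
    times a constant independent of x1, in energy and in mass. With x1 close to x0 part of
    the constraint is released, while the function is lowered nowhere: this contradicts
    adm_strict. *)
Lemma maximizer_positive v K L : adm p th v K L -> nonzero v -> W * K + L = 1 ->
  (\int[mu]_(x in `]0%R, +oo[) grad_density p v x)%E = K%:E ->
  int_lambda th (fun x => Aabs p m (v x)) = d%:E ->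
  forall x, 0 < x -> 0 < v x.
Proof.
move=> av nz KL KE Nd z z0; have [v0 nv ev Lv] := av.
rewrite lt_neqAle v0// andbT; apply/negP => /eqP/esym vz.
have [x0 [x00 before after]] := support_end av nz z0 vz.
(* C bounds the cost of the ramp and of the plateau per unit of h^p, counted as energy,
   with a margin of 1; the saving is h^p C once the logarithmic length T of the descent
   satisfies T^(p-1) = 1 / C. *)
pose C := (ln 2 `^ (p - 1))^-1 + Lam th (2 * x0) / W + 1.
have z20 : 0 < 2 * x0 by rewrite mulr_gt0.
have LamC : 0 < Lam th (2 * x0) / W by rewrite divr_gt0// Lam_gt0.
have l2C : 0 < (ln 2 `^ (p - 1))^-1 :> R by rewrite invr_gt0 powR_gt0.
have C0 : 0 < C by rewrite /C; lra.
pose T := C^-1 `^ (p - 1)^-1.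
have T0 : 0 < T by rewrite powR_gt0// invr_gt0.
have TE : T `^ (p - 1) = C^-1.
  by rewrite /T -powRrM mulVf ?gt_eqF// powRr1// invr_ge0 ltW.
pose x1 := x0 * expR (- T).
have x10 : 0 < x1 by rewrite mulr_gt0 ?expR_gt0.
have x1x0 : x1 < x0 by rewrite /x1 gtr_pMr// -expR0 ltr_expR oppr_lt0.
have lnT : ln (x0 / x1) = T.
  rewrite /x1 invfM mulrA divff ?gt_eqF// mul1r -expRN opprK expRK//.
pose h := v x1; have h0 : 0 < h by exact: before.
have hp : 0 < h `^ p by exact: powR_gt0.
have [_ _ [mv' _] _] := adm_in_W p2 th0 av.
have [acv _ _ _] := adm_in_W p2 th0 av.
have mg := measurable_grad_density p mv'.
have g0 (x : R) : 0 < x -> (0 <= grad_density p v x)%E by move=> _; exact: grad_density_ge0.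
have kE : (\int[mu]_(x in `]0%R, x1[) grad_density p v x <= (K - h `^ p * C)%:E)%E.
  have S : ((h `^ p * C)%:E <= \int[mu]_(x in `]x1, +oo[) grad_density p v x)%E.
    have s1 : `]x1, x0[ `<=` (`]x1, +oo[ : set R) by move=> x /=; rewrite !in_itv/= andbT => /andP[].
    apply: (@le_trans _ _ (\int[mu]_(x in `]x1, x0[) grad_density p v x)%E); last first.
      apply: ge0_subset_integral => //.
        by apply: measurable_funS mg => // x /=; rewrite !in_itv/= !andbT; exact: lt_trans.
      by move=> x _; exact: grad_density_ge0.
    have := seg_le_grad p1 acv mv' x10 (ltW x1x0); rewrite /seg lnT TE (after x0)// sub0r normrN.
    by rewrite (ger0_norm (v0 _ x10)) invrK.
  have := ge0_integral_split x10 mg g0; rewrite KE.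
  have A0 : (0 <= \int[mu]_(x in `]0%R, x1[) grad_density p v x)%E.
    by apply: integral_ge0 => x _; exact: grad_density_ge0.
  move: A0 S; case: (\int[mu]_(x in `]0%R, x1[) grad_density p v x)%E => [a| |]//;
  case: (\int[mu]_(x in `]x1, +oo[) grad_density p v x)%E => [b| |]// _.
  by rewrite lee_fin => S [E]; rewrite lee_fin; lra.
pose w := capped v h x1 x0.
have ew : energy_le p w (K - h `^ p * C + h `^ p / ln 2 `^ (p - 1)).
  apply: (capped_energy p1 x10 (ltW x1x0) (ltW h0) erefl mg g0) kE => a b a0 ab _.
  by apply: seg_le_grad => //; exact: ltW.
have w0 : forall x, 0 < x -> 0 <= w x by apply: capped_ge0 => //; exact: ltW.
have nw : forall x y, 0 < x -> x <= y -> w y <= w x.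
  by apply: capped_noninc => //; exact: ltW.
have wv x : 0 < x -> v x <= w x.
  move=> xx; have [xx1|xx1] := leP x x1; first by rewrite /w capped_left.
  have [xx0|xx0] := leP x x0; last by rewrite after ?w0// ltW.
  have -> : w x = h by apply: capped_mid => //; exact: ltW.
  by apply: nv => //; exact: ltW.
have mLv := adm_measurable_Lp p2 av.
have Lw : (int_lambda th (fun x => (`|w x| `^ p)%R) <= (L + h `^ p * Lam th (2 * x0))%:E)%E.
  rewrite EFinD -(int_lambda_step th0 z20 (ltW hp)).
  apply: (@le_trans _ _ (int_lambda th (fun x => `|v x| `^ p + (if x < 2 * x0 then h `^ p else 0)))).
    apply: int_lambda_le.
    - apply: (@measurableT_comp _ _ _ _ _ _ (fun y : R => `|y| `^ p)).
        by apply: continuous_measurable_fun; exact: continuous_norm_powR.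
      by apply: continuous_measurable_pos; exact: (energy_continuous p1 ew).
    - by apply: measurable_funD => //; exact: measurable_step.
    - by move=> x _; exact: powR_ge0.
    - move=> x xx; rewrite (ger0_norm (w0 x xx)).
      have step0 : 0 <= (if x < 2 * x0 then h `^ p else 0) by case: ifP => // _; exact: ltW.
      have [xx1|xx1] := leP x x1.
        by rewrite /w capped_left// ger0_norm ?v0// lerDl.
      have [xz|zx] := ltP x (2 * x0).
        apply: (@le_trans _ _ (h `^ p)); last by rewrite lerDr powR_ge0.
        apply: ge0_ler_powR; rewrite ?nnegrE ?(ltW p0) ?(ltW h0) ?w0//.
        have -> : h = w x1 by rewrite /w capped_left.
        by apply: nw => //; exact: ltW.
      have xx0 : x0 <= x by apply: le_trans zx; lra.
      have -> : w x = h * log_ramp x0 x by apply: capped_right => //; exact: ltW.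
      by rewrite log_ramp_out// mulr0 powR0 ?gt_eqF// addr0 powR_ge0.
  rewrite int_lambdaD//; first by apply: leeD.
  - exact: measurable_step.
  - by move=> x _; case: ifP => // _; exact: ltW.
have aw : adm p th w (K - h `^ p * C + h `^ p / ln 2 `^ (p - 1)) (L + h `^ p * Lam th (2 * x0)) by [].
have nzw : nonzero w.
  by exists x1 => //; rewrite /w capped_left// gt_eqF.
have budget : W * (K - h `^ p * C + h `^ p / ln 2 `^ (p - 1)) + (L + h `^ p * Lam th (2 * x0)) < 1.
  have -> : W * (K - h `^ p * C + h `^ p / ln 2 `^ (p - 1)) + (L + h `^ p * Lam th (2 * x0)) =
      W * K + L - W * h `^ p.
    by rewrite /C; field; rewrite !gt_eqF// powR_gt0.
  by rewrite KL ltrBlDr ltrDl mulr_gt0.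
have := adm_strict p2 th0 m0 dE d0 aw nzw budget.
apply/negP; rewrite -leNgt -Nd; apply: int_lambda_le.
- by apply: (adm_measurable_comp p2 av (phi := Aabs p m)); exact: continuous_Aabs.
- by apply: (adm_measurable_comp p2 aw (phi := Aabs p m)); exact: continuous_Aabs.
- by move=> x _; exact: Aabs_ge0.
- by move=> x xx; apply: Aabs_homo => //; [exact: v0|exact: wv].
Qed.

End maximizer_properties.

Theorem theorem1p2 (R : realType) (p theta alpha mu : R)
    (hp : 2 <= p) (htheta : 0 <= theta) (halpha : 0 <= alpha) (hmu : 0 < mu)
    (hap : alpha - (p - 1) = 0) (hmu_crit : mu <= mu_crit alpha theta)
    (hcase : (3 <= p /\ 0 < mu < mu_crit alpha theta) \/
             [/\ p = 2, (2%:E / B2 theta < mu%:E)%E & mu < mu_crit alpha theta]) :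
  exists u : R -> R,
    [/\ in_W p alpha theta u,
        forall x : R, 0 < x -> 0 < u x,
        forall x y : R, 0 < x -> x <= y -> u y <= u x,
        norm_W p alpha theta u = 1%E &
        d_sup p theta alpha mu =
          int_lambda theta (fun x => A_fun p mu `|u x|)].
Proof.
have {}hap : alpha = p - 1 by apply/eqP; rewrite -subr_eq0 hap.
move: hcase; rewrite hap => {halpha hmu_crit} hcase.
have mc : mu < mu_crit (p - 1) theta by case: hcase => [[_ /andP[]]|[]].
have gap : ((lead p mu)%:E < d_sup p theta (p - 1) mu)%E.
  case: hcase => [[p3 _]|[pE B _]]; first exact: lead_lt_d_sup.
  by rewrite pE; exact: lead_lt_d_sup2.
have := d_sup_lty hp htheta hmu mc.
case dE : (d_sup p theta (p - 1) mu) gap => [d| |]//; rewrite lte_fin => gap _.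
have d0 : 0 < d by apply: le_lt_trans gap; exact: lead_ge0.
have [v [g [l [av nz gl Nd]]]] := exists_maximizer hp htheta hmu mc dE gap.
have [K [L [aKL KL KE NE]]] := maximizer_saturates hp htheta hmu dE d0 av nz gl Nd.
have vpos := maximizer_positive hp htheta hmu dE d0 aKL nz KL KE Nd.
have [_ nv _ _] := av.
exists v; split => //; first exact: adm_in_W aKL.
rewrite -Nd; apply: eq_int_lambda => x x0.
by rewrite A_funE// ger0_norm// ltW// vpos.
Qed.
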